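(* The half-Hartley transform $$(\mathcal{H}_+ f)(x) = \sqrt{\frac{2}{\pi}} \int_{0}^\infty [\cos(xt)+ \sin(xt)]\, f(t)\, dt, \quad x \in \mathbb{R}_+,$$ extends to a bounded invertible map $\mathcal{H}_+: L_2(\mathbb{R}_+) \to L_2(\mathbb{R}_+)$, and for every $f\in L_2(\mathbb{R}_+)$ and almost all $x \in \mathbb{R}_+$ the following reciprocal formulas hold: $$(\mathcal{H}_+ f)(x) = \sqrt{\frac{2}{\pi}}\, \frac{d}{dx} \int_{0}^\infty [1+\sin(xt) - \cos(xt)]\, \frac{f(t)}{t}\, dt,$$ $$f(x)= \sqrt{\frac{2}{\pi}} \int_0^\infty \left[ \sin(xt)\, S(xt)+ \cos(xt)\, C(xt)\right] (\mathcal{H}_+ f)(t)\, dt,$$ where $S$ and $C$ are the Fresnel sine and cosine integrals $$S(x)= \sqrt{\frac{2}{\pi}} \int_0^{\sqrt{x}} \sin(t^2)\, dt, \qquad C(x)= \sqrt{\frac{2}{\pi}} \int_0^{\sqrt{x}} \cos(t^2)\, dt,$$ and the integral in the second formula converges with respect to the norm in $L_2(\mathbb{R}_+)$. Finally, for every $f\in L_2(\mathbb{R}_+)$ the following norm inequalities hold: $$\sqrt{2}\, \|f\|_{L_2(\mathbb{R}_+)} \le \|\mathcal{H}_+ f\|_{L_2(\mathbb{R}_+)} \le 2\, \|f\|_{L_2(\mathbb{R}_+)}.$$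
   Context: $\mathbb{R}_+=(0,\infty)$ and functions are complex-valued. The integral defining $\mathcal{H}_+ f$ is understood initially for $f$ in the dense subspace $C^{(2)}_c(\mathbb{R}_+)\subset L_2(\mathbb{R}_+)$ of twice continuously differentiable functions of compact support in $\mathbb{R}_+$; the extension is the (unique) continuous extension to $L_2(\mathbb{R}_+)$. An integral $\int_0^\infty$ converging with respect to the norm in $L_2(\mathbb{R}_+)$ means that the truncated integrals $\int_0^N$, as functions of $x$, converge in $L_2(\mathbb{R}_+)$ as $N\to\infty$. *)

(* Defs.v *)
From HB Require Import structures.
From mathcomp Require Import all_boot all_order all_algebra.
From mathcomp Require Import all_classical all_reals all_analysis.
From mathcomp Require Import complex.

Set Implicit Arguments.
Unset Strict Implicit.
Unset Printing Implicit Defensive.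

Import Order.TTheory GRing.Theory Num.Theory numFieldNormedType.Exports.

Local Open Scope classical_set_scope.
Local Open Scope ring_scope.
Local Open Scope complex_scope.

Notation leb R := (@lebesgue_measure R).

Definition Rpos (R : realType) : set R := `]0, +oo[.
Arguments Rpos {R}.

(* The library has no integration theory for R[i]-valued functions:
   measurability, integrals and derivatives are taken componentwise. *)
Definition cmeasurable (R : realType) (D : set R) (f : R -> R[i]) : Prop :=
  measurable_fun D (fun x => complex.Re (f x)) /\
  measurable_fun D (fun x => complex.Im (f x)).

Definition cintegrable (R : realType) (D : set R) (f : R -> R[i]) : Prop :=
  (leb R).-integrable D (fun x => (complex.Re (f x))%:E) /\
  (leb R).-integrable D (fun x => (complex.Im (f x))%:E).

Definition cintegral (R : realType) (D : set R) (f : R -> R[i]) : R[i] :=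
  (\int[leb R]_(x in D) complex.Re (f x)) +i*
  (\int[leb R]_(x in D) complex.Im (f x)).

Definition is_cderive (R : realType) (x : R) (f : R -> R[i]) (l : R[i]) : Prop :=
  is_derive x 1 (fun y => complex.Re (f y)) (complex.Re l) /\
  is_derive x 1 (fun y => complex.Im (f y)) (complex.Im l).

(* The norm `|z| of R[i] is itself an element of R[i], whence its Re.
   An element of L_2(R_+) is represented by a function on R, whose values
   outside R_+ play no role. *)
Definition L2norm (R : realType) (f : R -> R[i]) : \bar R :=
  'N[leb R]_2%:E[(fun x => (complex.Re `|f x|)%:E) \_ Rpos]%E.

Definition inL2 (R : realType) (f : R -> R[i]) : Prop :=
  cmeasurable Rpos f /\ (L2norm f < +oo)%E.

Definition eqL2 (R : realType) (f g : R -> R[i]) : Prop :=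
  f = g %[ae leb R in Rpos].

Definition cvgL2 (R : realType) (F : R -> R -> R[i]) (g : R -> R[i]) : Prop :=
  [/\ forall N : R, 0 < N -> inL2 (F N),
      inL2 g &
      L2norm (fun x => F N x - g x) @[N --> +oo] --> 0%E].

Definition C2_on (R : realType) (D : set R) (u : R -> R) : Prop :=
  forall x, D x ->
    [/\ derivable u x 1, derivable (u^`())%classic x 1 & {for x, continuous (u^`(2))%classic}].

Definition C2c (R : realType) (f : R -> R[i]) : Prop :=
  [/\ C2_on Rpos (fun x => complex.Re (f x)),
      C2_on Rpos (fun x => complex.Im (f x)) &
      exists K : set R,
        [/\ compact K, K `<=` Rpos & forall x, Rpos x -> ~ K x -> f x = 0]].

(* Bounded linear operators of L_2(R_+), acting on representatives. *)
Definition bounded_operatorL2 (R : realType)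
    (H : (R -> R[i]) -> R -> R[i]) : Prop :=
  [/\ forall f, inL2 f -> inL2 (H f),
      forall f g, inL2 f -> inL2 g -> eqL2 f g -> eqL2 (H f) (H g),
      forall (a : R[i]) f g, inL2 f -> inL2 g ->
        eqL2 (H (fun x => a * f x + g x)) (fun x => a * H f x + H g x) &
      exists M : R, forall f, inL2 f -> (L2norm (H f) <= M%:E * L2norm f)%E].

Definition invertibleL2 (R : realType)
    (H : (R -> R[i]) -> R -> R[i]) : Prop :=
  exists G : (R -> R[i]) -> R -> R[i],
    bounded_operatorL2 G /\
    forall f, inL2 f -> eqL2 (G (H f)) f /\ eqL2 (H (G f)) f.

Definition half_hartley (R : realType) (f : R -> R[i]) (x : R) : R[i] :=
  (Num.sqrt (2 / pi))%:C *
  cintegral Rpos (fun t => (cos (x * t) + sin (x * t))%:C * f t).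

Definition bounded_extension (R : realType)
    (H : (R -> R[i]) -> R -> R[i]) : Prop :=
  bounded_operatorL2 H /\ forall f, C2c f -> eqL2 (H f) (half_hartley f).

Definition fresnelS (R : realType) (x : R) : R :=
  Num.sqrt (2 / pi) * \int[leb R]_(t in `[0, Num.sqrt x]) sin (t ^+ 2).

Definition fresnelC (R : realType) (x : R) : R :=
  Num.sqrt (2 / pi) * \int[leb R]_(t in `[0, Num.sqrt x]) cos (t ^+ 2).

Definition derivative_integrand (R : realType) (f : R -> R[i]) (x t : R) : R[i] :=
  (1 + sin (x * t) - cos (x * t))%:C * (f t / t%:C).

Definition inversion_integrand (R : realType) (g : R -> R[i]) (x t : R) : R[i] :=
  (sin (x * t) * fresnelS (x * t) + cos (x * t) * fresnelC (x * t))%:C * g t.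

(* Main.v *)
Require Import Defs.
From HB Require Import structures.
From mathcomp Require Import all_boot all_order all_algebra.
From mathcomp Require Import all_classical all_reals all_analysis.
From mathcomp Require Import measurable_realfun.
From mathcomp Require Import complex ring lra.

Import Order.TTheory GRing.Theory Num.Theory numFieldNormedType.Exports.

Local Open Scope classical_set_scope.
Local Open Scope ring_scope.

Set Implicit Arguments.
Unset Strict Implicit.
Unset Printing Implicit Defensive.

(** All operators act on real-valued functions first; complex functions are
    treated componentwise. Let H be the transform, L the Laplace transform and
    S = L L the Stieltjes operator, with kernel 1/(x+t). Abel summation of
    the integral of (H f)^2 and approximate identities give
    |H f|^2 = 2 |f|^2 + (2/pi) |L f|^2 for Lipschitz f of compact support.
    By the Schur test |L f|^2 <= pi |f|^2, whence both norm bounds and the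
    extension of H to L_2; polarization and the symmetry of H give
    H H = 2 + (2/pi) S.
    Writing 1 = t (2/sqrt pi) \int_0^oo exp(-t^2 q^2) dq in the Fresnel integrals,
    sin u S(u) + cos u C(u) = (cos u + sin u)/2 - (sqrt 2/pi) m(u) with
    m(u) = \int_0^oo q^2 exp(-u q^2)/(1+q^4) dq. The transform of s |-> m(x s) is
    a multiple of t |-> 1/(x+t), so that M, with kernel m(x t), satisfies
    c M H = S/pi for a suitable c, and G = H/2 - c M is a left inverse of H; both
    are symmetric, so G is a two-sided inverse. The inversion integral over
    ]0,N[ is G applied to the truncation of H f to ]0,N[, and the derivative
    formula is Lebesgue differentiation of
    \int_0^x H f = sqrt(2/pi) \int_0^oo (1 + sin(x t) - cos(x t)) f(t)/t dt,
    which passes from nice f to all of L_2 by continuity. *)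

(** * Real square-integrable functions on the half-line *)

(** For [f] in L_2 the integral of cas(x t) f(t), with cas = cos + sin, need not converge
    absolutely. The transform is therefore pinned down by its primitives: the integrated kernel
    decays like 1/t, so it lies in L_2 and its pairing with [f] is continuous, while differentiation
    recovers the transform almost everywhere. The two terms of the norm identity come from cas(x s)
    cas(x t) = cos((s-t)x) + sin((s+t)x). Under damping the first part becomes a Poisson kernel of
    mass pi, and pi times 2/pi gives the 2; the second becomes 1/(s+t). The lower norm bound alone
    would give only injectivity and closed range, so surjectivity needs the explicit inverse. The
    form of that inverse is forced: half of the squared transform is the identity plus S/pi, and the
    excess S/pi has to be produced by another operator composed with the transform. By symmetry the
    transform can be moved onto the kernel m(x t), so it is enough that m be a superposition of
    exponentials whose transform is the resolvent 1/(x+t). *)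

Section LebesgueR.
Variable R : realType.
Local Notation mu := (@lebesgue_measure R).
Local Notation intg D f := (mu.-integrable D (EFin \o f)).
Implicit Types (f g h : R -> R) (D : set R).

Lemma intgD D f g : measurable D -> intg D f -> intg D g ->
  intg D (fun x => f x + g x).
Proof. by move=> mD; exact: (@integrableD _ _ _ mu). Qed.

Lemma intgB D f g : measurable D -> intg D f -> intg D g ->
  intg D (fun x => f x - g x).
Proof. by move=> mD; exact: (@integrableB _ _ _ mu). Qed.

Lemma intgZl D a f : measurable D -> intg D f -> intg D (fun x => a * f x).
Proof. by move=> mD; exact: (@integrableZl _ _ _ mu). Qed.

Lemma intgZr D a f : measurable D -> intg D f -> intg D (fun x => f x * a).
Proof.
by move=> mD /(intgZl a mD); apply: eq_integrable => // x _ /=; rewrite mulrC.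
Qed.

Lemma intg_le D f g : measurable D -> measurable_fun D f ->
  (forall x, D x -> `|f x| <= g x) -> intg D g -> intg D f.
Proof.
move=> mD mf fg; apply: le_integrable => //; first exact/measurable_EFinP.
by move=> x Dx /=; rewrite lee_fin (le_trans (fg _ Dx))// ler_norm.
Qed.

Lemma intg_eq D f g : measurable D -> (forall x, D x -> f x = g x) ->
  intg D f -> intg D g.
Proof. by move=> mD fg; apply: eq_integrable => // x /set_mem Dx /=; rewrite fg. Qed.

Lemma intgS D E f : measurable D -> measurable E -> D `<=` E ->
  intg E f -> intg D f.
Proof. by move=> mD mE; exact: (@integrableS _ _ _ mu). Qed.

Lemma intg_meas D f : intg D f -> measurable_fun D f.
Proof. by move=> H; apply/measurable_EFinP; exact: measurable_int H. Qed.

Lemma intgM D f g c : measurable D -> measurable_fun D f ->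
  (forall x, D x -> `|f x| <= c) -> intg D g -> intg D (fun x => f x * g x).
Proof.
move=> mD mf fc Hg; apply: (@intg_le _ _ (fun x => c * `|g x|)) => //.
- by apply: measurable_funM => //; exact: intg_meas Hg.
- by move=> x Dx; rewrite normrM ler_wpM2r ?fc.
- by apply: intgZl => //; exact: (@integrable_norm _ _ _ mu).
Qed.

Lemma aeS (P Q : R -> Prop) : (forall x, P x -> Q x) ->
  {ae mu, forall x, P x} -> {ae mu, forall x, Q x}.
Proof. exact: (@filterS _ _ (ae_filter_ringOfSetsType mu)). Qed.

Lemma aeS2 (P Q S : R -> Prop) : (forall x, P x -> Q x -> S x) ->
  {ae mu, forall x, P x} -> {ae mu, forall x, Q x} -> {ae mu, forall x, S x}.
Proof. exact: (@filterS2 _ _ (ae_filter_ringOfSetsType mu)). Qed.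

Lemma RintE D f : measurable D -> intg D f ->
  (\int[mu]_(x in D) f x)%:E = (\int[mu]_(x in D) (f x)%:E)%E.
Proof. by move=> mD Hf; rewrite /Rintegral fineK//; exact: integrable_fin_num. Qed.

Lemma Rint_eq D f g : (forall x, D x -> f x = g x) ->
  \int[mu]_(x in D) f x = \int[mu]_(x in D) g x.
Proof. by move=> fg; apply: eq_Rintegral => x /set_mem /fg. Qed.

Lemma Rint_ae_eq D f g : measurable D -> measurable_fun D f -> measurable_fun D g ->
  {ae mu, forall x, D x -> f x = g x} ->
  \int[mu]_(x in D) f x = \int[mu]_(x in D) g x.
Proof.
move=> mD mf mg fg; congr fine; apply: ae_eq_integral => //.
- exact/measurable_EFinP.
- exact/measurable_EFinP.
- by apply: aeS fg => x fg Dx; rewrite /= fg.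
Qed.

Lemma intg_ae_eq D f g : measurable D -> measurable_fun D g ->
  {ae mu, forall x, D x -> f x = g x} -> intg D f -> intg D g.
Proof.
move=> mD mg fg /integrableP[mf fi]; apply/integrableP; split.
  exact/measurable_EFinP.
suff -> : (\int[mu]_(x in D) `|(EFin \o g) x| = \int[mu]_(x in D) `|(EFin \o f) x|)%E.
  by [].
apply: ae_eq_integral => //.
- by apply: measurableT_comp => //; exact/measurable_EFinP.
- by apply: measurableT_comp.
- by apply: aeS fg => x fg Dx /=; rewrite fg.
Qed.

Lemma normr_Rint_le D f g : measurable D -> intg D f -> intg D g ->
  (forall x, D x -> `|f x| <= g x) ->
  `|\int[mu]_(x in D) f x| <= \int[mu]_(x in D) g x.
Proof.
move=> mD Hf Hg fg; apply: (le_trans (@le_normr_Rintegral _ _ _ mu _ _ mD Hf)).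
by apply: le_Rintegral => //; exact: (@integrable_norm _ _ _ mu).
Qed.

Lemma intg_cst D c : measurable D -> (mu D < +oo)%E -> intg D (cst c).
Proof.
move=> mD muD; apply: measurable_bounded_integrable => //.
by exists `|c|; split; rewrite ?num_real// => z cz x _ /=; exact: ltW.
Qed.

Lemma intg_bnd D f c : measurable D -> (mu D < +oo)%E -> measurable_fun D f ->
  (forall x, D x -> `|f x| <= c) -> intg D f.
Proof. by move=> mD muD mf fc; apply: (intg_le mD mf fc); exact: intg_cst. Qed.

End LebesgueR.

(** * Inner product and norm of real square-integrable functions *)

Section RealL2.
Variable R : realType.
Local Notation mu := (@lebesgue_measure R).
Local Notation intg D f := (mu.-integrable D (EFin \o f)).
Implicit Types (f g h : R -> R).

Definition sqint f :=
  measurable_fun Rpos f /\ mu.-integrable Rpos (EFin \o (fun x => f x ^+ 2)).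

Definition ip f g : R := \int[mu]_(x in Rpos) (f x * g x).

Definition nrm f : R := Num.sqrt (ip f f).

Lemma measurable_Rpos : measurable (@Rpos R).
Proof. exact: measurable_itv. Qed.
Hint Resolve measurable_Rpos : core.

Lemma in_Rpos (x : R) : Rpos x = (0 < x) :> Prop.
Proof. by rewrite /Rpos /= in_itv /= andbT. Qed.

Lemma sqint_mul f g : sqint f -> sqint g -> intg Rpos (fun x => f x * g x).
Proof.
move=> [mf f2] [mg g2]; apply: intg_le (intgD _ f2 g2) => //.
  exact: measurable_funM.
by move=> x _ /=; rewrite ler_norml; apply/andP; split; nra.
Qed.

Lemma sqintD f g : sqint f -> sqint g -> sqint (f + g).
Proof.
move=> Hf Hg; split; first exact: (measurable_funD Hf.1 Hg.1).
have fg := sqint_mul Hf Hg.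
apply: intg_eq (intgD _ (intgD _ Hf.2 Hg.2) (intgD _ fg fg)) => // x _ /=.
by rewrite !fctE; ring.
Qed.

Lemma sqintZ a f : sqint f -> sqint (a *: f).
Proof.
move=> Hf; split; first exact: (measurable_funM (measurable_cst a) Hf.1).
by apply: intg_eq (intgZl (a ^+ 2) _ Hf.2) => // x _ /=; rewrite -exprMn.
Qed.

Lemma sqintN f : sqint f -> sqint (- f).
Proof. by move=> Hf; rewrite -scaleN1r; exact: sqintZ. Qed.

Lemma sqintB f g : sqint f -> sqint g -> sqint (f - g).
Proof. by move=> Hf /sqintN; exact: sqintD. Qed.

Lemma ipC f g : ip f g = ip g f.
Proof. by apply: eq_Rintegral => x _; rewrite mulrC. Qed.

Lemma ipDl f g h : sqint f -> sqint g -> sqint h ->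
  ip (f + g) h = ip f h + ip g h.
Proof.
move=> Hf Hg Hh; rewrite /ip -RintegralD//; [|exact: sqint_mul..].
by apply: eq_Rintegral => x _; rewrite -mulrDl.
Qed.

Lemma ipZl a f h : sqint f -> sqint h -> ip (a *: f) h = a * ip f h.
Proof.
move=> Hf Hh; rewrite /ip -RintegralZl//; last exact: sqint_mul.
by apply: eq_Rintegral => x _; rewrite mulrA.
Qed.

Lemma ipDr f g h : sqint f -> sqint g -> sqint h ->
  ip h (f + g) = ip h f + ip h g.
Proof. by move=> *; rewrite ipC ipDl// !(ipC _ h). Qed.

Lemma ipZr a f h : sqint f -> sqint h -> ip h (a *: f) = a * ip h f.
Proof. by move=> *; rewrite ipC ipZl// ipC. Qed.

Lemma ipBl f g h : sqint f -> sqint g -> sqint h ->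
  ip (f - g) h = ip f h - ip g h.
Proof.
by move=> *; rewrite -scaleN1r ipDl// ?ipZl ?mulN1r//; exact: sqintZ.
Qed.

Lemma ipBr f g h : sqint f -> sqint g -> sqint h ->
  ip h (f - g) = ip h f - ip h g.
Proof. by move=> *; rewrite ipC ipBl// !(ipC _ h). Qed.

Lemma ip_ge0 f : 0 <= ip f f.
Proof. by apply: Rintegral_ge0 => x _; rewrite -expr2 sqr_ge0. Qed.

Lemma nrm_ge0 f : 0 <= nrm f. Proof. exact: sqrtr_ge0. Qed.

Lemma nrm2 f : nrm f ^+ 2 = ip f f.
Proof. by rewrite sqr_sqrtr ?ip_ge0. Qed.

Lemma cauchy_schwarz_sqr f g : sqint f -> sqint g ->
  ip f g ^+ 2 <= ip f f * ip g g.
Proof.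
move=> Hf Hg.
have Q (a b : R) : 0 <= a ^+ 2 * ip f f + 2 * a * b * ip f g + b ^+ 2 * ip g g.
  have := ip_ge0 (a *: f + b *: g).
  have Ha := sqintZ a Hf; have Hb := sqintZ b Hg.
  rewrite ipDl ?ipDr//; [|exact: sqintD..].
  by rewrite !ipZl// !ipZr// (ipC g f) => /le_trans; apply; nra.
have := ip_ge0 f; have := ip_ge0 g.
set A := ip f f in Q *; set B := ip f g in Q *; set C := ip g g in Q *.
move=> C0 A0; have [A1|A1] := ltP 0 A; last first.
  have {A0 A1}A00 : A = 0 by apply/eqP; rewrite eq_le A0 A1.
  rewrite A00 in Q *; have [/eqP ->|B0] := boolP (B == 0); first by rewrite expr0n /= mul0r.
  (* With [A = 0] the form is affine in its first argument; this choice gives it the value -1. *)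
  have := Q (- (C + 1) / (2 * B)) 1.
  rewrite (_ : 2 * (- (C + 1) / (2 * B)) * 1 * B = - (C + 1)); last by field.
  by move=> ?; exfalso; lra.
have := Q (- B) A; have -> : (- B) ^+ 2 * A + 2 * - B * A * B + A ^+ 2 * C = A * (A * C - B ^+ 2).
  by ring.
by rewrite pmulr_rge0// subr_ge0.
Qed.

Lemma cauchy_schwarz f g : sqint f -> sqint g -> `|ip f g| <= nrm f * nrm g.
Proof.
move=> Hf Hg; rewrite -(ler_pXn2r (n := 2)) ?nnegrE ?mulr_ge0 ?nrm_ge0//.
by rewrite exprMn !nrm2 -normrX ger0_norm ?sqr_ge0// cauchy_schwarz_sqr.
Qed.

Lemma nrmD f g : sqint f -> sqint g -> nrm (f + g) <= nrm f + nrm g.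
Proof.
move=> Hf Hg; rewrite -(ler_pXn2r (n := 2)) ?nnegrE ?addr_ge0 ?nrm_ge0//.
rewrite nrm2 ipDl ?ipDr//; [|exact: sqintD..].
have := cauchy_schwarz Hf Hg; rewrite ler_norml => /andP[_].
by rewrite (ipC g f) -!nrm2; nra.
Qed.

Lemma nrmZ a f : sqint f -> nrm (a *: f) = `|a| * nrm f.
Proof.
move=> Hf; rewrite /nrm ipZl ?ipZr//; last exact: sqintZ.
by rewrite mulrA -expr2 sqrtrM ?sqr_ge0// sqrtr_sqr.
Qed.

Lemma nrmN f : sqint f -> nrm (- f) = nrm f.
Proof. by move=> Hf; rewrite -scaleN1r nrmZ// normrN1 mul1r. Qed.

Lemma nrmB f g : sqint f -> sqint g -> nrm (f - g) = nrm (g - f).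
Proof. by move=> Hf Hg; rewrite -opprB nrmN//; exact: sqintB. Qed.

Lemma nrm_dist f g : sqint f -> sqint g -> `|nrm f - nrm g| <= nrm (f - g).
Proof.
move=> Hf Hg; have H1 := nrmD (sqintB Hf Hg) Hg.
have H2 := nrmD (sqintB Hg Hf) Hf.
rewrite !subrK (nrmB Hg Hf) in H1 H2.
by rewrite ler_norml; apply/andP; split; lra.
Qed.

Lemma eq_ip f f' g g' : {ae mu, forall x, Rpos x -> f x = f' x} ->
  {ae mu, forall x, Rpos x -> g x = g' x} ->
  sqint f -> sqint f' -> sqint g -> sqint g' -> ip f g = ip f' g'.
Proof.
move=> ff gg Hf Hf' Hg Hg'; apply: Rint_ae_eq => //.
- exact: (measurable_funM Hf.1 Hg.1).
- exact: (measurable_funM Hf'.1 Hg'.1).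
- by apply: aeS2 ff gg => x ff gg Dx; rewrite ff// gg.
Qed.

Lemma eq_sqint f f' : measurable_fun Rpos f' ->
  {ae mu, forall x, Rpos x -> f x = f' x} -> sqint f -> sqint f'.
Proof.
move=> mf' ff [mf f2]; split => //; apply: intg_ae_eq f2 => //.
  exact: measurable_funX.
by apply: aeS ff => x ff Dx /=; rewrite ff.
Qed.

Lemma nrm0_ae f : sqint f -> nrm f = 0 -> {ae mu, forall x, Rpos x -> f x = 0}.
Proof.
move=> Hf f0; have : (\int[mu]_(x in Rpos) `|(f x ^+ 2)%:E| = 0)%E.
  transitivity ((ip f f)%:E); last by rewrite -nrm2 f0 expr0n.
  rewrite /ip /Rintegral fineK; last by apply: integrable_fin_num => //; exact: sqint_mul.
  by apply: eq_integral => x _ /=; rewrite ger0_norm ?sqr_ge0.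
have mf2 : measurable_fun Rpos (EFin \o (fun x => f x ^+ 2)) := measurable_int _ Hf.2.
move=> /(@ae_eq_integral_abs _ _ _ mu _ measurable_Rpos _ mf2).1; apply: aeS => x /= + Dx.
by move=> /(_ Dx) [] /eqP; rewrite sqrf_eq0 => /eqP.
Qed.

End RealL2.
#[global] Hint Extern 0 (measurable Rpos) => exact: measurable_Rpos : core.
#[global] Hint Extern 0 (measurable _) => solve [exact: measurable_Rpos] : core.

(** * Dominated convergence and Fubini for real-valued integrals *)

Section Tools.
Variable R : realType.
Local Notation mu := (@lebesgue_measure R).
Local Notation intg D f := (mu.-integrable D (EFin \o f)).
Implicit Types (f g h u v : R -> R) (A B D : set R).

Lemma Rint_dct D (F : nat -> R -> R) f g : measurable D ->
  (forall n, measurable_fun D (F n)) -> measurable_fun D f ->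
  {ae mu, forall x, D x -> F n x @[n --> \oo] --> f x} ->
  intg D g -> (forall n x, D x -> `|F n x| <= g x) ->
  intg D f /\
  \int[mu]_(x in D) F n x @[n --> \oo] --> \int[mu]_(x in D) f x.
Proof.
move=> mD mF mf Ff Hg Fg.
have [|||||Hf _ cF] := @dominated_convergence _ _ _ mu D mD
  (fun n => EFin \o F n) (EFin \o f) (EFin \o g).
- by move=> n; apply/measurable_EFinP; exact: mF.
- exact/measurable_EFinP.
- by apply: aeS Ff => x Ff Dx; apply: cvg_EFin; [exact: nearW|exact: Ff].
- exact: Hg.
- by apply/aeW => x n Dx /=; rewrite lee_fin Fg.
split => //; move: cF; rewrite -(RintE mD Hf) => /fine_cvg; exact.
Qed.

(** Serves where no dominating function is at hand: a uniform bound on the integrals alone makes the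
    limit integrable. The conclusion has [|f x|] because the limit is known to be nonnegative only
    almost everywhere. *)
Lemma Rint_fatou D (F : nat -> R -> R) f c : measurable D ->
  (forall n, intg D (F n)) -> measurable_fun D f ->
  (forall n x, D x -> 0 <= F n x) ->
  {ae mu, forall x, D x -> F n x @[n --> \oo] --> f x} ->
  (forall n, \int[mu]_(x in D) F n x <= c) ->
  intg D f /\ \int[mu]_(x in D) `|f x| <= c.
Proof.
move=> mD iF mf F0 Ff Fc.
have mF n : measurable_fun D (EFin \o F n) by exact: measurable_int (iF n).
have F0' n x : D x -> (0 <= (EFin \o F n) x)%E by move=> Dx; rewrite lee_fin F0.
have H := @fatou _ _ _ mu D mD (fun n => EFin \o F n) mF F0'.
have E : (\int[mu]_(x in D) `|(f x)%:E| <= c%:E)%E.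
  rewrite (_ : (\int[mu]_(x in D) _ = \int[mu]_(x in D) limn_einf (fun n => (F n x)%:E))%E).
    apply: (le_trans H); apply: le_trans (limn_einf_sup _) _.
    rewrite limn_esup_lim; apply: lime_le; first exact: is_cvg_esups.
    apply: nearW => n; apply: ub_ereal_sup => _ [k /= _ <-].
    by rewrite -RintE// lee_fin.
  apply: ae_eq_integral => //.
  - by apply: measurableT_comp => //; exact/measurable_EFinP.
  - have mN n : measurable_fun D (fun x => (- (F n x)%:E)%E).
      by apply: measurableT_comp => //; exact: mF.
    by apply: measurableT_comp => //; exact: (measurable_fun_limn_esup mN).
  apply: aeS Ff => x Ff Dx; have /= Fx := Ff Dx.
  have Fx' : (F n x)%:E @[n --> \oo] --> (f x)%:E by apply: cvg_EFin; [exact: nearW|].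
  have f0 : 0 <= f x by apply: (cvgr_to_ge Fx); apply: nearW => n; exact: F0.
  rewrite ger0_norm// is_cvg_limn_einfE; last by apply/cvg_ex; exists (f x)%:E.
  by apply/esym/cvg_lim.
have iff : intg D f.
  by apply/integrableP; split; [exact/measurable_EFinP|apply: le_lt_trans E _; rewrite ltry].
split => //; rewrite -lee_fin RintE//.
exact: (@integrable_norm _ _ _ mu).
Qed.

(** The form in which an operator with kernel [K] is moved across the pairing of [u] and [v]. The
    majorant [w] of the inner absolute integrals reduces absolute convergence on the plane to one
    condition in one variable. Sections are integrable at every point because [Rintegral] is the
    finite part of an extended integral, and a factor is pulled out through [RintE]. *)
Lemma Fubini_kernel A B (K : R -> R -> R) u v w :
  measurable A -> measurable B ->
  measurable_fun setT (fun z : R * R => K z.1 z.2) ->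
  measurable_fun A u -> measurable_fun B v ->
  (forall x, A x -> intg B (fun y => K x y * v y)) ->
  (forall y, B y -> intg A (fun x => K x y * u x)) ->
  (forall x, A x -> \int[mu]_(y in B) `|K x y * v y| <= w x) ->
  intg A (fun x => `|u x| * w x) ->
  [/\ intg A (fun x => u x * \int[mu]_(y in B) (K x y * v y)),
      intg B (fun y => v y * \int[mu]_(x in A) (K x y * u x)) &
      \int[mu]_(x in A) (u x * \int[mu]_(y in B) (K x y * v y)) =
      \int[mu]_(y in B) (v y * \int[mu]_(x in A) (K x y * u x))].
Proof.
move=> mA mB mK mu_ mv Kv Ku Kw iw.
(* Extending [u] and [v] by zero moves the problem to the whole plane, where Fubini's theorem is
   applied. *)
have mF' : measurable_fun setT (fun z => (u \_ A) z.1 * (K z.1 z.2 * (v \_ B) z.2)).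
  apply: measurable_funM.
    by apply: measurableT_comp => //; exact/(measurable_restrictT _ _).1.
  apply: measurable_funM => //.
  by apply: measurableT_comp => //; exact/(measurable_restrictT _ _).1.
have fin : (\int[mu]_(x in A) \int[mu]_(y in B) `|u x * (K x y * v y)|%:E < +oo)%E.
  apply: (@le_lt_trans _ _ (\int[mu]_(x in A) (`|u x| * w x)%:E)%E); last exact: integrable_lty.
  apply: ge0_le_integral => //.
  - by move=> x Ax; apply: integral_ge0 => y By.
  - apply: (eq_measurable_fun (fun x => \int[mu]_y `|(u \_ A) x * (K x y * (v \_ B) y)|%:E)%E).
      move=> x Ax; rewrite [RHS]integral_mkcond; apply: eq_integral => y _ /=.
      by rewrite !patchE Ax; case: ifPn => // _; rewrite !mulr0 normr0.
    apply: measurable_funTS.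
    apply: (@measurable_fun_fubini_tonelli_F _ _ _ _ R mu
      (fun z => `|(u \_ A) z.1 * (K z.1 z.2 * (v \_ B) z.2)|%:E)%E) => //.
    by apply/measurable_EFinP; apply: measurableT_comp.
  - exact: measurable_int iw.
  - move=> x Ax; apply: (@le_trans _ _ (`|u x|%:E * (\int[mu]_(y in B) `|K x y * v y|)%:E)%E); last first.
      by rewrite -EFinM lee_fin ler_wpM2l// Kw.
    have iKv := @integrable_norm _ _ _ mu _ _ (Kv _ Ax).
    rewrite RintE// -ge0_integralZl//; last exact: measurable_int iKv.
    rewrite (_ : \int[mu]_(y in B) _ = \int[mu]_(y in B) (`|u x|%:E * `|K x y * v y|%:E))%E//.
    by apply: eq_integral => y _; rewrite normrM.
pose F z := (u \_ A) z.1 * (K z.1 z.2 * (v \_ B) z.2).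
have mF : measurable_fun setT F := mF'.
have Fx x : (\int[mu]_y (F (x, y))%:E)%E =
    (((fun x => u x * \int[mu]_(y in B) (K x y * v y)) \_ A) x)%:E.
  rewrite /F /= !patchE; case: ifPn => [/set_mem Ax|_]; last first.
    by apply: integral0_eq => y _; rewrite mul0r.
  rewrite EFinM RintE//; last exact: Kv.
  rewrite -integralZl//; last exact: Kv.
  rewrite [RHS]integral_mkcond; apply: eq_integral => y _.
  by rewrite !patchE; case: ifPn => // _; rewrite !mulr0.
have Fy y : (\int[mu]_x (F (x, y))%:E)%E =
    (((fun y => v y * \int[mu]_(x in A) (K x y * u x)) \_ B) y)%:E.
  rewrite /F /= !patchE; case: ifPn => [/set_mem By|_]; last first.
    by apply: integral0_eq => x _; rewrite !mulr0.
  rewrite EFinM RintE//; last exact: Ku.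
  rewrite -integralZl//; last exact: Ku.
  rewrite [RHS]integral_mkcond; apply: eq_integral => x _.
  rewrite !patchE; case: ifPn => // _; last by rewrite mul0r.
  by rewrite -EFinM; congr EFin; ring.
have iF : (mu \x mu)%E.-integrable setT (EFin \o F).
  apply/integrable12ltyP; first exact/measurable_EFinP.
  apply: le_lt_trans fin; rewrite [leRHS]integral_mkcond.
  rewrite le_eqVlt; apply/orP; left; apply/eqP.
  rewrite /F; apply: eq_integral => x _ /=; rewrite !patchE.
  case: ifPn => // _; last by apply: integral0_eq => y _; rewrite mul0r normr0.
  rewrite [RHS]integral_mkcond; apply: eq_integral => y _ /=.
  by rewrite !patchE; case: ifPn => // _; rewrite !mulr0 normr0.
(* The function with swapped variables gives integrability of the second iterated integral. *)
have iF' : (mu \x mu)%E.-integrable setT (EFin \o (F \o unstable.swap)).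
  apply/integrable12ltyP.
    by apply/measurable_EFinP/measurableT_comp => //; exact: measurable_swap.
  by move/integrable21ltyP : iF; apply; exact/measurable_EFinP.
have H1 := integrable_fubini_F iF; have H2 := integrable_fubini_F iF'.
have H3 := Fubini iF.
split.
- apply/(@integrable_mkcond _ _ _ mu _ _ mA); rewrite restrict_EFin.
  by apply: eq_integrable H1 => // x _; rewrite /fubini_F /= Fx.
- apply/(@integrable_mkcond _ _ _ mu _ _ mB); rewrite restrict_EFin.
  by apply: eq_integrable H2 => // x _; rewrite /fubini_F /= Fy.
- rewrite Rintegral_mkcond [RHS]Rintegral_mkcond; congr fine.
  rewrite /= in H3; under eq_integral do rewrite -Fx.
  by rewrite H3; apply: eq_integral => y _; exact: Fy.
Qed.

(** A bounded kernel admits the constant majorant [c] times the integral of |v|. This covers cas,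
    which is bounded by 2 but does not decay. *)
Lemma Fubini_bounded A B (K : R -> R -> R) u v c :
  measurable A -> measurable B ->
  measurable_fun setT (fun z : R * R => K z.1 z.2) ->
  intg A u -> intg B v -> (forall x y, A x -> B y -> `|K x y| <= c) ->
  [/\ intg A (fun x => u x * \int[mu]_(y in B) (K x y * v y)),
      intg B (fun y => v y * \int[mu]_(x in A) (K x y * u x)) &
      \int[mu]_(x in A) (u x * \int[mu]_(y in B) (K x y * v y)) =
      \int[mu]_(y in B) (v y * \int[mu]_(x in A) (K x y * u x))].
Proof.
move=> mA mB mK Hu Hv Kc.
have mK1 x : measurable_fun setT (K x).
  by apply: (measurableT_comp (f := fun z : R * R => K z.1 z.2) mK (g := pair x)); exact: pair1_measurable.
have mK2 y : measurable_fun setT (K ^~ y).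
  by apply: (measurableT_comp (f := fun z : R * R => K z.1 z.2) mK (g := fun x => (x, y))); exact: pair2_measurable.
have Kv x : A x -> intg B (fun y => K x y * v y).
  move=> Ax; apply: (@intgM _ _ _ _ c) => //; first exact: measurable_funTS.
  by move=> y By; exact: Kc.
have Ku y : B y -> intg A (fun x => K x y * u x).
  move=> By; apply: (@intgM _ _ _ _ c) => //; first exact: measurable_funTS.
  by move=> x Ax; exact: Kc.
have Nv := @integrable_norm _ _ _ mu _ _ Hv.
have Nu := @integrable_norm _ _ _ mu _ _ Hu.
apply: (@Fubini_kernel _ _ _ _ _ (fun=> c * \int[mu]_(y in B) `|v y|)) => //.
- exact: intg_meas Hu.
- exact: intg_meas Hv.
- move=> x Ax; rewrite -RintegralZl//; apply: le_Rintegral => //.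
  + exact: (@integrable_norm _ _ _ mu _ _ (Kv _ Ax)).
  + exact: intgZl.
  + by move=> y By; rewrite normrM ler_wpM2r// Kc.
- exact: (@intgZr _ _ _ (fun x => `|u x|)).
Qed.

(** Tonelli applied to the positive and negative parts gives measurability even across points [x]
    whose section is not integrable; [fine] is measurable and absorbs infinite values. *)
Lemma measurable_Rint B (K : R -> R -> R) v : measurable B ->
  measurable_fun setT (fun z : R * R => K z.1 z.2) -> measurable_fun B v ->
  measurable_fun setT (fun x => \int[mu]_(y in B) (K x y * v y)).
Proof.
move=> mB mK mv; pose F z := (K z.1 z.2 * (v \_ B) z.2)%:E.
have mF : measurable_fun setT F.
  apply/measurable_EFinP/measurable_funM => //.
  by apply: measurableT_comp => //; exact/(measurable_restrictT _ _).1.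
rewrite (_ : (fun x => _) = fine \o (fun x => \int[mu]_y (F^\+ (x, y)) - \int[mu]_y (F^\- (x, y)))%E).
  apply: measurableT_comp => //; apply: emeasurable_funB.
  - by apply: (@measurable_fun_fubini_tonelli_F _ _ _ _ R mu F^\+%E) => //; exact: measurable_funepos.
  - by apply: (@measurable_fun_fubini_tonelli_F _ _ _ _ R mu F^\-%E) => //; exact: measurable_funeneg.
apply/funext => x; rewrite Rintegral_mkcond /Rintegral /= integralE; congr (fine (_ - _)%E).
- apply: eq_integral => y _; rewrite !funeposE /F /= !patchE.
  by case: ifPn => // _; rewrite mulr0.
- apply: eq_integral => y _; rewrite !funenegE /F /= !patchE.
  by case: ifPn => // _; rewrite mulr0.
Qed.

End Tools.

(** * Derivatives and the fundamental theorem of calculus *)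

Section Calculus.
Variable R : realType.
Local Notation mu := (@lebesgue_measure R).
Local Notation intg D f := (mu.-integrable D (EFin \o f)).
Implicit Types (f g F : R -> R).

Lemma cont_meas f D : continuous f -> measurable_fun D f.
Proof. by move=> cf; apply: measurable_funTS; exact: continuous_measurable_fun. Qed.

Lemma mu_itv_fin (a b : R) (b0 b1 : bool) :
  (mu [set` Interval (BSide b0 a) (BSide b1 b)] < +oo)%E.
Proof. by rewrite lebesgue_measure_itv /=; case: ifP => _; rewrite ?ltry// -EFinD ltry. Qed.

Lemma cont_intg f (a b : R) : continuous f -> intg `[a, b] f.
Proof. by move=> cf; apply: continuous_compact_integrable; [exact: segment_compact|exact: continuous_subspaceT]. Qed.

Lemma is_derive_cont F (f : R -> R) : (forall x : R, is_derive x 1 F (f x)) -> continuous F.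
Proof.
by move=> dF x; apply/differentiable_continuous/derivable1_diffP; case: (dF x).
Qed.

Lemma FTC2 f F (a b : R) : a < b -> (forall x : R, is_derive x 1 F (f x)) -> continuous f ->
  \int[mu]_(x in `[a, b]) f x = F b - F a.
Proof.
move=> ab dF cf; have cF := is_derive_cont dF.
rewrite /Rintegral (@continuous_FTC2 _ f F)//.
- exact: continuous_subspaceT.
- split=> [x _||]; [by case: (dF x)|exact/cvg_at_right_filter/cF|exact/cvg_at_left_filter/cF].
- by move=> x _; rewrite derive1E; case: (dF x).
Qed.

Lemma open_Rpos : open (@Rpos R).
Proof. by rewrite /Rpos; apply: interval_open. Qed.

Lemma Rpos_setI (a : R) : Rpos `&` `[0, a]%classic = `]0, a]%classic :> set R.
Proof.
apply/seteqP; split => x; rewrite /= in_Rpos !in_itv /=; first by case=> -> /andP[_ ->].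
by move=> /andP[x0 ->]; rewrite x0 ltW.
Qed.

Lemma FTC2y f F l : (forall x : R, is_derive x 1 F (f x)) -> continuous f ->
  F x @[x --> +oo] --> l -> intg Rpos f -> \int[mu]_(x in Rpos) f x = l - F 0.
Proof.
move=> dF cf Fl Hf.
(* [n.+1] keeps the interval of truncation nondegenerate, as [FTC2] demands. *)
have [|||||_ H] := @Rint_dct _ Rpos (fun n => f \_ `[0, n.+1%:R]) f (fun x => `|f x|) (@measurable_Rpos R).
- move=> n; apply: measurable_funTS; apply/(measurable_restrictT _ _).1 => //.
  exact: cont_meas.
- exact: cont_meas.
- apply/aeW => x x0; apply: cvg_near_cst; near=> n.
  rewrite patchE ifT// inE /= in_itv /=; move: x0; rewrite in_Rpos => /ltW -> /=.
  rewrite (@le_trans _ _ n%:R)// ?ler_nat//; near: n; exact: nbhs_infty_ger.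
- exact: (@integrable_norm _ _ _ mu).
- by move=> n x _; rewrite patchE; case: ifPn => // _; rewrite normr0.
have E n : \int[mu]_(x in Rpos) (f \_ `[0, n.+1%:R]) x = F n.+1%:R - F 0.
  rewrite -Rintegral_mkcondr.
  rewrite Rpos_setI Rintegral_itv_obnd_cbnd; first exact: FTC2.
  apply: (@intgS _ _ `[0, n.+1%:R]) => //; last exact: cont_intg.
  by move=> x /=; rewrite !in_itv /= => /andP[/ltW -> ->].
move: H; rewrite (eq_cvg _ _ E) => H; apply: (cvg_unique _ H) => //.
apply: cvgB; last exact: cvg_cst.
apply: (@cvg_comp _ _ _ (fun n => n.+1%:R) F _ +oo) => //.
by rewrite (cvg_shiftS (fun n => n%:R : R)); exact: cvgr_idn.
Unshelve. all: by end_near. Qed.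

(** Nonnegativity turns the existence of the limit of [F] into integrability. All conditions are
    confined to the half-line because primitives such as -1/(x+t) have poles on the negative
    axis. *)
Lemma FTC2y_ge0 f F l : (forall x : R, 0 < x -> is_derive x 1 F (f x)) ->
  (forall x : R, 0 <= x -> {for x, continuous F}) ->
  (forall x : R, 0 <= x -> {for x, continuous f}) ->
  (forall x, 0 <= x -> 0 <= f x) ->
  F x @[x --> +oo] --> l -> intg Rpos f /\ \int[mu]_(x in Rpos) f x = l - F 0.
Proof.
move=> dF cF cf f0 Fl.
have mf : measurable_fun Rpos f.
  apply: open_continuous_measurable_fun; first exact: open_Rpos.
  by move=> x; rewrite inE in_Rpos => /ltW /cf.
have H : (\int[mu]_(x in Rpos) (f x)%:E = l%:E - (F 0)%:E)%E.
  rewrite integral_itv_obnd_cbnd; last exact/measurable_EFinP.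
  apply: ge0_continuous_FTC2y => //.
  - apply/continuous_within_itvcyP; split => [x|].
      by rewrite in_itv /= andbT => /ltW /cf.
    exact/cvg_at_right_filter/cf.
  - by move=> x x0; case: (dF x x0).
  - exact/cvg_at_right_filter/cF.
  - by move=> x; rewrite in_itv /= andbT derive1E => x0; case: (dF x x0).
split; last by rewrite /Rintegral H.
apply/integrableP; split; first exact/measurable_EFinP.
rewrite (_ : (\int[mu]_(x in Rpos) _ = \int[mu]_(x in Rpos) (f x)%:E)%E); first by rewrite H -EFinD ltry.
apply: eq_integral => x; rewrite inE in_Rpos => /ltW /f0 fx0.
by rewrite /= ger0_norm.
Qed.

Lemma FTC2y_ge0' f F l : (forall x : R, is_derive x 1 F (f x)) -> continuous f ->
  (forall x, 0 <= x -> 0 <= f x) ->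
  F x @[x --> +oo] --> l -> intg Rpos f /\ \int[mu]_(x in Rpos) f x = l - F 0.
Proof.
move=> dF cf f0 Fl; apply: FTC2y_ge0 => // x _; last exact: cf.
exact: is_derive_cont dF x.
Qed.

End Calculus.

(** * Differentiation rules for lambda terms and a derivative tactic *)

Section DeriveRules.
Variable R : realType.
Implicit Types (f g : R -> R) (x a b c : R).

Lemma der_cst c x : is_derive x 1 (fun=> c) 0.
Proof. exact: is_derive_cst. Qed.

Lemma der_id x : is_derive x 1 (fun y : R => y) 1.
Proof. exact: is_derive_id. Qed.

Lemma der_add f g x a b : is_derive x 1 f a -> is_derive x 1 g b ->
  is_derive x 1 (fun y => f y + g y) (a + b).
Proof. by move=> fa gb; have : is_derive x 1 (f + g) (a + b) by exact: is_deriveD. Qed.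

Lemma der_opp f x a : is_derive x 1 f a -> is_derive x 1 (fun y => - f y) (- a).
Proof. by move=> fa; have : is_derive x 1 (- f) (- a) by exact: is_deriveN. Qed.

Lemma der_mul f g x a b : is_derive x 1 f a -> is_derive x 1 g b ->
  is_derive x 1 (fun y => f y * g y) (a * g x + f x * b).
Proof.
move=> fa gb; have H : is_derive x 1 (f * g) (f x *: b + g x *: a) by exact: is_deriveM.
apply: (is_derive_eq H); by rewrite /GRing.scale /= addrC mulrC.
Qed.

Lemma der_exprn f n x a : is_derive x 1 f a ->
  is_derive x 1 (fun y => f y ^+ n) (n%:R * f x ^+ n.-1 * a).
Proof.
move=> fa; elim: n => [|n IH].
  by rewrite mul0r mul0r; exact: is_derive_cst.
under eq_fun do rewrite exprS.
apply: (is_derive_eq (der_mul fa IH)) => /=.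
by case: n {IH} => [|n] /=; rewrite ?expr0 ?exprS -?(natr1 n.+1) -?(natr1 n); ring.
Qed.

Lemma der_comp f g x a b : is_derive x 1 f a -> is_derive (f x) 1 g b ->
  is_derive x 1 (fun y => g (f y)) (b * a).
Proof.
move=> fa gb; apply: (is_derive_eq (is_derive1_comp gb fa)).
by rewrite /GRing.scale /=.
Qed.

Lemma der_inv f x a : is_derive x 1 f a -> f x != 0 ->
  is_derive x 1 (fun y => (f y)^-1) (- a / f x ^+ 2).
Proof.
move=> fa fx0; have H : is_derive x 1 (fun y => (f y)^-1) (- (f x) ^- 2 *: a) by exact: is_deriveV.
apply: (is_derive_eq H); by rewrite /GRing.scale /= -exprVn; ring.
Qed.

Lemma der_cont f : (forall x, exists a, is_derive x 1 f a) -> continuous f.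
Proof.
move=> df x; have [a [fx _]] := df x.
exact/differentiable_continuous/derivable1_diffP.
Qed.

Lemma measurable_comp_cont (d : measure_display) (T : measurableType d) (D : set T)
    (g : T -> R) (f : R -> R) :
  continuous f -> measurable_fun D g -> measurable_fun D (fun x : T => f (g x)).
Proof.
by move=> cf mg; apply: (measurableT_comp (f := f)) => //; exact: continuous_measurable_fun.
Qed.

End DeriveRules.

(** The derivative is an evar filled in by descent on the syntax of the function. What [der] leaves
    are the nonvanishing or positivity conditions and one equation with the announced value. *)
Ltac der_step := lazymatch goal with
  | |- is_derive _ _ (fun=> ?c) _ => exact (der_cst c _)
  | |- is_derive _ _ (fun y => y) _ => exact (der_id _)
  | |- is_derive _ _ (fun y => @?f y + @?g y) _ => notypeclasses refine (@der_add _ f g _ _ _ _ _)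
  | |- is_derive _ _ (fun y => - @?f y) _ => notypeclasses refine (@der_opp _ f _ _ _)
  | |- is_derive _ _ (fun y => @?f y * @?g y) _ => notypeclasses refine (@der_mul _ f g _ _ _ _ _)
  | |- is_derive _ _ (fun y => @?f y ^+ ?n) _ => notypeclasses refine (@der_exprn _ f n _ _ _)
  | |- is_derive _ _ (fun y => (@?f y)^-1) _ => notypeclasses refine (@der_inv _ f _ _ _ _)
  | |- is_derive _ _ (fun y => expR (@?f y)) _ =>
      notypeclasses refine (@der_comp _ f expR _ _ _ _ (is_derive_expR _))
  | |- is_derive _ _ (fun y => sin (@?f y)) _ =>
      notypeclasses refine (@der_comp _ f sin _ _ _ _ (is_derive_sin _))
  | |- is_derive _ _ (fun y => cos (@?f y)) _ =>
      notypeclasses refine (@der_comp _ f cos _ _ _ _ (is_derive_cos _))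
  | |- is_derive _ _ (fun y => atan (@?f y)) _ =>
      notypeclasses refine (@der_comp _ f atan _ _ _ _ (is_derive1_atan _))
  | |- is_derive _ _ (fun y => ln (@?f y)) _ =>
      notypeclasses refine (@der_comp _ f (@ln _) _ _ _ _ (is_derive1_ln _))
  | |- is_derive _ _ (fun y => Num.sqrt (@?f y)) _ =>
      notypeclasses refine (@der_comp _ f Num.sqrt _ _ _ _ (is_derive1_sqrt _))
  end.
Ltac der := notypeclasses refine (is_derive_eq _ _); [repeat der_step|cbv beta].
Ltac der_continuous :=
  notypeclasses refine (@der_cont _ _ _);
  let x := fresh "x" in intro x; eexists; repeat der_step.

Section BasicIntegrals.
Variable R : realType.
Local Notation mu := (@lebesgue_measure R).
Local Notation intg D f := (mu.-integrable D (EFin \o f)).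
Implicit Types (f g F : R -> R).

Lemma cvg_expRN (a : R) : 0 < a -> expR (- (a * x)) @[x --> +oo] --> (0 : R).
Proof.
move=> a0; apply: (@cvg_comp _ _ _ (fun x => a * x) (fun y => expR (- y)) _ +oo).
  by apply: gt0_cvgMry => //; exact: cvg_id.
exact: cvgr_expR.
Qed.

Lemma integral_expRN (a : R) : 0 < a ->
  intg Rpos (fun x => expR (- (a * x))) /\
  \int[mu]_(x in Rpos) expR (- (a * x)) = a^-1.
Proof.
move=> a0; have [||||H1 H2] := @FTC2y_ge0' _ (fun x => expR (- (a * x))) (fun x => - a^-1 * expR (- (a * x))) 0.
- by move=> x; der; field; rewrite gt_eqF.
- by der_continuous.
- by move=> x _; exact: expR_ge0.
- by rewrite -[X in _ --> X](mulr0 (- a^-1)); apply: cvgMr; exact: cvg_expRN.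
by split => //; rewrite H2 mulr0 oppr0 expR0 mulr1 opprK add0r.
Qed.

End BasicIntegrals.

(** * Explicit integrals *)

Section Integrals.
Variable R : realType.
Local Notation mu := (@lebesgue_measure R).
Local Notation intg D f := (mu.-integrable D (EFin \o f)).
Implicit Types (f g F : R -> R) (a b c e : R).

Lemma cvg0_dominated (F g : R -> R) : (forall x, 0 < x -> `|F x| <= g x) ->
  g x @[x --> +oo] --> (0 : R) -> F x @[x --> +oo] --> (0 : R).
Proof.
move=> Fg g0; apply/cvgr0Pnorm_le => e e0.
have /cvgr0Pnorm_le /(_ _ e0) ge := g0.
near=> x; apply: le_trans (Fg _ _) (le_trans (ler_norm _) _); near: x => //.
exact: nbhs_pinfty_gt.
Unshelve. all: by end_near. Qed.

Lemma trig_bound (p q y : R) : `|p * cos y + q * sin y| <= `|p| + `|q|.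
Proof.
rewrite (le_trans (ler_normD _ _))// !normrM lerD// ler_piMr//.
  by rewrite ler_norml cos_geN1 cos_le1.
by rewrite ler_norml sin_geN1 sin_le1.
Qed.

Lemma integral_expRN_trig e (p q b : R) : 0 < e ->
  intg Rpos (fun x => expR (- (e * x)) * (p * cos (b * x) + q * sin (b * x))) /\
  \int[mu]_(x in Rpos) (expR (- (e * x)) * (p * cos (b * x) + q * sin (b * x))) =
    (p * e + q * b) / (e ^+ 2 + b ^+ 2).
Proof.
move=> e0; have eb : e ^+ 2 + b ^+ 2 != 0.
  by rewrite gt_eqF// ltr_wpDr ?sqr_ge0// exprn_gt0.
have [iE _] := integral_expRN e0.
have H : intg Rpos (fun x => expR (- (e * x)) * (p * cos (b * x) + q * sin (b * x))).
  apply: (@intg_le _ _ _ (fun x => expR (- (e * x)) * (`|p| + `|q|))) => //.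
  - by apply: cont_meas; der_continuous.
  - by move=> x _; rewrite normrM ger0_norm ?expR_ge0// ler_wpM2l ?expR_ge0// trig_bound.
  - exact: intgZr.
(* The coefficients P of cos and Q of sin solve -e P + b Q = p and -b P - e Q = q. *)
split => //; pose F x := expR (- (e * x)) *
  ((- e * p - b * q) / (e ^+ 2 + b ^+ 2) * cos (b * x)
   + (b * p - e * q) / (e ^+ 2 + b ^+ 2) * sin (b * x)).
transitivity (0 - F 0); last by rewrite /F !mulr0 oppr0 expR0 cos0 sin0; field.
apply: FTC2y => //.
- by move=> x; rewrite /F; der; field.
- by der_continuous.
- pose C := `|(- e * p - b * q) / (e ^+ 2 + b ^+ 2)| + `|(b * p - e * q) / (e ^+ 2 + b ^+ 2)|.
  apply: (@cvg0_dominated _ (fun x => expR (- (e * x)) * C)); last first.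
    by rewrite -[X in _ --> X](mul0r C); apply: cvgMl; exact: cvg_expRN.
  by move=> x _; rewrite normrM ger0_norm ?expR_ge0// ler_wpM2l ?expR_ge0// trig_bound.
Qed.

Lemma integral_scale (G : R -> R) a : 0 < a -> continuous G -> (forall x, 0 <= G x) ->
  intg Rpos G -> intg Rpos (fun x => G (a * x)) /\
  \int[mu]_(x in Rpos) G (a * x) = a^-1 * \int[mu]_(x in Rpos) G x.
Proof.
move=> a0 cG G0 iG.
pose F (x : R) := a * x.
have dF : forall x : R, is_derive x 1 F a by move=> x; rewrite /F; der; ring.
have dFE : F^`()%classic = cst a by apply/funext => x; rewrite derive1E; case: (dF x).
have cF : continuous (fun x => G (a * x)).
  by move=> x; apply: continuous_comp; [exact: mulrl_continuous|exact: cG].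
have Gm : measurable_fun setT G by exact: cont_meas.
have E : (\int[mu]_(x in Rpos) (G x)%:E = a%:E * \int[mu]_(x in Rpos) (G (a * x))%:E)%E.
  rewrite !integral_itv_obnd_cbnd; [|by apply/measurable_EFinP; exact: cont_meas..].
  have := @increasing_ge0_integration_by_substitutiony R F G 0.
  rewrite (_ : F 0 = 0) ?/F ?mulr0// -/F dFE => ->.
  - rewrite -ge0_integralZl//.
    + by apply: eq_integral => x _; rewrite -EFinM mulrC.
    + by apply/measurable_EFinP; exact: cont_meas.
    + by move=> x _; rewrite lee_fin.
    + by rewrite lee_fin ltW.
  - by move=> x y _ _; rewrite ltr_pM2l.
  - by move=> x _; exact: cst_continuous.
  - exact: is_cvg_cst.
  - exact: is_cvg_cst.
  - split; first by move=> x _; case: (dF x).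
    by apply: cvg_at_right_filter; exact: mulrl_continuous.
  - by apply: gt0_cvgMry => //; exact: cvg_id.
  - exact: continuous_subspaceT.
  - by move=> x _.
have iGE := RintE (@measurable_Rpos R) iG.
have iG' : intg Rpos (fun x => G (a * x)).
  apply/integrableP; split; first by apply/measurable_EFinP; exact: cont_meas.
  rewrite (_ : \int[mu]_(x in Rpos) _ = \int[mu]_(x in Rpos) (G (a * x))%:E)%E; last first.
    by apply: eq_integral => x _; rewrite /= ger0_norm.
  (* Were the scaled integral infinite, [E] would make the integral of [G] infinite as well. *)
  rewrite ltNge leye_eq; apply/negP => /eqP Ey.
  by move: E; rewrite Ey -iGE gt0_muley ?lte_fin.
split => //; move: E; rewrite -!RintE// -EFinM => -[->].
by rewrite mulKf// gt_eqF.
Qed.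

Lemma gauss_half (a : R) : 0 < a ->
  intg Rpos (fun q => expR (- (a * q) ^+ 2)) /\
  \int[mu]_(q in Rpos) expR (- (a * q) ^+ 2) = Num.sqrt pi / 2 / a.
Proof.
move=> a0; have cg := @continuous_gauss_fun R.
have iG : intg Rpos (@gauss_fun R).
  by apply: (@intgS _ _ setT); [by []|by []|by []|exact: integrableT_gauss].
have [H1 H2] := integral_scale a0 cg (@gauss_fun_ge0 R) iG.
split => //; rewrite [LHS]H2 mulrC; congr (_ / _).
rewrite /Rintegral integral_itv_obnd_cbnd ?integral0y_gauss//.
by apply/measurable_EFinP; exact: cont_meas.
Qed.

End Integrals.

(** * Rational integrals over 1 + q^4 and the weight of the Schur test *)

Section QuarticIntegrals.
Variable R : realType.
Local Notation mu := (@lebesgue_measure R).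
Local Notation intg D f := (mu.-integrable D (EFin \o f)).
Implicit Types (f g F : R -> R) (a b c e p q r s t x y : R).

Lemma cvg_linear_y a b : 0 < a -> a * x + b @[x --> +oo] --> (+oo : set_system R).
Proof.
move=> a0; apply/cvgryPge => M; near=> x.
rewrite -lerBlDr mulrC -ler_pdivrMr//; near: x; exact: nbhs_pinfty_ge.
Unshelve. all: by end_near. Qed.

(** Partial fractions over 1 + q^4 = (q^2 + s q + 1)(q^2 - s q + 1) with s = sqrt 2. The logarithmic
    part of the primitive vanishes at 0 and at infinity, so only the arctangents contribute, and
    they carry the coefficient [p + r]. *)
Lemma quartic_integral p r : 0 <= p -> 0 <= r ->
  intg Rpos (fun q => (p * q ^+ 2 + r) / (1 + q ^+ 4)) /\
  \int[mu]_(q in Rpos) ((p * q ^+ 2 + r) / (1 + q ^+ 4)) =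
    (p + r) * pi / (2 * Num.sqrt 2).
Proof.
move=> p0 r0; set s := Num.sqrt 2.
have s0 : 0 < s by rewrite sqrtr_gt0.
have s2 : s ^+ 2 = 2 by rewrite sqr_sqrtr.
have sn0 : s != 0 by rewrite gt_eqF.
have D1 q : 0 < q ^+ 2 + s * q + 1 by nra.
have D2 q : 0 < q ^+ 2 - s * q + 1 by nra.
have D3 q : 1 + q ^+ 4 = (q ^+ 2 + s * q + 1) * (q ^+ 2 - s * q + 1).
  by transitivity (q ^+ 4 + (2 - s ^+ 2) * q ^+ 2 + 1); [rewrite s2|]; ring.
have D4 q : 1 + (s * q + 1) ^+ 2 = 2 * (q ^+ 2 + s * q + 1).
  by transitivity (s ^+ 2 * q ^+ 2 + 2 * s * q + 2); [|rewrite s2]; ring.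
have D5 q : 1 + (s * q - 1) ^+ 2 = 2 * (q ^+ 2 - s * q + 1).
  by transitivity (s ^+ 2 * q ^+ 2 - 2 * s * q + 2); [|rewrite s2]; ring.
pose F q := (p - r) / (4 * s) * (ln (q ^+ 2 - s * q + 1) - ln (q ^+ 2 + s * q + 1))
  + (p + r) / (2 * s) * (atan (s * q + 1) + atan (s * q - 1)).
have F0 : F 0 = 0.
  by rewrite /F !mulr0 expr0n /= subr0 !add0r atanN !subrr !mulr0 add0r.
have -> : (p + r) * pi / (2 * s) = (p + r) * pi / (2 * s) - F 0 by rewrite F0 subr0.
apply: FTC2y_ge0'.
- move=> q; rewrite /F; der; [exact: D2|exact: D1|rewrite D4 D5 D3; field].
  by rewrite sn0 !gt_eqF.
- apply: der_cont => q; eexists; repeat der_step.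
  by rewrite D3 mulf_neq0// gt_eqF.
- move=> q _; rewrite D3 divr_ge0//; first by rewrite addr_ge0// mulr_ge0// sqr_ge0.
  by rewrite mulr_ge0// ltW.
have H1 : (ln (q ^+ 2 - s * q + 1) - ln (q ^+ 2 + s * q + 1)) @[q --> +oo] --> (0 : R).
  have HR : (1 - 2 * s * q / (q ^+ 2 + s * q + 1)) @[q --> +oo] --> (1 : R).
    rewrite -[X in _ --> X](subr0 1); apply: cvgB; first exact: cvg_cst.
    apply: (@cvg0_dominated _ _ (fun q => 2 * s * q^-1)).
      move=> q q0; rewrite ger0_norm; last by rewrite divr_ge0 ?mulr_ge0 ?ltW.
      rewrite -!mulrA ler_pM2l// ler_pM2l// ler_pdivrMr// mulrC ler_pdivlMr//; nra.
    rewrite -[X in _ --> X](mulr0 (2 * s)); apply: cvgMr.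
    by apply/gtr0_cvgV0; [exact: nbhs_pinfty_gt|exact: cvg_id].
  rewrite (_ : (fun q => _) = (fun q => ln (1 - 2 * s * q / (q ^+ 2 + s * q + 1)))).
    by rewrite -ln1; apply: (continuous_cvg _ (continuous_ln ltr01) HR).
  apply/funext => q; rewrite -ln_div ?posrE//; congr ln; field; rewrite gt_eqF//.
have H2 b : atan (s * q + b) @[q --> +oo] --> (pi / 2 : R).
  by apply: cvg_comp (@cvgy_atan R); exact: cvg_linear_y.
rewrite (_ : _ * _ / _ = (p - r) / (4 * s) * 0 + (p + r) / (2 * s) * (pi / 2 + pi / 2)); last by field.
by apply: cvgD; apply: cvgMr => //; apply: cvgD.
Qed.

Lemma quartic_integral_scaled c p r : 0 < c -> 0 <= p -> 0 <= r ->
  intg Rpos (fun q => (p * q ^+ 2 + r) / (c ^+ 4 + q ^+ 4)) /\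
  \int[mu]_(q in Rpos) ((p * q ^+ 2 + r) / (c ^+ 4 + q ^+ 4)) =
    pi / (2 * Num.sqrt 2) * (p / c + r / c ^+ 3).
Proof.
move=> c0 p0 r0; have cn0 : c != 0 by rewrite gt_eqF.
have D q : 1 + q ^+ 4 != 0 by rewrite gt_eqF// ltr_pwDl// exprn_even_ge0.
have D' q : c ^+ 4 + q ^+ 4 != 0 by rewrite gt_eqF// ltr_pwDl ?exprn_gt0// exprn_even_ge0.
have [p0' r0'] : 0 <= p * c ^+ 2 /\ 0 <= r by rewrite mulr_ge0// sqr_ge0.
have [H1 H2] := quartic_integral p0' r0'.
have ci0 : 0 < c^-1 by rewrite invr_gt0.
have [| |H3 H4] := integral_scale ci0 _ _ H1.
- by apply: der_cont => q; eexists; repeat der_step.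
- move=> q; apply: divr_ge0; apply: addr_ge0 => //; last exact: exprn_even_ge0.
  by rewrite mulr_ge0// sqr_ge0.
have E q : c ^- 4 * ((p * c ^+ 2 * (c^-1 * q) ^+ 2 + r) / (1 + (c^-1 * q) ^+ 4)) =
    (p * q ^+ 2 + r) / (c ^+ 4 + q ^+ 4).
  rewrite exprMn exprVn; by field; rewrite cn0 D'.
split.
  by apply: intg_eq (intgZl (c ^- 4) _ H3) => // q _; exact: E.
transitivity (c ^- 4 * (c^-1^-1 * ((p * c ^+ 2 + r) * pi / (2 * Num.sqrt 2)))).
  rewrite -H2 -H4 -RintegralZl//.
  by apply: Rint_eq => q _; rewrite E.
by field; rewrite cn0 gt_eqF// sqrtr_gt0.
Qed.

(** With t = c^2 x the denominator becomes a multiple of (1 + q^4)(c^4 + q^4), and [h] is its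
    partial fraction decomposition up to a constant. The two factors must differ, hence [x != t],
    which later excludes a null set of [t]. The two terms over c^4 + q^4 have equal integrals and
    cancel. *)
Lemma quartic_kernel_integral x t : 0 < x -> 0 < t -> x != t ->
  \int[mu]_(q in Rpos) (q ^+ 2 / (1 + q ^+ 4) *
     ((x * q ^+ 2 + t) / ((x * q ^+ 2) ^+ 2 + t ^+ 2))) =
  pi / (2 * Num.sqrt 2) / (x + t).
Proof.
move=> x0 t0 xt; pose c : R := Num.sqrt (t / x).
have c0 : 0 < c by rewrite sqrtr_gt0 divr_gt0.
have tE : t = c ^+ 2 * x by rewrite sqr_sqrtr ?divfK ?gt_eqF// divr_ge0 ?ltW.
have c1 : c ^+ 4 - 1 != 0.
  rewrite subr_eq0; apply: contra xt; rewrite -(expr1n R 4) eqrXn2 ?ltW// => /eqP c1.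
  by rewrite tE c1 expr1n mul1r.
have D q : 1 + q ^+ 4 != 0 by rewrite gt_eqF// ltr_pwDl// exprn_even_ge0.
have D' q : c ^+ 4 + q ^+ 4 != 0 by rewrite gt_eqF// ltr_pwDl ?exprn_gt0// exprn_even_ge0.
have c20 := sqr_ge0 c.
have [A1 A2] := quartic_integral_scaled c0 (lexx 0) (exprn_ge0 4 (ltW c0)).
have [B1 B2] := quartic_integral_scaled c0 c20 (lexx 0).
have [C1 C2] := quartic_integral_scaled ltr01 c20 (lexx 0).
have [E1 E2] := quartic_integral_scaled ltr01 (lexx 0) ler01.
pose h := fun q : R => (0 * q ^+ 2 + c ^+ 4) / (c ^+ 4 + q ^+ 4) -
  (c ^+ 2 * q ^+ 2 + 0) / (c ^+ 4 + q ^+ 4) +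
  ((c ^+ 2 * q ^+ 2 + 0) / (1 ^+ 4 + q ^+ 4) - (0 * q ^+ 2 + 1) / (1 ^+ 4 + q ^+ 4)).
have ih : \int[mu]_(q in Rpos) h q = pi / (2 * Num.sqrt 2) * (c ^+ 2 - 1).
  rewrite /h RintegralD//; [|exact: intgB..].
  rewrite !RintegralB// A2 B2 C2 E2; field.
  by rewrite !gt_eqF// sqrtr_gt0.
rewrite (@Rint_eq _ _ _ (fun q => (x^-1 / (c ^+ 4 - 1)) * h q)); last first.
  move=> q _; rewrite /h tE; field; rewrite D D' c1 !gt_eqF//.
  by rewrite ltr_wpDl ?sqr_ge0// exprn_gt0// mulr_gt0// exprn_gt0.
rewrite RintegralZl//; last by apply: intgD => //; apply: intgB.
rewrite ih tE; field.
by rewrite c1 !gt_eqF ?(sqrtr_gt0 2)// addr_gt0// mulr_gt0// exprn_gt0.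
Qed.

(** The primitive is (2 / sqrt y) atan (sqrt t / sqrt y). As the integrand is singular at 0, [t] is
    shifted by [d n] and Fatou's lemma removes the shift, which is why the conclusion is an
    inequality on the absolute value. *)
Lemma schur_weight y : 0 < y ->
  intg Rpos (fun t => (Num.sqrt t)^-1 / (y + t)) /\
  \int[mu]_(t in Rpos) `|(Num.sqrt t)^-1 / (y + t)| <= pi / Num.sqrt y.
Proof.
move=> y0; have sy0 : 0 < Num.sqrt y by rewrite sqrtr_gt0.
pose d n : R := n.+1%:R^-1.
have d0 n : 0 < d n by rewrite invr_gt0.
have K n : intg Rpos (fun t => (Num.sqrt (t + d n))^-1 / (y + (t + d n))) /\
    \int[mu]_(t in Rpos) ((Num.sqrt (t + d n))^-1 / (y + (t + d n))) <= pi / Num.sqrt y.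
  pose F t := 2 / Num.sqrt y * atan (Num.sqrt (t + d n) / Num.sqrt y).
  have P t : 0 <= t -> 0 < t + d n by move=> t0; rewrite ltr_wpDl.
  have dF : forall t : R, 0 <= t -> is_derive t 1 F ((Num.sqrt (t + d n))^-1 / (y + (t + d n))).
    move=> t t0; rewrite /F; der; first exact: P.
    have := sqr_sqrtr (ltW (P _ t0)); have := sqr_sqrtr (ltW y0).
    have : 0 < Num.sqrt (t + d n) by rewrite sqrtr_gt0 P.
    move: (Num.sqrt (t + d n)) (Num.sqrt y) sy0 => u v v0 u0 vE uE.
    rewrite -uE -[in RHS]vE; field.
    by rewrite !gt_eqF// ?addr_gt0 ?exprn_gt0.
  have [|||||H1 H2] := @FTC2y_ge0 _ (fun t => (Num.sqrt (t + d n))^-1 / (y + (t + d n))) F (2 / Num.sqrt y * (pi / 2)).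
  - by move=> t /ltW; exact: dF.
  - move=> t /dF [dt _]; exact/differentiable_continuous/derivable1_diffP.
  - move=> t t0; have := P t t0 => td0.
    have : exists a, is_derive t 1 (fun t => (Num.sqrt (t + d n))^-1 / (y + (t + d n))) a.
      eexists; repeat der_step => //.
      + by rewrite gt_eqF// sqrtr_gt0.
      + by rewrite gt_eqF// addr_gt0.
    by case=> a [dt _]; exact/differentiable_continuous/derivable1_diffP.
  - by move=> t t0; rewrite mulr_ge0 ?invr_ge0 ?sqrtr_ge0// addr_ge0 ?ltW// P.
  - apply: cvgMr; apply: cvg_comp (@cvgy_atan R).
    apply/cvgryPge => M; near=> t; rewrite ler_pdivlMr//.
    have [M0|M0] := leP (M * Num.sqrt y) 0; first by rewrite (le_trans M0)// sqrtr_ge0.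
    have t1 : (M * Num.sqrt y) ^+ 2 <= t + d n.
      apply: ler_wpDr; first exact: ltW.
      by near: t; apply: nbhs_pinfty_ge; exact: num_real.
    rewrite -(ger0_norm (ltW M0)) -sqrtr_sqr ler_sqrt// (le_trans _ t1)//.
    exact: sqr_ge0.
  split => //; rewrite H2 lerBlDr.
  rewrite (_ : 2 / Num.sqrt y * (pi / 2) = pi / Num.sqrt y); last by field; rewrite gt_eqF.
  rewrite lerDl; apply: mulr_ge0; first by rewrite divr_ge0// ltW.
  by rewrite -(@atan0 R) le_atan// divr_ge0// sqrtr_ge0.
have K1 n := (K n).1; have K2 n := (K n).2.
apply: (@Rint_fatou _ _ _ _ _ (@measurable_Rpos R) K1) => //.
- apply: open_continuous_measurable_fun; first exact: open_Rpos.
  move=> t; rewrite inE in_Rpos => t0.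
  have : exists a, is_derive t 1 (fun t => (Num.sqrt t)^-1 / (y + t)) a.
    eexists; repeat der_step => //.
    + by rewrite gt_eqF// sqrtr_gt0.
    + by rewrite gt_eqF// addr_gt0.
  by case=> a [dt _]; exact/differentiable_continuous/derivable1_diffP.
- move=> n t; rewrite in_Rpos => t0.
  by rewrite divr_ge0 ?invr_ge0 ?sqrtr_ge0// ltW// !addr_gt0.
- apply/aeW => t; rewrite in_Rpos => t0.
  have td : t + d n @[n --> \oo] --> t.
    rewrite -[X in _ --> X]addr0; apply: cvgD; first exact: cvg_cst.
    exact: cvg_harmonic.
  apply: cvgM; last apply: cvgV.
  + apply: cvgV; first by rewrite gt_eqF// sqrtr_gt0.
    by apply: continuous_cvg => //; exact: sqrt_continuous.
  + by rewrite gt_eqF// addr_gt0.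
  + by apply: cvgD => //; exact: cvg_cst.
Unshelve. all: by end_near. Qed.

End QuarticIntegrals.

(** * The Schur test and the Laplace transform *)

Section Schur.
Variable R : realType.
Local Notation mu := (@lebesgue_measure R).
Local Notation intg D f := (mu.-integrable D (EFin \o f)).
Implicit Types (f g : R -> R) (x t : R).

Lemma measurable_inv : measurable_fun setT (fun x : R => x^-1).
Proof.
rewrite -(setvU [set (0 : R)]); apply/measurable_funU => //; first exact: measurableC.
split; last exact: measurable_fun_set1.
apply: open_continuous_measurable_fun.
  by apply: closed_openC; exact: closed_eq.
by move=> x; rewrite inE /= => /eqP x0; exact: inv_continuous.
Qed.

(** Makes the Stieltjes integral of an L_2 function converge absolutely at every positive [x]. *)
Lemma sqint_resolvent x : 0 < x -> sqint (fun t => (x + t)^-1).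
Proof.
move=> x0; split.
  by apply: (measurable_funTS (f := fun t => (x + t)^-1)); apply: measurableT_comp; [exact: measurable_inv|exact: measurable_funD].
have P t : 0 <= t -> 0 < x + t by move=> t0; rewrite ltr_wpDr.
have dc (F : R -> R) t : (exists a, is_derive t 1 F a) -> {for t, continuous F}.
  by case=> a [dt _]; exact/differentiable_continuous/derivable1_diffP.
have [|||||H _] := @FTC2y_ge0 _ (fun t => (x + t)^-1 ^+ 2) (fun t => - (x + t)^-1) 0.
- move=> t t0; der; first by rewrite gt_eqF// P// ltW.
  by field; rewrite gt_eqF// P// ltW.
- by move=> t t0; apply: dc; eexists; repeat der_step; rewrite gt_eqF// P.
- by move=> t t0; apply: dc; eexists; repeat der_step; rewrite gt_eqF// P.
- by move=> t t0; rewrite exprn_ge0// invr_ge0 ltW// P.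
- rewrite -oppr0; apply: cvgN; apply/gtr0_cvgV0.
    by near=> t; apply: P; near: t; exact: nbhs_pinfty_ge.
  apply: cvg_trans (cvg_linear_y x ltr01); apply: near_eq_cvg.
  by apply: nearW => t; rewrite mul1r addrC.
by [].
Unshelve. all: by end_near. Qed.

(** With [|f t|] in the integrand, this dominates every operator whose kernel is bounded in absolute
    value by [K]. *)
Definition schur_op (K : R -> R -> R) f x := \int[mu]_(t in Rpos) (K x t * `|f t|).

(** The upper bound in the third clause keeps K x t sqrt(t) f(t)^2 below a multiple of f(t)^2 for
    fixed [x]. The last clause is the Schur condition for the weight t^(-1/2), a formal
    eigenfunction with eigenvalue pi of both kernels to which the test is applied. *)
Definition schur_kernel (K : R -> R -> R) :=
  [/\ measurable_fun setT (fun z : R * R => K z.1 z.2), forall x t, K x t = K t x,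
      forall x t, 0 < x -> 0 < t -> 0 <= K x t <= (Num.sqrt x)^-1 / Num.sqrt t &
      forall x, 0 < x -> intg Rpos (fun t => K x t * (Num.sqrt t)^-1) /\
        \int[mu]_(t in Rpos) (K x t * (Num.sqrt t)^-1) <= pi / Num.sqrt x].

Lemma measurable_kernel1 (K : R -> R -> R) x :
  measurable_fun setT (fun z : R * R => K z.1 z.2) -> measurable_fun setT (K x).
Proof. by move=> mK; exact: (measurable_fun_pair2 (f := fun z : R * R => K z.1 z.2) x mK). Qed.

(** Cauchy-Schwarz for K |f| = u v with u^2 = K t^(-1/2) and v^2 = K t^(1/2) f^2 bounds the square
    of the operator by pi x^(-1/2) [V x]. Exchanging the integrals and using the Schur condition in
    the other variable yields the second factor pi. *)
Lemma schur_test K f : schur_kernel K -> sqint f ->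
  [/\ forall x, 0 < x -> intg Rpos (fun t => K x t * `|f t|),
      sqint (schur_op K f) & ip (schur_op K f) (schur_op K f) <= pi ^+ 2 * ip f f].
Proof.
move=> [mK Ksym K0 Kw] Hf.
have mR := @measurable_Rpos R.
have mK1 x : measurable_fun Rpos (K x) by apply: measurable_funTS; exact: measurable_kernel1.
have msq : measurable_fun Rpos (@Num.sqrt R) by apply: cont_meas; exact: sqrt_continuous.
have misq : measurable_fun Rpos (fun t : R => (Num.sqrt t)^-1).
  by apply: measurableT_comp; [exact: measurable_inv|].
have mf2 : measurable_fun Rpos (fun t => Num.sqrt t * f t ^+ 2).
  by apply: measurable_funM => //; apply: measurable_funX; exact: Hf.1.
have sq0 t : 0 < t -> Num.sqrt t != 0 by move=> t0; rewrite gt_eqF// sqrtr_gt0.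
have sf0 t : 0 <= Num.sqrt t * f t ^+ 2 by apply: mulr_ge0; rewrite ?sqrtr_ge0 ?sqr_ge0.
have Kis0 x t : 0 < x -> 0 < t -> 0 <= K x t * (Num.sqrt t)^-1.
  by move=> x0 t0; have /andP[k0 k1] := K0 x t x0 t0; rewrite mulr_ge0// invr_ge0 sqrtr_ge0.
have iV x : 0 < x -> intg Rpos (fun t => K x t * (Num.sqrt t * f t ^+ 2)).
  move=> x0; apply: (@intg_le _ _ _ (fun t => (Num.sqrt x)^-1 * f t ^+ 2)) => //.
  - exact: measurable_funM.
  - move=> t; rewrite in_Rpos => t0; have /andP[k0 k1] := K0 x t x0 t0.
    rewrite ger0_norm; last exact: mulr_ge0.
    by rewrite mulrA ler_wpM2r ?sqr_ge0// -ler_pdivlMr// sqrtr_gt0.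
  - exact: intgZl Hf.2.
pose u x t := Num.sqrt (K x t * (Num.sqrt t)^-1).
pose v x t := Num.sqrt (K x t * Num.sqrt t) * `|f t|.
have u2 x t : 0 < x -> 0 < t -> u x t ^+ 2 = K x t * (Num.sqrt t)^-1.
  move=> x0 t0; have /andP[k0 k1] := K0 x t x0 t0.
  by rewrite sqr_sqrtr// mulr_ge0// invr_ge0 sqrtr_ge0.
have v2 x t : 0 < x -> 0 < t -> v x t ^+ 2 = K x t * (Num.sqrt t * f t ^+ 2).
  move=> x0 t0; have /andP[k0 k1] := K0 x t x0 t0.
  by rewrite exprMn real_normK ?num_real// sqr_sqrtr ?mulrA// mulr_ge0// sqrtr_ge0.
have uv x t : 0 < x -> 0 < t -> u x t * v x t = K x t * `|f t|.
  move=> x0 t0; have /andP[k0 k1] := K0 x t x0 t0.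
  rewrite mulrA -sqrtrM; last by rewrite mulr_ge0// invr_ge0 sqrtr_ge0.
  by rewrite mulrACA mulVf ?sq0// mulr1 -expr2 sqrtr_sqr ger0_norm.
have Hu x : 0 < x -> sqint (u x).
  move=> x0; split.
    by apply: measurable_comp_cont; [exact: sqrt_continuous|exact: measurable_funM].
  by apply: intg_eq (Kw x x0).1 => // t; rewrite in_Rpos => t0; rewrite -u2.
have Hv x : 0 < x -> sqint (v x).
  move=> x0; split.
    apply: measurable_funM; last by apply: measurableT_comp => //; exact: Hf.1.
    by apply: measurable_comp_cont; [exact: sqrt_continuous|exact: measurable_funM].
  by apply: intg_eq (iV x x0) => // t; rewrite in_Rpos => t0; rewrite -v2.
have iK x : 0 < x -> intg Rpos (fun t => K x t * `|f t|).
  move=> x0; apply: intg_eq (sqint_mul (Hu _ x0) (Hv _ x0)) => // t.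
  by rewrite in_Rpos => t0; rewrite uv.
pose V x := \int[mu]_(t in Rpos) (K x t * (Num.sqrt t * f t ^+ 2)).
have TV x : 0 < x -> schur_op K f x ^+ 2 <= pi * ((Num.sqrt x)^-1 * V x).
  move=> x0; have := cauchy_schwarz_sqr (Hu _ x0) (Hv _ x0).
  have -> : ip (u x) (v x) = schur_op K f x.
    by apply: Rint_eq => t; rewrite in_Rpos => t0; rewrite uv.
  move=> /le_trans; apply.
  have -> : ip (v x) (v x) = V x.
    by apply: Rint_eq => t; rewrite in_Rpos => t0; rewrite -expr2 v2.
  have -> : ip (u x) (u x) = \int[mu]_(t in Rpos) (K x t * (Num.sqrt t)^-1).
    by apply: Rint_eq => t; rewrite in_Rpos => t0; rewrite -expr2 u2.
  rewrite mulrA ler_wpM2r//; last exact: (Kw x x0).2.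
  apply: Rintegral_ge0 => t; rewrite in_Rpos => t0; have /andP[k0 k1] := K0 x t x0 t0.
  exact: mulr_ge0.
have mT : measurable_fun Rpos (schur_op K f).
  apply: measurable_funTS; apply: (@measurable_Rint _ _ _ (fun t => `|f t|)) => //.
  by apply: measurableT_comp => //; exact: Hf.1.
have [|||||||H1 H2 H3] := @Fubini_kernel _ Rpos Rpos (fun t x => K x t) (fun t => Num.sqrt t * f t ^+ 2)
  (fun x => (Num.sqrt x)^-1) (fun t => pi / Num.sqrt t) (@measurable_Rpos R) (@measurable_Rpos R).
- rewrite (_ : (fun z : R * R => K z.2 z.1) = (fun z => K z.1 z.2))//.
  by apply/funext => z; rewrite Ksym.
- by [].
- by [].
- move=> t; rewrite in_Rpos => t0.
  by apply: intg_eq (Kw t t0).1 => // x _; rewrite Ksym.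
- by move=> x; rewrite in_Rpos; exact: iV.
- move=> t; rewrite in_Rpos => t0; apply: le_trans (Kw t t0).2.
  rewrite le_eqVlt; apply/orP; left; apply/eqP; apply: Rint_eq => x; rewrite in_Rpos => x0.
  by rewrite ger0_norm Ksym// Kis0.
- apply: intg_eq (intgZl pi _ Hf.2) => // t; rewrite in_Rpos => t0.
  by rewrite ger0_norm//; field; exact: sq0.
have HT : sqint (schur_op K f).
  split=> //; apply: (intg_le mR (measurable_funX 2 mT) _ (intgZl pi mR H2)).
  by move=> x; rewrite in_Rpos => x0; rewrite ger0_norm ?sqr_ge0//; exact: TV.
split; [exact: iK|exact: HT|].
apply: (@le_trans _ _ (pi * \int[mu]_(x in Rpos) ((Num.sqrt x)^-1 * V x))).
  rewrite -RintegralZl; [|exact: mR|exact: H2].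
  apply: le_Rintegral; [exact: mR|exact: sqint_mul|exact: intgZl|].
  by move=> x; rewrite in_Rpos => x0; rewrite -expr2 TV.
rewrite -H3 expr2 -mulrA ler_wpM2l ?pi_ge0// -RintegralZl; [|exact: mR|exact: sqint_mul].
apply: le_Rintegral; [exact: mR|exact: H1|by apply: intgZl => //; exact: sqint_mul|].
- move=> t; rewrite in_Rpos => t0; rewrite -expr2.
  apply: (@le_trans _ _ (Num.sqrt t * f t ^+ 2 * (pi / Num.sqrt t))).
    rewrite ler_wpM2l//; apply: le_trans (Kw t t0).2.
    by rewrite le_eqVlt; apply/orP; left; apply/eqP; apply: Rint_eq => x _; rewrite Ksym.
  rewrite le_eqVlt; apply/orP; left; apply/eqP; field; exact: sq0.
Qed.

End Schur.

(** * The Laplace transform and its square *)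

Section Laplace.
Variable R : realType.
Local Notation mu := (@lebesgue_measure R).
Local Notation intg D f := (mu.-integrable D (EFin \o f)).
Implicit Types (f g : R -> R) (p x t : R).

Lemma sqint_le f g : measurable_fun Rpos f ->
  (forall x, 0 < x -> `|f x| <= g x) -> sqint g -> sqint f.
Proof.
move=> mf fg [mg ig]; split => //; apply: intg_le ig => //; first exact: measurable_funX.
move=> x; rewrite in_Rpos => x0; rewrite normrX lerXn2r ?nnegrE ?fg//.
exact: le_trans (fg _ x0).
Qed.

Lemma sqint_norm f : sqint f -> sqint (fun x => `|f x|).
Proof.
move=> [mf f2]; split; first by apply: measurableT_comp.
by apply: intg_eq f2 => // x _; rewrite real_normK ?num_real.
Qed.

Lemma schur_kernel_inv_add : schur_kernel (fun x t : R => (x + t)^-1).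
Proof.
split.
- by apply: measurableT_comp; [exact: measurable_inv|exact: measurable_funD].
- by move=> x t; rewrite addrC.
- move=> x t x0 t0; have xt0 := addr_gt0 x0 t0.
  have sx : 0 < Num.sqrt x by rewrite sqrtr_gt0.
  have st : 0 < Num.sqrt t by rewrite sqrtr_gt0.
  apply/andP; split; first by rewrite invr_ge0 ltW.
  rewrite -invfM lef_pV2 ?posrE// ?mulr_gt0//.
  rewrite -{2}(sqr_sqrtr (ltW x0)) -{2}(sqr_sqrtr (ltW t0)).
  have := sqr_ge0 (Num.sqrt x - Num.sqrt t); nra.
- move=> x x0; have [H1 H2] := schur_weight x0; split.
    by apply: intg_eq H1 => // t _; rewrite mulrC.
  apply: le_trans H2; rewrite le_eqVlt; apply/orP; left; apply/eqP; apply: Rint_eq => t.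
  rewrite in_Rpos => t0; rewrite ger0_norm 1?mulrC// mulr_ge0 ?invr_ge0 ?sqrtr_ge0//.
  by rewrite addr_ge0// ltW.
Qed.

(** This kernel majorizes exp(-x t) and, up to a constant, the Fresnel tail, so one Schur test
    serves both the Laplace transform and the inverse operator. It reduces to [schur_weight] at 1/x,
    since 1/(1 + x t) = x^-1 / (x^-1 + t). *)
Lemma schur_kernel_inv_1D : schur_kernel (fun x t : R => (1 + x * t)^-1).
Proof.
split.
- by apply: measurableT_comp; [exact: measurable_inv|apply: measurable_funD => //; exact: measurable_funM].
- by move=> x t; rewrite (mulrC x).
- move=> x t x0 t0; have xt0 : 0 < 1 + x * t by rewrite addr_gt0// mulr_gt0.
  apply/andP; split; first by rewrite invr_ge0 ltW.
  rewrite -invfM lef_pV2 ?posrE// ?mulr_gt0 ?sqrtr_gt0//.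
  have -> : x * t = (Num.sqrt x * Num.sqrt t) ^+ 2.
    by rewrite exprMn !sqr_sqrtr// ltW.
  by move: (Num.sqrt x * Num.sqrt t) => y; nra.
- move=> x x0; have xi0 : 0 < x^-1 by rewrite invr_gt0.
  have [H1 H2] := schur_weight xi0.
  have E t : 0 < t -> x^-1 * `|(Num.sqrt t)^-1 / (x^-1 + t)| = (1 + x * t)^-1 / Num.sqrt t.
    move=> t0; have st : 0 < Num.sqrt t by rewrite sqrtr_gt0.
    rewrite ger0_norm; last by rewrite mulr_ge0// invr_ge0 ?sqrtr_ge0// addr_ge0// ltW.
    have xt := mulr_gt0 x0 t0.
    field; rewrite !gt_eqF ?addr_gt0//.
  have H1' := @integrable_norm _ _ _ mu _ _ H1.
  split.
    by apply: intg_eq (intgZl x^-1 _ H1') => // t; rewrite in_Rpos => t0; rewrite -E.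
  rewrite -(Rint_eq (D := Rpos) (f := fun t => x^-1 * `|(Num.sqrt t)^-1 / (x^-1 + t)|)); last first.
    by move=> t; rewrite in_Rpos; exact: E.
  rewrite RintegralZl//; apply: (le_trans (ler_wpM2l (ltW xi0) H2)).
  rewrite sqrtrV; last exact: ltW.
  rewrite invrK -{1}(sqr_sqrtr (ltW x0)) le_eqVlt; apply/orP; left; apply/eqP.
  by field; rewrite gt_eqF// sqrtr_gt0.
Qed.

Lemma expRN_le u : 0 <= u :> R -> expR (- u) <= (1 + u)^-1.
Proof.
move=> u0; rewrite expRN lef_pV2 ?posrE ?expR_gt0 ?ltr_pwDl// expR_ge1Dx//.
Qed.

Definition lap f p := \int[mu]_(x in Rpos) (expR (- (p * x)) * f x).

Lemma measurable_lap_kernel : measurable_fun setT (fun z : R * R => expR (- (z.1 * z.2))).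
Proof.
apply: measurable_comp_cont; first exact: continuous_expR.
by apply: measurableT_comp => //; exact: measurable_funM.
Qed.

Lemma measurable_expRN p D : measurable_fun D (fun x : R => expR (- (p * x))).
Proof. by apply: cont_meas; der_continuous. Qed.

Lemma lap_kernel_bound p x : 0 < p -> 0 < x -> `|expR (- (p * x))| <= (1 + p * x)^-1.
Proof. by move=> p0 x0; rewrite ger0_norm ?expR_ge0// expRN_le// mulr_ge0// ltW. Qed.

Lemma lap_intg f p : sqint f -> 0 < p -> intg Rpos (fun x => expR (- (p * x)) * f x).
Proof.
move=> Hf p0; have [H _ _] := schur_test schur_kernel_inv_1D Hf.
apply: intg_le (H p p0) => //.
  by apply: measurable_funM; [exact: measurable_expRN|exact: Hf.1].
by move=> x; rewrite in_Rpos => x0; rewrite normrM ler_wpM2r// lap_kernel_bound.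
Qed.

Lemma lap_norm_le f p : sqint f -> 0 < p ->
  \int[mu]_(x in Rpos) `|expR (- (p * x)) * f x| <= schur_op (fun x t : R => (1 + x * t)^-1) f p.
Proof.
move=> Hf p0; have [H _ _] := schur_test schur_kernel_inv_1D Hf.
apply: le_Rintegral => //; last 2 first.
- exact: H.
- by move=> x; rewrite in_Rpos => x0; rewrite normrM ler_wpM2r// lap_kernel_bound.
exact: (@integrable_norm _ _ _ mu _ _ (lap_intg Hf p0)).
Qed.

Lemma lap_sqint f : sqint f -> sqint (lap f).
Proof.
move=> Hf; have [_ H _] := schur_test schur_kernel_inv_1D Hf.
apply: sqint_le H.
  by apply: measurable_funTS; apply: measurable_Rint => //; [exact: measurable_lap_kernel|exact: Hf.1].
move=> p p0; apply: le_trans (lap_norm_le Hf p0).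
by apply: le_normr_Rintegral => //; exact: lap_intg.
Qed.

Lemma lapD f g p : sqint f -> sqint g -> 0 < p -> lap (f + g) p = lap f p + lap g p.
Proof.
move=> Hf Hg p0; rewrite /lap -RintegralD//; [|exact: lap_intg..].
by apply: Rint_eq => x _; rewrite -mulrDr.
Qed.

Lemma lapZ a f p : sqint f -> 0 < p -> lap (a *: f) p = a * lap f p.
Proof.
move=> Hf p0; rewrite /lap -RintegralZl//; last exact: lap_intg.
by apply: Rint_eq => x _; rewrite mulrCA.
Qed.

Lemma lap_sym f g : sqint f -> sqint g -> ip (lap f) g = ip f (lap g).
Proof.
move=> Hf Hg; have [_ Hs _] := schur_test schur_kernel_inv_1D Hf.
have [|||||||_ _ E] := @Fubini_kernel _ Rpos Rpos (fun p x => expR (- (p * x))) g f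
  (schur_op (fun x t : R => (1 + x * t)^-1) f) (@measurable_Rpos R) (@measurable_Rpos R).
- exact: measurable_lap_kernel.
- exact: Hg.1.
- exact: Hf.1.
- by move=> p; rewrite in_Rpos; exact: lap_intg.
- by move=> x; rewrite in_Rpos => x0; apply: intg_eq (lap_intg Hg x0) => // p _; rewrite (mulrC x).
- by move=> p; rewrite in_Rpos; exact: lap_norm_le.
- have Hg' : sqint (fun x => `|g x|).
    exact: sqint_norm.
  exact: sqint_mul Hg' Hs.
rewrite ipC [LHS]E; apply: Rint_eq => x _; congr (_ * _).
by apply: Rint_eq => p _; rewrite (mulrC x).
Qed.

(** Fubini, and the integral of exp(-(x+t)p) over p. The outer function exp(-x p) is
    square-integrable because it lies below a multiple of the resolvent at 1/x. *)
Lemma lap_lap f x : sqint f -> 0 < x -> lap (lap f) x = \int[mu]_(t in Rpos) ((x + t)^-1 * f t).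
Proof.
move=> Hf x0; have [_ Hs _] := schur_test schur_kernel_inv_1D Hf.
have He : sqint (fun p => expR (- (x * p))).
  apply: (@sqint_le _ (fun p => (1 + x * p)^-1)); first exact: measurable_expRN.
    by move=> p; exact: lap_kernel_bound.
  have xi0 : 0 < x^-1 by rewrite invr_gt0.
  have [m i] := sqintZ x^-1 (sqint_resolvent xi0).
  have E p : 0 < p -> (x^-1 *: (fun t => (x^-1 + t)^-1)) p = (1 + x * p)^-1.
    move=> p0; transitivity (x^-1 * (x^-1 + p)^-1) => //; field.
    by rewrite !gt_eqF// ?addr_gt0// mulr_gt0.
  split.
    apply: (eq_measurable_fun (x^-1 *: (fun t => (x^-1 + t)^-1))) => //.
    by move=> p /set_mem; rewrite in_Rpos; exact: E.
  by apply: intg_eq i => // p; rewrite in_Rpos => p0; rewrite E.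
have [|||||||_ _ E] := @Fubini_kernel _ Rpos Rpos (fun p t => expR (- (p * t)))
  (fun p => expR (- (x * p))) f
  (schur_op (fun x t : R => (1 + x * t)^-1) f) (@measurable_Rpos R) (@measurable_Rpos R).
- exact: measurable_lap_kernel.
- exact: He.1.
- exact: Hf.1.
- by move=> p; rewrite in_Rpos; exact: lap_intg.
- move=> t; rewrite in_Rpos => t0.
  by apply: intg_eq (lap_intg He t0) => // p _; rewrite (mulrC t).
- by move=> p; rewrite in_Rpos; exact: lap_norm_le.
- have Hg' : sqint (fun p => `|expR (- (x * p))|).
    exact: sqint_norm.
  exact: sqint_mul Hg' Hs.
rewrite [LHS]E; apply: Rint_eq => t; rewrite in_Rpos => t0; rewrite mulrC; congr (_ * _).
have [_ <-] := integral_expRN (addr_gt0 x0 t0).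
by apply: Rint_eq => p _; rewrite -expRD; congr expR; ring.
Qed.

(** The Schur test for the majorant of exp(-x t) would give only pi^2. Passing through (L f, L f) =
    (f, L L f) and bounding the Stieltjes operator L L by pi gives the constant pi, and with it the
    upper bound 2 for the transform. *)
Lemma lap_bound f : sqint f -> ip (lap f) (lap f) <= pi * ip f f.
Proof.
move=> Hf; have [iS HS bS] := schur_test schur_kernel_inv_add Hf.
have HL := lap_sqint Hf; have HLL := lap_sqint HL.
have bLL : ip (lap (lap f)) (lap (lap f)) <= pi ^+ 2 * ip f f.
  apply: le_trans bS; apply: le_Rintegral => //; [exact: sqint_mul|exact: sqint_mul|].
  move=> x; rewrite in_Rpos => x0; rewrite lap_lap// -!expr2 -real_normK ?num_real//.
  have xt t : 0 < t -> 0 <= (x + t)^-1 by move=> t0; rewrite invr_ge0 addr_ge0// ltW.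
  rewrite lerXn2r ?nnegrE//; first by apply: Rintegral_ge0 => t; rewrite in_Rpos => t0; rewrite mulr_ge0 ?xt.
  apply: normr_Rint_le => //; [|exact: iS|].
    apply: intg_le (iS x x0) => //.
      by apply: measurable_funM; [exact: (sqint_resolvent x0).1|exact: Hf.1].
    by move=> t; rewrite in_Rpos => t0; rewrite normrM ger0_norm ?xt.
  by move=> t; rewrite in_Rpos => t0; rewrite normrM ger0_norm ?xt.
rewrite lap_sym//; apply: le_trans (ler_norm _) _; apply: le_trans (cauchy_schwarz Hf HLL) _.
rewrite -nrm2 expr2 mulrCA ler_wpM2l ?nrm_ge0//.
rewrite -(ler_pXn2r (n := 2)) ?nnegrE ?mulr_ge0 ?nrm_ge0 ?pi_ge0//.
by rewrite exprMn !nrm2.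
Qed.

End Laplace.

(** * Lebesgue differentiation and density of smooth functions *)

Section Density.
Variable R : realType.
Local Notation mu := (@lebesgue_measure R).
Local Notation intg D f := (mu.-integrable D (EFin \o f)).
Implicit Types (f g : R -> R) (x t a b h B C e : R).

(** Extension by zero gives a locally integrable function on the line, to which Lebesgue
    differentiation applies: a compact set meets the half-line inside some ]0, N]. *)
Lemma ae_FTC g : measurable_fun Rpos g -> (forall x, 0 < x -> intg `]0, x] g) ->
  {ae mu, forall x, 0 < x -> is_derive x 1 (fun y => \int[mu]_(t in `]0, y]) g t) (g x)}.
Proof.
move=> mg ig; pose f := g \_ Rpos.
have fg y x : `]0, y]%classic x -> f x = g x.
  by rewrite /= in_itv /= => /andP[x0 _]; rewrite /f patchE ifT// inE in_Rpos.
have jf y : intg `]0, y] f.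
  have [y0|y0] := ltP 0 y; last by rewrite set_itv_ge ?bnd_simp -?leNgt//; exact: integrable_set0.
  by apply: intg_eq (ig _ y0) => // x xy; rewrite (fg y).
have lf : locally_integrable [set: R] f.
  split; [|exact: openT|].
    by apply/(measurable_restrictT _ _).1.
  move=> K _ cK; have mK := compact_measurable cK.
  have [M [_ KM]] := compact_bounded cK.
  pose N := Num.max M 0 + 1.
  have N0 : 0 < N by rewrite ltr_wpDl// le_max lexx orbT.
  have KN x : K x -> x <= N.
    move=> Kx; apply: le_trans (ler_norm x) _; apply: (KM N) => //.
    by rewrite /N ltr_pwDr// le_max lexx.
  have iN : intg setT (g \_ `]0, N]).
    have := (@integrable_mkcond _ _ _ mu _ _ (measurable_itv `]0, N])).1 (ig _ N0).
    by rewrite restrict_EFin.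
  have iK : intg K (g \_ `]0, N]) by apply: intgS iN.
  have /integrableP[_ //] : intg K f.
  apply: intg_eq iK => // x Kx; rewrite /f !patchE.
  congr (if _ then _ else _); apply/idP/idP; rewrite !inE in_Rpos /= in_itv /=.
    by move=> /andP[].
  by move=> ->; rewrite KN.
have := @FTC1 R f (BRight 0) jf lf; apply: aeS => x H x0.
have {}H : derivable (fun x => \int[mu]_(t in `]0, x]) f t) x 1 /\
  (fun x => \int[mu]_(t in `]0, x]) f t)^`()%classic x = f x by exact: H.
case: H.
have -> : (fun x : R => \int[mu]_(t in `]0, x]) f t) = (fun y => \int[mu]_(t in `]0, y]) g t).
  by apply/funext => y; apply: Rint_eq; exact: fg.
rewrite derive1E => dF dE; split => //; rewrite dE (fg x)//= in_itv /= x0 lexx.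
by [].
Qed.

(** The test by which two representatives of the transform are identified: both are almost
    everywhere the derivative of one primitive. *)
Lemma ae_eq_primitive g1 g2 : measurable_fun Rpos g1 -> measurable_fun Rpos g2 ->
  (forall x, 0 < x -> intg `]0, x] g1) ->
  (forall x, 0 < x -> intg `]0, x] g2) ->
  (forall x, 0 < x -> \int[mu]_(t in `]0, x]) g1 t = \int[mu]_(t in `]0, x]) g2 t) ->
  {ae mu, forall x, Rpos x -> g1 x = g2 x}.
Proof.
move=> m1 m2 i1 i2 E; have := ae_FTC m1 i1; have := ae_FTC m2 i2; apply: aeS2 => x d2 d1.
rewrite in_Rpos => x0; have [_ <-] := d1 x0.
have [_ <-] : is_derive x 1 (fun y => \int[mu]_(t in `]0, y]) g1 t) (g2 x).
  apply: (near_eq_is_derive _ (d2 x0)).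
  near=> y; rewrite E//; near: y; exact: lt_nbhsr.
by [].
Unshelve. all: by end_near. Qed.

(** Posed on all of [R], with interval and bound tracked explicitly, so that averaging can be
    iterated while the support stays inside the half-line. *)
Definition bsupp a b B f :=
  [/\ measurable_fun setT f, forall x, `|f x| <= B & forall x, ~~ (a <= x <= b) -> f x = 0].

Lemma bsupp_intg a b B f D : measurable D -> bsupp a b B f -> intg D f.
Proof.
move=> mD [mf fB f0]; apply: (@intgS _ D setT) => //.
have : intg `[a, b] f.
  by apply: (@intg_bnd _ _ _ B) => //; [exact: mu_itv_fin|exact: measurable_funTS].
move/(@integrable_mkcond _ _ _ mu _ _ (measurable_itv `[a, b])).1.
rewrite restrict_EFin; apply: intg_eq => // x _; rewrite patchE.
by case: ifPn => // /negP; rewrite inE /= in_itv /= => /negP /f0.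
Qed.

Lemma bsupp_sqint a b B f : bsupp a b B f -> sqint f.
Proof.
move=> Hf; have [mf fB f0] := Hf; split; first exact: measurable_funTS.
have := @intgM _ Rpos f f B (@measurable_Rpos R) _ _ (bsupp_intg _ Hf).
by apply=> //; exact: measurable_funTS.
Qed.

Lemma bsuppS a b B a' b' f : a' <= a -> b <= b' -> bsupp a b B f -> bsupp a' b' B f.
Proof.
move=> aa bb [mf fB f0]; split => // x H; apply: f0; apply: contra H => /andP[ax xb].
by rewrite (le_trans aa)// (le_trans xb).
Qed.

Definition prim f x := \int[mu]_(t in `]-oo, x]) f t.

Lemma prim_diff a b B f x y : bsupp a b B f -> x <= y ->
  prim f y - prim f x = \int[mu]_(t in `]x, y]) f t.
Proof.
move=> Hf xy; rewrite /prim Rintegral_itvB//; exact: bsupp_intg Hf.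
Qed.

Lemma prim_lip a b B f x y : bsupp a b B f ->
  `|prim f y - prim f x| <= B * `|y - x|.
Proof.
move=> Hf; wlog xy : x y / x <= y => [H|].
  by have [/H//|/ltW/H] := leP x y; rewrite distrC (distrC y).
have [mf fB f0] := Hf.
rewrite (prim_diff Hf xy) (ger0_norm (x := y - x)) ?subr_ge0//.
have fin : (mu `]x, y] < +oo)%E by exact: mu_itv_fin.
apply: (@le_trans _ _ (\int[mu]_(t in `]x, y]) B)).
  by apply: normr_Rint_le => //; [exact: bsupp_intg Hf|exact: (@intg_cst _ _ B)].
have -> : \int[mu]_(t in `]x, y]) B = B * fine (mu `]x, y]) by exact: Rintegral_cst.
rewrite lebesgue_measure_itv /= lte_fin.
case: ltP => xy'; first by rewrite -EFinD.
have -> : y = x by apply/eqP; rewrite eq_le xy xy'.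
by rewrite subrr.
Qed.

Lemma prim_low a b B f x : bsupp a b B f -> x < a -> prim f x = 0.
Proof.
move=> [mf fB f0] xa; rewrite /prim (Rint_eq (g := cst 0)) ?Rintegral_cst ?mul0r//.
move=> t; rewrite /= in_itv /= => tx; apply: f0.
by rewrite negb_and -ltNge (le_lt_trans tx xa).
Qed.

Lemma prim_high a b B f x y : bsupp a b B f -> b <= x -> x <= y -> prim f y = prim f x.
Proof.
move=> Hf bx xy; apply/eqP; rewrite -subr_eq0 (prim_diff Hf xy); have [mf fB f0] := Hf.
rewrite (Rint_eq (g := cst 0)) ?Rintegral_cst ?mul0r//.
move=> t; rewrite /= in_itv /= => /andP[xt ty]; apply: f0.
by rewrite negb_and orbC -ltNge (le_lt_trans bx xt).
Qed.

(** The Steklov average, that is, the mean of [f] over [x, x + h]. It makes a bounded function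
    Lipschitz and a continuous one C^1, and it moves only the left end of the support. *)
Definition avg h f x := h^-1 * (prim f (x + h) - prim f x).

Lemma lipschitz_continuous f C : (forall x y, `|f x - f y| <= C * `|x - y|) -> continuous f.
Proof.
move=> fC x; apply/cvgrPdist_le => e e0.
have C1 : 0 < `|C| + 1 by rewrite ltr_wpDl.
near=> y; apply: le_trans (fC _ _) _.
apply: (@le_trans _ _ ((`|C| + 1) * `|x - y|)).
  by rewrite ler_wpM2r// (le_trans (ler_norm _))// lerDl.
rewrite mulrC -ler_pdivlMr//; near: y; apply: cvgr_dist_le; first exact: cvg_id.
by rewrite divr_gt0.
Unshelve. all: by end_near. Qed.

Lemma avg_lip a b B f h x y : bsupp a b B f -> 0 < h ->
  `|avg h f x - avg h f y| <= 2 * B / h * `|x - y|.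
Proof.
move=> Hf h0; have hi : 0 <= h^-1 by rewrite invr_ge0 ltW.
rewrite /avg -mulrBr normrM ger0_norm// (mulrC (2 * B)) -[leRHS]mulrA ler_wpM2l//.
have H1 := prim_lip (y + h) (x + h) Hf; have H2 := prim_lip y x Hf.
rewrite (_ : x + h - (y + h) = x - y) in H1; last by ring.
rewrite (_ : _ - _ - _ = (prim f (x + h) - prim f (y + h)) - (prim f x - prim f y)); last by ring.
by apply: (le_trans (ler_normB _ _)); lra.
Qed.

Lemma avg_continuous a b B f h : bsupp a b B f -> 0 < h -> continuous (avg h f).
Proof.
move=> Hf h0; apply: (@lipschitz_continuous _ (2 * B / h)) => x y.
exact: avg_lip Hf h0.
Qed.

Lemma bsupp_avg a b B f h : bsupp a b B f -> 0 < h -> bsupp (a - h) b B (avg h f).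
Proof.
move=> Hf h0; split.
- by apply: cont_meas; exact: avg_continuous Hf h0.
- have hi : 0 <= h^-1 by rewrite invr_ge0 ltW.
  move=> x; rewrite /avg normrM (ger0_norm hi) ler_pdivrMl// mulrC.
  by have := prim_lip x (x + h) Hf; rewrite (addrC x) addrK (ger0_norm (ltW h0)).
- move=> x; rewrite /avg negb_and -!ltNge => /orP[xa|bx].
    by rewrite !(prim_low Hf) ?subrr ?mulr0//; lra.
  by rewrite (prim_high (x := x) Hf) ?subrr ?mulr0//; lra.
Qed.

Lemma prim_ae a b B f : bsupp a b B f -> {ae mu, forall x, is_derive x 1 (prim f) (f x)}.
Proof.
move=> Hf; have [mf fB f0] := Hf.
have lf : locally_integrable [set: R] f.
  apply: open_integrable_locally; first exact: openT.
  exact: bsupp_intg Hf.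
have jf y : intg `]-oo, y] f by exact: bsupp_intg Hf.
have := FTC1Ny jf lf; apply: aeS => x [dF]; rewrite derive1E => dE.
by split.
Qed.

Lemma prim_der a b B f x : bsupp a b B f -> continuous f -> is_derive x 1 (prim f) (f x).
Proof.
move=> Hf cf; have x1 : x < x + 1 by rewrite ltrDl.
have iu : intg [set` `]-oo, x + 1]] f by exact: bsupp_intg Hf.
have H := continuous_FTC1 x1 iu.
have [dF] : derivable (prim f) x 1 /\ (prim f)^`()%classic x = f x.
  by apply: H; [exact: ltNyr|exact: cf].
by rewrite derive1E => dE; split.
Qed.

Lemma der_shift f h x (l : R) : is_derive (x + h) 1 f l ->
  is_derive x 1 (fun y => f (y + h)) l.
Proof.
move=> fl; have H : is_derive x 1 (fun y : R => y + h) 1 by der; rewrite addr0.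
by apply: (is_derive_eq (der_comp H fl)); rewrite mulr1.
Qed.

Lemma avg_der a b B f h x : bsupp a b B f -> continuous f ->
  is_derive x 1 (avg h f) (h^-1 * (f (x + h) - f x)).
Proof.
move=> Hf cf; rewrite /avg.
have d1 : is_derive x 1 (fun y => prim f (y + h)) (f (x + h)).
  by apply: der_shift; exact: prim_der Hf cf.
have := der_mul (der_cst h^-1 x) (der_add d1 (der_opp (prim_der x Hf cf))).
by rewrite mul0r add0r.
Qed.

Lemma avg_cvg f x (h : nat -> R) : (forall n, 0 < h n) -> h n @[n --> \oo] --> (0 : R) ->
  is_derive x 1 (prim f) (f x) -> avg (h n) f x @[n --> \oo] --> f x.
Proof.
move=> h0 hc [dF dE].
have /cvgr_dnbhsP/(_ h) : (fun t => t^-1 *: ((prim f \o shift x) (t *: 1) - prim f x)) @ 0^' --> f x.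
  by rewrite -dE; exact: dF.
have h00 : (forall n, h n != 0) /\ h n @[n --> \oo] --> (0 : R).
  by split => // n; rewrite gt_eqF.
move=> /(_ h00); apply: cvg_trans; apply: near_eq_cvg; apply: nearW => n.
rewrite /avg /= /GRing.scale /=; congr (_ * (prim f _ - _)).
by rewrite mulr1 addrC.
Qed.

(** Averages converge almost everywhere by Lebesgue differentiation. With h <= a/2 they are all
    bounded by [B] and supported in [a/2, b], so dominated convergence applies and the support stays
    away from 0. *)
Lemma avg_approx a b B f e : 0 < a -> bsupp a b B f -> 0 < e ->
  exists2 h, 0 < h <= a / 2 & nrm (f - avg h f) < e.
Proof.
move=> a0 Hf e0; have [mf fB f0] := Hf.
have a20 : 0 < a / 2 by rewrite divr_gt0.
pose h n : R := a / 2 / n.+1%:R.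
have h0 n : 0 < h n by rewrite divr_gt0.
have hc : h n @[n --> \oo] --> (0 : R).
  rewrite -(mulr0 (a / 2)); apply: cvgMr; exact: cvg_harmonic.
have hle n : h n <= a / 2.
  by rewrite /h ler_pdivrMr// ler_peMr ?ler1n// ltW.
have Ha n : bsupp (a / 2) b B (avg (h n) f).
  by apply: bsuppS (bsupp_avg Hf (h0 n)) => //; have := hle n; lra.
have Hf' : bsupp (a / 2) b B f by apply: bsuppS Hf => //; lra.
have Sf := bsupp_sqint Hf.
have Sd n := sqintB Sf (bsupp_sqint (Ha n)).
have [|||||_ cv] := @Rint_dct _ Rpos (fun n x => (f x - avg (h n) f x) ^+ 2) (cst 0)
  ((cst ((B + B) ^+ 2)) \_ `[a / 2, b]) (@measurable_Rpos R).
- by move=> n; apply: measurable_funX; exact: (Sd n).1.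
- exact: measurable_cst.
- have := prim_ae Hf; apply: aeS => x dx _.
  rewrite -[X in _ --> X](expr0n _ 2) -(subrr (f x)).
  apply: (@cvg_comp _ _ _ (fun n => f x - avg (h n) f x) (fun y => y ^+ 2)); last first.
    exact: exprn_continuous.
  by apply: cvgB; [exact: cvg_cst|exact: avg_cvg].
- apply: (@intgS _ _ setT) => //.
  have := (@integrable_mkcond _ _ _ mu _ _ (measurable_itv `[a / 2, b])).1 (@intg_cst _ _ ((B + B) ^+ 2) (measurable_itv `[a / 2, b]) (mu_itv_fin _ _ _ _)).
  by rewrite restrict_EFin.
- move=> n x _; have [_ aB av0] := Ha n; have [_ _ fv0] := Hf'.
  rewrite patchE; case: ifPn => [_|].
    rewrite normrX lerXn2r ?nnegrE//.
      by rewrite addr_ge0// (le_trans _ (fB 0)).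
    by rewrite (le_trans (ler_normB _ _))// lerD// aB.
  rewrite notin_setE /= in_itv /= => /negP xab.
  by rewrite fv0 ?av0// ?subrr ?expr0n ?normr0//; apply/negP.
have cvn : nrm (f - avg (h n) f) @[n --> \oo] --> (0 : R).
  rewrite -(@sqrtr0 R).
  apply: continuous_cvg; first exact: sqrt_continuous.
  have -> : (0 : R) = \int[mu]_(x in Rpos) cst 0 x by rewrite /Rintegral integral0.
  apply: cvg_trans cv; apply: near_eq_cvg; apply: nearW => n.
  by apply: Rint_eq => x _; rewrite expr2.
have /cvgrPdist_lt/(_ _ e0)[n _ /(_ n (leqnn n))] := cvn.
rewrite sub0r normrN ger0_norm ?nrm_ge0// => H.
by exists (h n); rewrite ?h0 ?hle.
Qed.

End Density.

(** * Density of Lipschitz and twice differentiable functions of compact support *)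

Section SmoothDensity.
Variable R : realType.
Local Notation mu := (@lebesgue_measure R).
Local Notation intg D f := (mu.-integrable D (EFin \o f)).
Implicit Types (f g : R -> R) (x t a b h B C e : R).

(** The class on which the norm identity is proved: the Lipschitz bound controls the Poisson
    integral, and a support that begins at a positive [a] keeps 1/(s+t) bounded. *)
Definition lipc (f : R -> R) := exists a b B C,
  [/\ 0 < a, bsupp a b B f & forall x y, `|f x - f y| <= C * `|x - y|].

Lemma trunc_approx f e : sqint f -> 0 < e ->
  exists a b B g, [/\ 0 < a, bsupp a b B g & nrm (f - g) < e].
Proof.
move=> Hf e0; have [mf f2] := Hf.
pose I n := `[n.+1%:R^-1, n.+1%:R]%classic : set R.
pose E n := I n `&` (fun x => `|f x|) @^-1` `]-oo, n.+1%:R].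
have IR n : I n `<=` Rpos.
  by move=> x; rewrite /I in_Rpos /= in_itv /= => /andP[+ _]; apply: lt_le_trans; rewrite invr_gt0.
have mfI n : measurable_fun (I n) (fun x => `|f x|).
  by apply: measurableT_comp => //; apply: measurable_funS mf; [|exact: IR].
have mE n : measurable (E n) by apply: mfI => //; exact: measurable_itv.
have ER n : E n `<=` Rpos by move=> x [/IR].
pose g n := f \_ (E n).
have bg n : bsupp n.+1%:R^-1 n.+1%:R n.+1%:R (g n).
  split.
  - by apply/(measurable_restrictT _ _).1 => //; apply: measurable_funS mf; [|exact: ER].
  - move=> x; rewrite /g patchE; case: ifPn => [|_]; last by rewrite normr0.
    by rewrite inE => -[_]; rewrite /= in_itv.
  - move=> x xI; rewrite /g patchE ifN//; rewrite notin_setE => -[+ _].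
    by rewrite /I /= in_itv /=; apply/negP.
have Sg n := bsupp_sqint (bg n).
have [|||||_ cv] := @Rint_dct _ Rpos (fun n x => (f x - g n x) ^+ 2) (cst 0)
  (fun x => f x ^+ 2) (@measurable_Rpos R).
- by move=> n; apply: measurable_funX; exact: (sqintB Hf (Sg n)).1.
- exact: measurable_cst.
- apply/aeW => x; rewrite in_Rpos => x0; apply: cvg_near_cst; near=> n.
  rewrite /g patchE ifT ?subrr ?expr0n// inE; split; rewrite /I /= in_itv /=.
    apply/andP; split; last first.
      by rewrite (@le_trans _ _ n%:R)// ?ler_nat//; near: n; exact: nbhs_infty_ger.
    rewrite -[leRHS]invrK lef_pV2 ?posrE ?invr_gt0//.
    by rewrite (@le_trans _ _ n%:R)// ?ler_nat//; near: n; exact: nbhs_infty_ger.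
  by rewrite (@le_trans _ _ n%:R)// ?ler_nat//; near: n; exact: nbhs_infty_ger.
- exact: f2.
- move=> n x _; rewrite ger0_norm ?sqr_ge0// /g patchE.
  by case: ifPn => _; rewrite ?subrr ?subr0// expr0n sqr_ge0.
have cvn : nrm (f - g n) @[n --> \oo] --> (0 : R).
  rewrite -(@sqrtr0 R).
  apply: continuous_cvg; first exact: sqrt_continuous.
  have -> : (0 : R) = \int[mu]_(x in Rpos) cst 0 x by rewrite /Rintegral integral0.
  apply: cvg_trans cv; apply: near_eq_cvg; apply: nearW => n.
  by apply: Rint_eq => x _; rewrite expr2.
have /cvgrPdist_lt/(_ _ e0)[n _ /(_ n (leqnn n))] := cvn.
rewrite sub0r normrN ger0_norm ?nrm_ge0// => H.
by exists n.+1%:R^-1, n.+1%:R, n.+1%:R, (g n); rewrite invr_gt0.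
Unshelve. all: by end_near. Qed.

(** Three averages, because the first only turns a bounded function into a Lipschitz one; the next
    two supply the first and second continuous derivatives. Each derivative is a difference quotient
    of the preceding stage. *)
Lemma C2_avg a b B f h1 h2 h3 : 0 < a -> bsupp a b B f -> 0 < h1 -> 0 < h2 -> 0 < h3 ->
  C2_on Rpos (avg h3 (avg h2 (avg h1 f))).
Proof.
move=> a0 Hf h10 h20 h30.
have H1 := bsupp_avg Hf h10; have H2 := bsupp_avg H1 h20.
have c1 := avg_continuous Hf h10; have c2 := avg_continuous H1 h20.
set g1 := avg h1 f in H1 H2 c1 c2 *; set g2 := avg h2 g1 in H2 c2 *.
pose d2 x := h2^-1 * (g1 (x + h2) - g1 x).
have D2 x : is_derive x 1 g2 (d2 x) by exact: avg_der H1 c1.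
pose d3 x := h3^-1 * (g2 (x + h3) - g2 x).
have D3 x : is_derive x 1 (avg h3 g2) (d3 x) by exact: avg_der H2 c2.
have E3 : (avg h3 g2)^`()%classic = d3.
  by apply/funext => x; rewrite derive1E; case: (D3 x).
pose dd3 x := h3^-1 * (d2 (x + h3) - d2 x).
have DD3 x : is_derive x 1 d3 (dd3 x).
  have s1 : is_derive x 1 (fun y => g2 (y + h3)) (d2 (x + h3)).
    by apply: der_shift; exact: D2.
  have := der_mul (der_cst h3^-1 x) (der_add s1 (der_opp (D2 x))).
  by rewrite mul0r add0r.
have EE3 : (avg h3 g2)^`(2)%classic = dd3.
  rewrite derive1nS /=; apply/funext => x; rewrite E3 derive1E; case: (DD3 x).
  by [].
have cd2 : continuous d2.
  move=> x; apply: cvgMr; apply: cvgB; last exact: c1.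
  by apply: (@continuous_comp _ _ _ (fun y => y + h2) g1); [apply: cvgD; [exact: cvg_id|exact: cvg_cst]|exact: c1].
have cdd3 : continuous dd3.
  move=> x; apply: cvgMr; apply: cvgB; last exact: cd2.
  by apply: (@continuous_comp _ _ _ (fun y => y + h3) d2); [apply: cvgD; [exact: cvg_id|exact: cvg_cst]|exact: cd2].
move=> x _; split.
- by case: (D3 x).
- by rewrite E3; case: (DD3 x).
- by rewrite EE3; exact: cdd3.
Qed.

(** One approximant is both Lipschitz and C^2, so the same density serves the norm identity and the
    uniqueness of the extension from [C2c]. A quarter of [e] goes to the truncation and to each of
    the three averages, every one of which halves the left end of the support. *)
Lemma lipc_dense f e : sqint f -> 0 < e -> exists g, [/\ lipc g, C2_on Rpos g & nrm (f - g) < e].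
Proof.
move=> Hf e0; have e4 : 0 < e / 4 by rewrite divr_gt0.
have [a [b [B [g0 [a0 H0 n0]]]]] := trunc_approx Hf e4.
have half (c : R) : 0 < c -> 0 < c / 2 by move=> c0; rewrite divr_gt0.
have step (c : R) g : 0 < c -> bsupp c b B g -> exists h, [/\ 0 < h, bsupp (c / 2) b B (avg h g) & nrm (g - avg h g) < e / 4].
  move=> c0 Hg; have [h /andP[h0 hc] hn] := avg_approx c0 Hg e4.
  exists h; split => //; apply: bsuppS (bsupp_avg Hg h0) => //; lra.
have [h1 [h10 H1 n1]] := step _ _ a0 H0.
have [h2 [h20 H2 n2]] := step _ _ (half _ a0) H1.
have [h3 [h30 H3 n3]] := step _ _ (half _ (half _ a0)) H2.
set g1 := avg h1 g0 in H1 n1 H2 n2 H3 n3 *; set g2 := avg h2 g1 in H2 n2 H3 n3 *.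
set g3 := avg h3 g2 in H3 n3 *.
exists g3; split.
- exists (a / 2 / 2 / 2), b, B, (2 * B / h3); split; first by rewrite !divr_gt0.
    exact: H3.
  by move=> x y; exact: avg_lip H2 h30.
- exact: C2_avg a0 H0 h10 h20 h30.
have S0 := bsupp_sqint H0; have S1 := bsupp_sqint H1.
have S2 := bsupp_sqint H2; have S3 := bsupp_sqint H3.
have -> : f - g3 = (f - g0) + ((g0 - g1) + ((g1 - g2) + (g2 - g3))).
  by rewrite !addrA !subrK.
have -> : e = e / 4 + (e / 4 + (e / 4 + e / 4)) by field.
have S12 := sqintB S1 S2; have S23 := sqintB S2 S3; have S01 := sqintB S0 S1.
apply: (le_lt_trans (nrmD (sqintB Hf S0) (sqintD S01 (sqintD S12 S23)))).
apply: (ltrD n0); apply: (le_lt_trans (nrmD S01 (sqintD S12 S23))).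
by apply: (ltrD n1); apply: (le_lt_trans (nrmD S12 S23)); exact: (ltrD n2 n3).
Qed.

Lemma lipc_sqint f : lipc f -> sqint f.
Proof. by move=> [a [b [B [C [_ /bsupp_sqint]]]]]. Qed.

Lemma lipc_intg f : lipc f -> intg Rpos f.
Proof. by move=> [a [b [B [C [_ + _]]]]]; exact: bsupp_intg. Qed.

Lemma lipcB f g : lipc f -> lipc g -> lipc (f - g).
Proof.
move=> [a [b [B [C [a0 [mf fB f0] fC]]]]] [a' [b' [B' [C' [a'0 [mg gB g0] gC]]]]].
exists (Num.min a a'), (Num.max b b'), (B + B'), (C + C'); split.
- by rewrite lt_min a0 a'0.
- split.
  + exact: measurable_funB.
  + by move=> x; apply: (le_trans (ler_normB _ _)); exact: lerD.
  + move=> x H; rewrite !fctE f0 ?g0 ?subrr//; apply: contra H => /andP[H1 H2].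
      by rewrite ge_min le_max H1 H2 !orbT.
    by rewrite ge_min le_max H1 H2.
- move=> x y; rewrite !fctE opprD addrACA mulrDl (le_trans (ler_normD _ _))//.
  by rewrite lerD// -opprD normrN.
Qed.

(** Additivity is asked in the form T f = T g + T (f - g), which holds exactly for pairings with
    operators that are linear only almost everywhere. *)
Lemma dense_eq0 (T : (R -> R) -> R) M : 0 <= M ->
  (forall f g, sqint f -> sqint g -> T f = T g + T (f - g)) ->
  (forall f, sqint f -> `|T f| <= M * nrm f) ->
  (forall f, lipc f -> T f = 0) -> forall f, sqint f -> T f = 0.
Proof.
move=> M0 TD TM T0 f Hf; apply/eqP; rewrite -normr_le0; apply/ler_addgt0Pl => e e0.
rewrite addr0; have M1 : 0 < M + 1 by rewrite ltr_wpDl.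
have eM : 0 < e / (M + 1) by rewrite divr_gt0.
have [g [Hg _ fg]] := lipc_dense Hf eM; have Sg := lipc_sqint Hg.
rewrite (TD _ _ Hf Sg) T0// add0r; apply: le_trans (TM _ (sqintB Hf Sg)) _.
apply: (@le_trans _ _ ((M + 1) * (e / (M + 1)))).
  by apply: ler_pM => //; [exact: nrm_ge0|rewrite lerDl|exact: ltW].
by rewrite mulrCA divff ?mulr1// gt_eqF.
Qed.

End SmoothDensity.

(** * Completeness *)

Section Completeness.
Variable R : realType.
Local Notation mu := (@lebesgue_measure R).
Local Notation intg D f := (mu.-integrable D (EFin \o f)).
Implicit Types (f g : R -> R) (x t : R).

(** Expand c^-1 (c a - 1)^2 >= 0. It turns summability of weighted squares into summability of the
    terms themselves. *)
Lemma le_weighted_square (a c : R) : 0 <= a -> 0 < c -> a <= c * a ^+ 2 + c^-1.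
Proof.
move=> a0 c0; have ci : 0 < c^-1 by rewrite invr_gt0.
have := mulr_ge0 (ltW ci) (sqr_ge0 (c * a - 1)).
have -> : c^-1 * (c * a - 1) ^+ 2 = c * a ^+ 2 - 2 * a + c^-1 by field; rewrite gt_eqF.
by move=> H1; lra.
Qed.

Lemma sum_half n : \sum_(0 <= i < n) (2^-1 : R) ^+ i <= 2.
Proof.
suff -> : \sum_(0 <= i < n) (2^-1 : R) ^+ i = 2 - 2 * 2^-1 ^+ n.
  by rewrite lerBlDr lerDl mulr_ge0// exprn_ge0.
elim: n => [|n IH]; first by rewrite big_geq// expr0 mulr1 subrr.
by rewrite big_nat_recr//= IH exprS; lra.
Qed.

Lemma L2_cauchy_bound (g : nat -> R -> R) n k : (forall n, sqint (g n)) ->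
  (forall n, nrm (g n.+1 - g n) <= 2^-1 ^+ n) ->
  nrm (g (k + n)%N - g n) <= 2 * 2^-1 ^+ n.
Proof.
move=> Hg dg.
(* The stronger bound carries the exact geometric partial sum, which closes the induction on [k]. *)
suff : nrm (g (k + n)%N - g n) <= 2 * 2^-1 ^+ n * (1 - 2^-1 ^+ k).
  move/le_trans; apply; apply: ler_piMr; first by rewrite mulr_ge0 ?exprn_ge0.
  by rewrite lerBlDr lerDl exprn_ge0.
elim: k => [|k IH].
  by rewrite add0n expr0 !subrr mulr0 /nrm /ip (Rint_eq (g := cst 0)) ?Rintegral_cst ?mul0r ?sqrtr0// => x _; rewrite mul0r.
rewrite addSn (_ : g (k + n).+1 - g n = (g (k + n).+1 - g (k + n)%N) + (g (k + n)%N - g n)); last by rewrite addrA subrK.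
apply: le_trans (nrmD (sqintB (Hg _) (Hg _)) (sqintB (Hg _) (Hg _))) _.
have := dg (k + n)%N; rewrite exprS exprD => H.
have -> : 2 * 2^-1 ^+ n * (1 - 2^-1 * 2^-1 ^+ k) = 2^-1 ^+ k * 2^-1 ^+ n + 2 * 2^-1 ^+ n * (1 - 2^-1 ^+ k) :> R.
  by field.
exact: lerD.
Qed.

(** The squared increments weighted by 2^n have integrals at most 2^-n, so their sum is finite
    almost everywhere, and there [le_weighted_square] makes the telescoping series converge
    absolutely. Fatou's lemma then bounds the distance to the limit. *)
Lemma L2_complete (g : nat -> R -> R) : (forall n, sqint (g n)) ->
  (forall n, nrm (g n.+1 - g n) <= 2^-1 ^+ n) ->
  exists2 f, sqint f & nrm (g n - f) @[n --> \oo] --> (0 : R).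
Proof.
move=> Hg dg.
pose d n := g n.+1 - g n.
have Hd n : sqint (d n) by exact: sqintB.
pose w n x : R := 2 ^+ n * d n x ^+ 2.
have w0 n x : 0 <= w n x by rewrite mulr_ge0 ?sqr_ge0 ?exprn_ge0.
have iw n : intg Rpos (w n) by exact: intgZl (Hd n).2.
pose h x := (\sum_(n <oo) (w n x)%:E)%E.
have w0' n x : Rpos x -> (0 <= (w n x)%:E)%E by move=> _; rewrite lee_fin.
have mw n : measurable_fun Rpos (fun x => (w n x)%:E) by exact: measurable_int (iw n).
have ih : mu.-integrable Rpos h.
  apply/integrableP; split.
    apply: (ge0_emeasurable_sum (h := fun n x => (w n x)%:E)) => //.
    by move=> k x Dx _; exact: w0'.
  apply: (@le_lt_trans _ _ 2%:E); last exact: ltry.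
  rewrite (_ : (\int[mu]_(x in Rpos) _ = \int[mu]_(x in Rpos) h x)%E); last first.
    by apply: eq_integral => x _; rewrite gee0_abs// nneseries_ge0// => n _ _; rewrite lee_fin.
  rewrite integral_nneseries//; apply: lime_le.
    by apply: is_cvg_nneseries => n _ _; apply: integral_ge0 => x _; rewrite lee_fin.
  apply: nearW => n; apply: (@le_trans _ _ (\sum_(0 <= i < n) (2^-1 ^+ i)%:E)%E); last first.
    by rewrite sumEFin lee_fin sum_half.
  apply: lee_sum => i _; rewrite -RintE// lee_fin /w RintegralZl//; last exact: (Hd i).2.
  have -> : \int[mu]_(x in Rpos) d i x ^+ 2 = nrm (d i) ^+ 2.
    by rewrite nrm2; apply: Rint_eq => x _; rewrite expr2.
  apply: (@le_trans _ _ (2 ^+ i * (2^-1 ^+ i) ^+ 2)).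
    rewrite ler_wpM2l ?exprn_ge0//; apply: lerXn2r; last exact: dg.
      by rewrite nnegrE nrm_ge0.
    by rewrite nnegrE exprn_ge0.
  by rewrite expr2 mulrA -exprMn divff// expr1n mul1r.
have cvgg : {ae mu, forall x, Rpos x -> cvgn (fun n => g n x)}.
  have := @integrable_ae _ _ _ mu _ (@measurable_Rpos R) _ ih; apply: aeS => x H Dx.
  have hfin := H Dx.
  have cw : cvgn (series (w ^~ x)).
    apply: nnseries_is_cvg => //.
    by move: hfin; rewrite fin_numElt => /andP[_].
  have cd : cvgn (series (fun n => d n x)).
    apply: normed_cvg.
    apply: (@series_le_cvg _ _ (w ^~ x + geometric 1 (2^-1 : R))).
    - by move=> n; exact: normr_ge0.
    - move=> n; apply: addr_ge0; first exact: w0.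
      by rewrite /= mul1r exprn_ge0.
    - move=> n; change (`|d n x| <= w n x + 1 * 2^-1 ^+ n); rewrite mul1r /w.
      have c0 : 0 < (2 : R) ^+ n by rewrite exprn_gt0.
      rewrite exprVn -(@real_normK _ (d n x)) ?num_real//.
      exact: le_weighted_square.
    - apply: is_cvg_seriesD => //; apply: is_cvg_geometric_series.
      by rewrite ger0_norm// invf_lt1// ltr1n.
  have : cvgn (series (telescope (fun n => g n x))) by [].
  rewrite telescopeK => cg.
  have cg2 : cvgn ([sequence g n x - g 0%N x]_n + (fun=> g 0%N x)).
    by apply: is_cvgD => //; exact: is_cvg_cst.
  have -> : (fun n => g n x) = [sequence g n x - g 0%N x]_n + (fun=> g 0%N x).
    by apply/funext => n; rewrite !fctE /= subrK.
  exact: cg2.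
(* The upper limit is measurable whether or not the sequence converges at [x]; [fine] gives it a
   real value on the exceptional null set too. *)
pose f x := fine (limn_esup (fun n => (g n x)%:E)).
have mf : measurable_fun Rpos f.
  apply: measurableT_comp => //; apply: measurable_fun_limn_esup => n.
  by apply/measurable_EFinP; exact: (Hg n).1.
have gf : {ae mu, forall x, Rpos x -> g n x @[n --> \oo] --> f x}.
  move: cvgg; apply: aeS => x H /H cg.
  have cg' : (fun n => (g n x)%:E) @ \oo --> (limn (fun n => g n x))%:E.
    by apply: cvg_EFin; [exact: nearW|exact: cg].
  by rewrite /f (cvg_limn_einf_sup cg').2.
have bnd n : sqint (g n - f) /\ nrm (g n - f) <= 2 * 2^-1 ^+ n.
  have [|||||H1 H2] := @Rint_fatou _ Rpos (fun k x => (g n x - g (k + n)%N x) ^+ 2)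
    (fun x => (g n x - f x) ^+ 2) ((2 * 2^-1 ^+ n) ^+ 2) (@measurable_Rpos R).
  - by move=> k; exact: (sqintB (Hg n) (Hg _)).2.
  - by apply: measurable_funX; apply: measurable_funB => //; exact: (Hg n).1.
  - by move=> k x _; exact: sqr_ge0.
  - move: gf; apply: aeS => x H /H cg.
    apply: (@cvg_comp _ _ _ (fun k => g n x - g (k + n)%N x) (fun y => y ^+ 2)); last exact: exprn_continuous.
    by apply: cvgB; [exact: cvg_cst|rewrite (cvg_shiftn n (fun k => g k x))].
  - move=> k; have -> : \int[mu]_(x in Rpos) (g n x - g (k + n)%N x) ^+ 2 = nrm (g n - g (k + n)%N) ^+ 2.
      by rewrite nrm2; apply: Rint_eq => x _; rewrite expr2.
    rewrite lerXn2r ?nnegrE ?nrm_ge0 ?mulr_ge0 ?exprn_ge0//.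
    by rewrite nrmB//; exact: L2_cauchy_bound.
  have S : sqint (g n - f).
    by split => //; apply: measurable_funB => //; exact: (Hg n).1.
  split => //; rewrite -(ler_pXn2r (n := 2)) ?nnegrE ?nrm_ge0 ?mulr_ge0 ?exprn_ge0// nrm2.
  apply: le_trans H2; rewrite le_eqVlt; apply/orP; left; apply/eqP.
  by apply: Rint_eq => x _; rewrite ger0_norm ?sqr_ge0// expr2.
exists f.
  have -> : f = g 0%N - (g 0%N - f) by rewrite opprB addrC subrK.
  by apply: sqintB => //; exact: (bnd 0%N).1.
apply: (@squeeze_cvgr _ _ _ _ (cst 0) (fun n => 2 * 2^-1 ^+ n)).
- by apply: nearW => n; rewrite /= nrm_ge0; exact: (bnd n).2.
- exact: cvg_cst.
- rewrite -(mulr0 2); apply: cvgMr; apply: cvg_expr.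
  by rewrite ger0_norm// invf_lt1// ltr1n.
Qed.

End Completeness.

(** * The norm identity on Lipschitz functions of compact support *)

Section Hartley.
Variable R : realType.
Local Notation mu := (@lebesgue_measure R).
Local Notation intg D f := (mu.-integrable D (EFin \o f)).
Implicit Types (f g : R -> R) (x s t a b B C e : R).

Definition cas x := cos x + sin x.

Definition hart f x := \int[mu]_(t in Rpos) (cas (x * t) * f t).

Lemma cas_bound x : `|cas x| <= 2.
Proof.
have := trig_bound 1 1 x; rewrite !mul1r => /le_trans; apply.
by rewrite normr1.
Qed.

Lemma cas_continuous : continuous (@cas).
Proof. by rewrite /cas; der_continuous. Qed.

Lemma measurable_cas_kernel : measurable_fun setT (fun z : R * R => cas (z.1 * z.2)).
Proof.
apply: measurable_comp_cont; first exact: cas_continuous.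
exact: measurable_funM.
Qed.

Lemma measurable_cas x D : measurable_fun D (fun t => cas (x * t)).
Proof. by apply: cont_meas; rewrite /cas; der_continuous. Qed.

(** The difference frequency will produce the Poisson kernel, hence the multiple of |f|^2 in the
    norm identity; the sum frequency will produce the Stieltjes kernel. *)
Lemma cas_mul x s t :
  cas (x * t) * cas (x * s) = cos ((s - t) * x) + sin ((s + t) * x).
Proof.
by rewrite mulrBl (mulrDl s) cosB sinD /cas !(mulrC x); ring.
Qed.

Lemma hart_intg f x : intg Rpos f -> intg Rpos (fun t => cas (x * t) * f t).
Proof.
move=> jf; apply: (@intgM _ _ _ _ 2) => //; first exact: measurable_cas.
by move=> t _; exact: cas_bound.
Qed.

Lemma hart_bound f x : intg Rpos f -> `|hart f x| <= 2 * \int[mu]_(t in Rpos) `|f t|.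
Proof.
move=> jf; have nf := @integrable_norm _ _ _ mu _ _ jf.
rewrite -RintegralZl//; apply: normr_Rint_le => //; [exact: hart_intg|exact: intgZl|].
by move=> t _; rewrite normrM ler_wpM2r// cas_bound.
Qed.

Lemma measurable_hart f D : measurable_fun Rpos f -> measurable_fun D (hart f).
Proof.
move=> mf; apply: measurable_funTS; apply: measurable_Rint => //.
exact: measurable_cas_kernel.
Qed.

(** The damping makes the triple integral absolutely convergent. The two copies of [hart f] are
    unfolded one at a time by Fubini with the bounded kernel [cas]; the [x]-integral that remains is
    elementary. *)
Lemma hart_abel f e : intg Rpos f -> 0 < e ->
  intg Rpos (fun x => expR (- (e * x)) * hart f x ^+ 2) /\
  \int[mu]_(x in Rpos) (expR (- (e * x)) * hart f x ^+ 2) =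
  \int[mu]_(s in Rpos) (f s * \int[mu]_(t in Rpos)
     (f t * (e / (e ^+ 2 + (s - t) ^+ 2) + (s + t) / (e ^+ 2 + (s + t) ^+ 2)))).
Proof.
move=> jf e0; have [iE _] := integral_expRN e0.
pose N := 2 * \int[mu]_(t in Rpos) `|f t|.
pose u x := expR (- (e * x)) * hart f x.
have iu : intg Rpos u.
  have : intg Rpos (fun x => hart f x * expR (- (e * x))).
    apply: (@intgM _ _ _ _ N) => //; first exact: measurable_hart (intg_meas jf).
    by move=> x _; exact: hart_bound.
  by apply: intg_eq => // x _; rewrite mulrC.
have mK := measurable_cas_kernel.
have Kb x y : Rpos x -> Rpos y -> `|cas (x * y)| <= 2 by move=> _ _; exact: cas_bound.
have [H1 _ H3] := @Fubini_bounded _ _ _ (fun x y => cas (x * y)) _ _ _ (@measurable_Rpos R) (@measurable_Rpos R) mK iu jf Kb.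
split; first by apply: intg_eq H1 => // x _; rewrite /u -mulrA -expr2.
transitivity (\int[mu]_(x in Rpos) (u x * hart f x)).
  by apply: Rint_eq => x _; rewrite /u -mulrA -expr2.
rewrite [LHS]H3; apply: Rint_eq => s _; congr (_ * _).
pose v x := expR (- (e * x)) * cas (x * s).
have iv : intg Rpos v.
  have : intg Rpos (fun x => cas (s * x) * expR (- (e * x))).
    apply: (@intgM _ _ _ _ 2) => //; first exact: measurable_cas.
    by move=> x _; exact: cas_bound.
  by apply: intg_eq => // x _; rewrite /v mulrC (mulrC s).
have [_ _ H4] := @Fubini_bounded _ _ _ (fun x y => cas (x * y)) _ _ _ (@measurable_Rpos R) (@measurable_Rpos R) mK iv jf Kb.
transitivity (\int[mu]_(x in Rpos) (v x * hart f x)).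
  by apply: Rint_eq => x _; rewrite /u /v; ring.
rewrite [LHS]H4; apply: Rint_eq => t _; congr (_ * _).
have [C1 C2] := integral_expRN_trig 1 0 (s - t) e0.
have [S1 S2] := integral_expRN_trig 0 1 (s + t) e0.
transitivity ((1 * e + 0 * (s - t)) / (e ^+ 2 + (s - t) ^+ 2) +
  (0 * e + 1 * (s + t)) / (e ^+ 2 + (s + t) ^+ 2)); last by congr (_ / _ + _ / _); ring.
rewrite -C2 -S2 -RintegralD//; apply: Rint_eq => x _.
by rewrite /v mulrCA cas_mul; ring.
Qed.

Lemma poisson_integral e s a b : 0 < e -> a < b ->
  \int[mu]_(t in `[a, b]) (e / (e ^+ 2 + (s - t) ^+ 2)) =
  atan ((b - s) / e) + atan ((s - a) / e).
Proof.
move=> e0 ab; pose F t := - atan ((s - t) / e).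
have D t : 0 < e ^+ 2 + (s - t) ^+ 2 by rewrite ltr_pwDl ?sqr_ge0// exprn_gt0.
have -> : atan ((b - s) / e) + atan ((s - a) / e) = F b - F a.
  by rewrite /F opprK -atanN -mulNr opprB.
apply: FTC2 => //.
  move=> t; rewrite /F; der; have en0 : e != 0 by rewrite gt_eqF.
  have -> : 1 + ((s - t) / e) ^+ 2 = (e ^+ 2 + (s - t) ^+ 2) / e ^+ 2 by field.
  by field; rewrite en0 gt_eqF.
by apply: der_cont => t; eexists; repeat der_step; rewrite gt_eqF.
Qed.

Lemma poisson_nonneg e s t : 0 < e -> 0 <= e / (e ^+ 2 + (s - t) ^+ 2).
Proof. by move=> e0; rewrite divr_ge0 ?addr_ge0 ?sqr_ge0// ltW. Qed.

(** From 2 e |s - t| <= e^2 + (s - t)^2. Together with a Lipschitz bound it dominates (f t - f s)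
    times the Poisson kernel by a constant independent of [e]. *)
Lemma poisson_lip e s t : 0 < e -> `|t - s| * (e / (e ^+ 2 + (s - t) ^+ 2)) <= 1.
Proof.
move=> e0; have D : 0 < e ^+ 2 + (s - t) ^+ 2 by rewrite ltr_pwDl ?sqr_ge0// exprn_gt0.
rewrite mulrA ler_pdivrMr// mul1r distrC.
have := sqr_ge0 (`|s - t| - e); rewrite -(@real_normK _ (s - t)) ?num_real//.
have := normr_ge0 (s - t); nra.
Qed.

Definition eps (n : nat) : R := n.+1%:R^-1.

Lemma eps_gt0 n : 0 < eps n. Proof. by rewrite invr_gt0. Qed.

Lemma eps_cvg : eps n @[n --> \oo] --> (0 : R).
Proof. exact: cvg_harmonic. Qed.

Lemma atan_eps_cvg b : 0 < b -> atan (b / eps n) @[n --> \oo] --> (pi / 2 : R).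
Proof.
move=> b0; apply: cvg_comp (@cvgy_atan R).
have -> : (fun n => b / eps n) = (fun n => b * n.+1%:R) by apply/funext => n; rewrite /eps invrK.
apply: (@cvg_comp _ _ _ (fun n => n.+1%:R : R) (fun x => b * x) _ +oo).
  by rewrite (cvg_shiftS (fun n => n%:R : R)); exact: cvgr_idn.
by apply: gt0_cvgMry => //; exact: cvg_id.
Qed.

(** Split f t = f s + (f t - f s). The first part integrates to two arctangents, each tending to
    pi/2 because [s] is strictly inside; the second tends to 0 pointwise and is dominated by [C]. *)
Lemma poisson_cvg f B C a b s : (forall x, `|f x| <= B) ->
  (forall x y, `|f x - f y| <= C * `|x - y|) -> a < s < b ->
  \int[mu]_(t in `[a, b]) (f t * (eps n / (eps n ^+ 2 + (s - t) ^+ 2))) @[n --> \oo] --> pi * f s.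
Proof.
move=> fB fC /andP[as_ sb]; have ab : a < b by exact: lt_trans sb.
have cf : continuous f by exact: lipschitz_continuous fC.
have mab := measurable_itv `[a, b].
have D n t : 0 < eps n ^+ 2 + (s - t) ^+ 2 by rewrite ltr_pwDl ?sqr_ge0// exprn_gt0// eps_gt0.
have cP n : continuous (fun t => eps n / (eps n ^+ 2 + (s - t) ^+ 2)).
  by apply: der_cont => t; eexists; repeat der_step; rewrite gt_eqF.
have C0 : 0 <= C.
  have := fC a b; rewrite -(pmulr_lge0 _ (x := `|a - b|)) => [|] ; last by rewrite normr_gt0 subr_eq0 lt_eqF.
  by apply: le_trans.
have E n : \int[mu]_(t in `[a, b]) (f t * (eps n / (eps n ^+ 2 + (s - t) ^+ 2))) =
  f s * (atan ((b - s) / eps n) + atan ((s - a) / eps n)) +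
  \int[mu]_(t in `[a, b]) ((f t - f s) * (eps n / (eps n ^+ 2 + (s - t) ^+ 2))).
  rewrite -poisson_integral ?eps_gt0// -RintegralZl//; last exact: cont_intg.
  rewrite -RintegralD//; first by apply: Rint_eq => t _; ring.
  - by apply: intgZl => //; exact: cont_intg.
  - apply: cont_intg => t; apply: cvgM; last exact: cP.
    by apply: cvgB; [exact: cf|exact: cvg_cst].
have [|||||_ cv] := @Rint_dct _ `[a, b]%classic (fun n t => (f t - f s) * (eps n / (eps n ^+ 2 + (s - t) ^+ 2)))
  (cst 0) (cst C) mab.
- move=> n; apply: measurable_funM; last exact: cont_meas.
  by apply: measurable_funB => //; exact: cont_meas.
- exact: measurable_cst.
- apply/aeW => t _; rewrite -[X in _ --> X](mulr0 (f t - f s)).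
  have [->|ts] := eqVneq t s; first by rewrite subrr mul0r; under eq_fun do rewrite mul0r; exact: cvg_cst.
  apply: cvgMr; rewrite -[X in _ --> X](mul0r (0 ^+ 2 + (s - t) ^+ 2)^-1).
  have st : 0 ^+ 2 + (s - t) ^+ 2 != 0 by rewrite expr0n /= add0r sqrf_eq0 subr_eq0 eq_sym.
  apply: cvgM; first exact: eps_cvg.
  apply: cvgV => //; apply: cvgD; last exact: cvg_cst.
  by apply: (@cvg_comp _ _ _ eps (fun y => y ^+ 2)); [exact: eps_cvg|exact: exprn_continuous].
- by apply: intg_cst => //; exact: mu_itv_fin.
- move=> n t _; rewrite normrM (ger0_norm (poisson_nonneg _ _ (eps_gt0 n))).
  apply: (@le_trans _ _ (C * `|t - s| * (eps n / (eps n ^+ 2 + (s - t) ^+ 2)))).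
    by rewrite ler_wpM2r ?fC// poisson_nonneg// eps_gt0.
  by rewrite -mulrA ler_piMr// poisson_lip// eps_gt0.
under eq_cvg do rewrite E.
rewrite (_ : pi * f s = f s * (pi / 2 + pi / 2) + \int[mu]_(t in `[a, b]) cst 0 t); last first.
  by rewrite /Rintegral integral0 /= addr0; field.
apply: cvgD => //; apply: cvgMr; apply: cvgD; apply: atan_eps_cvg; rewrite subr_gt0//.
Qed.

End Hartley.

(** * Passage to the limit in the Abel means *)

Section HartleyNorm.
Variable R : realType.
Local Notation mu := (@lebesgue_measure R).
Local Notation intg D f := (mu.-integrable D (EFin \o f)).
Implicit Types (f g : R -> R) (x s t a b B C e : R).

(** Enlarging [a, b] puts every point of the support, end points included, strictly inside the
    interval of integration, as [poisson_cvg] requires. *)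
Lemma bsupp_Rint a b a' b' B f (G : R -> R) : 0 < a' -> a' <= a -> b <= b' -> bsupp a b B f ->
  \int[mu]_(t in Rpos) (f t * G t) = \int[mu]_(t in `[a', b']) (f t * G t).
Proof.
move=> a0 aa bb [mf fB f0]; rewrite Rintegral_mkcond [RHS]Rintegral_mkcond.
apply: eq_Rintegral => t _; rewrite !patchE.
have [H|H] := boolP (a <= t <= b); last by rewrite (f0 _ H) !mul0r; do 2 case: ifP.
have /andP[at_ tb] := H.
rewrite !ifT// inE ?in_Rpos.
- by rewrite /= in_itv /= (le_trans aa)// (le_trans tb).
- by rewrite (lt_le_trans a0)// (le_trans aa).
Qed.

Lemma stieltjes_reg_bound e (u : R) : 0 < u -> 0 <= u / (e ^+ 2 + u ^+ 2) <= u^-1.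
Proof.
move=> u0; have D : 0 < e ^+ 2 + u ^+ 2 by rewrite ltr_wpDl ?sqr_ge0// exprn_gt0.
apply/andP; split; first by rewrite divr_ge0// ltW.
by rewrite ler_pdivrMr// ler_pdivlMl// -expr2 lerDr sqr_ge0.
Qed.

Lemma stieltjes_cvg f s : sqint f -> 0 < s ->
  \int[mu]_(t in Rpos) (f t * ((s + t) / (eps R n ^+ 2 + (s + t) ^+ 2))) @[n --> \oo] -->
  \int[mu]_(t in Rpos) ((s + t)^-1 * f t).
Proof.
move=> Hf s0; have st t : 0 < t -> 0 < s + t by move=> t0; rewrite addr_gt0.
have D n t : 0 < t -> 0 < eps R n ^+ 2 + (s + t) ^+ 2.
  by move=> t0; rewrite ltr_pwDl ?sqr_ge0// exprn_gt0// eps_gt0.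
have := @Rint_dct _ Rpos (fun n t => f t * ((s + t) / (eps R n ^+ 2 + (s + t) ^+ 2)))
  (fun t => (s + t)^-1 * f t) (fun t => (s + t)^-1 * `|f t|) (@measurable_Rpos R).
case=> //.
- move=> n; apply: measurable_funM; first exact: Hf.1.
  apply: measurable_funM; first exact: measurable_funD.
  apply: measurableT_comp; first exact: measurable_inv.
  by apply: measurable_funD => //; apply: measurable_funX; exact: measurable_funD.
- by apply: measurable_funM; [exact: (sqint_resolvent s0).1|exact: Hf.1].
- apply/aeW => t; rewrite in_Rpos => t0; rewrite mulrC; apply: cvgMr.
  rewrite (_ : (s + t)^-1 = (s + t) / (0 ^+ 2 + (s + t) ^+ 2)); last first.
    by rewrite expr0n /= add0r; field; rewrite gt_eqF// st.
  apply: cvgMr; apply: cvgV; first by rewrite expr0n /= add0r sqrf_eq0 gt_eqF// st.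
  apply: cvgD; last exact: cvg_cst.
  by apply: (@cvg_comp _ _ _ (@eps R) (fun y => y ^+ 2)); [exact: eps_cvg|exact: exprn_continuous].
- exact: sqint_mul (sqint_resolvent s0) (sqint_norm Hf).
- move=> n t; rewrite in_Rpos => t0; have /andP[q0 q1] := stieltjes_reg_bound (eps R n) (st t t0).
  by rewrite normrM (ger0_norm q0) mulrC ler_wpM2r.
Qed.

Lemma measurable_abel_kernel e : measurable_fun setT (fun z : R * R =>
  e / (e ^+ 2 + (z.1 - z.2) ^+ 2) + (z.1 + z.2) / (e ^+ 2 + (z.1 + z.2) ^+ 2)).
Proof.
apply: measurable_funD; apply: measurable_funM => //.
- apply: measurableT_comp; first exact: measurable_inv.
  by apply: measurable_funD => //; apply: measurable_funX; exact: measurable_funB.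
- exact: measurable_funD.
- apply: measurableT_comp; first exact: measurable_inv.
  by apply: measurable_funD => //; apply: measurable_funX; exact: measurable_funD.
Qed.

(** On the right of the Abel identity [f s * Phi n s] is dominated by a multiple of |f|. On the
    left, convergence bounds the damped integrals, so Fatou's lemma first yields
    square-integrability of [hart f]; its square then dominates the damped integrands. *)
Lemma hart_norm f : lipc f ->
  sqint (hart f) /\ ip (hart f) (hart f) = pi * ip f f + ip (lap f) (lap f).
Proof.
move=> [a [b [B [C [a0 Hf fC]]]]]; have [mf fB f0] := Hf.
have Sf := bsupp_sqint Hf; have jf : intg Rpos f by exact: bsupp_intg Hf.
have nf := @integrable_norm _ _ _ mu _ _ jf.
(* [bsupp a b] allows b < a, so the maximum keeps [a', b'] nondegenerate. *)
pose a' := a / 2; pose b' := Num.max a b + 1.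
have a'0 : 0 < a' by rewrite divr_gt0.
have a'a : a' < a by rewrite /a'; lra.
have bb' : b < b' by rewrite /b' ltr_pwDr// le_max lexx orbT.
have ab' : a' < b' by apply: (lt_trans a'a); rewrite /b' ltr_pwDr// le_max lexx.
pose K n s t := eps R n / (eps R n ^+ 2 + (s - t) ^+ 2) + (s + t) / (eps R n ^+ 2 + (s + t) ^+ 2).
pose Phi n s := \int[mu]_(t in Rpos) (f t * K n s t).
have iP n s : intg Rpos (fun t => f t * (eps R n / (eps R n ^+ 2 + (s - t) ^+ 2))).
  have : intg Rpos (fun t => (eps R n / (eps R n ^+ 2 + (s - t) ^+ 2)) * f t).
    apply: (@intgM _ _ _ _ (eps R n)^-1) => //.
      apply: measurable_funM => //; apply: measurableT_comp; first exact: measurable_inv.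
      by apply: measurable_funD => //; apply: measurable_funX; exact: measurable_funB.
    move=> t _; rewrite ger0_norm ?poisson_nonneg ?eps_gt0//.
    have e0 := eps_gt0 R n; rewrite ler_pdivrMr; last by rewrite ltr_pwDl ?sqr_ge0// exprn_gt0.
    by rewrite mulrDr expr2 mulKf ?gt_eqF// lerDl mulr_ge0 ?sqr_ge0// invr_ge0 ltW.
  by apply: intg_eq => // t _; rewrite mulrC.
have iS s : 0 < s -> intg Rpos (fun t => (s + t)^-1 * `|f t|).
  by move=> s0; exact: sqint_mul (sqint_resolvent s0) (sqint_norm Sf).
have mQ n s : measurable_fun Rpos (fun t => f t * ((s + t) / (eps R n ^+ 2 + (s + t) ^+ 2))).
  apply: measurable_funM; first exact: Sf.1.
  apply: measurable_funM; first exact: measurable_funD.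
  apply: measurableT_comp; first exact: measurable_inv.
  by apply: measurable_funD => //; apply: measurable_funX; exact: measurable_funD.
have Qle n s t : 0 < s -> 0 < t ->
    `|f t * ((s + t) / (eps R n ^+ 2 + (s + t) ^+ 2))| <= (s + t)^-1 * `|f t|.
  move=> s0 t0; have /andP[q0 q1] := stieltjes_reg_bound (eps R n) (addr_gt0 s0 t0).
  by rewrite normrM (ger0_norm q0) mulrC ler_wpM2r.
have iQ n s : 0 < s -> intg Rpos (fun t => f t * ((s + t) / (eps R n ^+ 2 + (s + t) ^+ 2))).
  by move=> s0; apply: intg_le (iS s s0) => // t; rewrite in_Rpos; exact: Qle.
have PhiE n s : 0 < s -> Phi n s =
  \int[mu]_(t in `[a', b']) (f t * (eps R n / (eps R n ^+ 2 + (s - t) ^+ 2))) +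
  \int[mu]_(t in Rpos) (f t * ((s + t) / (eps R n ^+ 2 + (s + t) ^+ 2))).
  move=> s0; rewrite -(bsupp_Rint _ a'0 (ltW a'a) (ltW bb') Hf) -RintegralD//; last exact: iQ.
  by apply: Rint_eq => t _; rewrite -mulrDr.
(* Two arctangents below pi/2 give [B * pi]; for s >= a the kernel 1/(s+t) is at most 1/a. *)
pose D := B * pi + a^-1 * \int[mu]_(t in Rpos) `|f t|.
have B0 : 0 <= B by exact: le_trans (fB 0).
have PhiB n s : a <= s -> `|Phi n s| <= D.
  move=> as_; have s0 := lt_le_trans a0 as_.
  rewrite PhiE//; apply: (le_trans (ler_normD _ _)); apply: lerD.
    have cP : continuous (fun t => eps R n / (eps R n ^+ 2 + (s - t) ^+ 2)).
      apply: der_cont => t; eexists; repeat der_step.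
      by rewrite gt_eqF// ltr_pwDl ?sqr_ge0// exprn_gt0// eps_gt0.
    apply: (@le_trans _ _ (\int[mu]_(t in `[a', b']) (B * (eps R n / (eps R n ^+ 2 + (s - t) ^+ 2))))).
      apply: normr_Rint_le => //.
      - apply: (@intgM _ _ _ _ B) => //; last exact: cont_intg.
        exact: measurable_funTS.
      - by apply: intgZl => //; exact: cont_intg.
      - move=> t _; rewrite normrM (ger0_norm (poisson_nonneg _ _ (eps_gt0 R n))) ler_wpM2r//.
        exact: poisson_nonneg (eps_gt0 R n).
    rewrite RintegralZl//; last exact: cont_intg.
    rewrite ler_wpM2l// poisson_integral// ?eps_gt0//.
    by have := atan_ltpi2 ((b' - s) / eps R n); have := atan_ltpi2 ((s - a') / eps R n); lra.
  rewrite -RintegralZl//; apply: normr_Rint_le => //; [exact: iQ|exact: intgZl|].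
  move=> t; rewrite in_Rpos => t0; apply: le_trans (Qle n s t s0 t0) _.
  rewrite ler_wpM2r// lef_pV2 ?posrE ?addr_gt0//.
  by rewrite (le_trans as_)// lerDl ltW.
pose S s := \int[mu]_(t in Rpos) ((s + t)^-1 * f t).
have SE s : 0 < s -> S s = lap (lap f) s by move=> s0; rewrite lap_lap.
have SLL := lap_sqint (lap_sqint Sf).
have [|||||_ cR] := @Rint_dct _ Rpos (fun n s => f s * Phi n s)
  (fun s => f s * (pi * f s + lap (lap f) s)) (fun s => `|f s| * D) (@measurable_Rpos R).
- move=> n; apply: measurable_funM; first exact: Sf.1.
  apply: measurable_funTS; rewrite (_ : Phi n = fun s => \int[mu]_(t in Rpos) (K n s t * f t)).
    by apply: measurable_Rint => //; [exact: measurable_abel_kernel|exact: Sf.1].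
  by apply/funext => s; apply: Rint_eq => t _; rewrite mulrC.
- apply: measurable_funM; first exact: Sf.1.
  by apply: measurable_funD; [apply: measurable_funM => //; exact: Sf.1|exact: SLL.1].
- apply/aeW => s; rewrite in_Rpos => s0.
  have [H|H] := boolP (a <= s <= b); last first.
    by rewrite (f0 _ H) mul0r; under eq_fun do rewrite mul0r; exact: cvg_cst.
  have /andP[as_ sb] := H; apply: cvgMr; rewrite -SE//.
  under eq_fun do rewrite PhiE//.
  apply: cvgD; last exact: stieltjes_cvg.
  apply: poisson_cvg fB fC _.
  by rewrite (lt_le_trans a'a as_) (le_lt_trans sb bb').
- exact: (@intgZr _ _ _ (fun x => `|f x|)).
- move=> n s; rewrite in_Rpos => s0; rewrite normrM.
  have [H|H] := boolP (a <= s <= b); last by rewrite (f0 _ H) normr0 !mul0r.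
  by have /andP[as_ sb] := H; rewrite ler_wpM2l// PhiB.
have cL : \int[mu]_(x in Rpos) (expR (- (eps R n * x)) * hart f x ^+ 2) @[n --> \oo] -->
    \int[mu]_(s in Rpos) (f s * (pi * f s + lap (lap f) s)).
  under eq_fun => n do rewrite (hart_abel jf (eps_gt0 R n)).2.
  exact: cR.
have iA n := (hart_abel jf (eps_gt0 R n)).1.
have [M HM] : exists M, forall n, \int[mu]_(x in Rpos) (expR (- (eps R n * x)) * hart f x ^+ 2) <= M.
  have /cvgP/cvg_seq_bounded/bounded_fun_has_ubound[M HM] := cL.
  by exists M => n; apply: HM; exists n.
have mh : measurable_fun Rpos (fun x => hart f x ^+ 2).
  by apply: measurable_funX; exact: measurable_hart Sf.1.
have cE : {ae mu, forall x, Rpos x -> (expR (- (eps R n * x)) * hart f x ^+ 2) @[n --> \oo] --> hart f x ^+ 2}.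
  apply/aeW => x _; rewrite -[X in _ --> X]mul1r; apply: cvgMl.
  rewrite -expR0 -oppr0 -(mul0r x); apply: continuous_cvg; first exact: continuous_expR.
  by apply: cvgN; apply: cvgMl; exact: eps_cvg.
have [|ih _] := Rint_fatou (@measurable_Rpos R) iA mh _ cE HM.
  by move=> n x _; rewrite mulr_ge0 ?sqr_ge0// expR_ge0.
have Sh : sqint (hart f) by split => //; exact: measurable_hart Sf.1.
split => //.
have [||_ cH] := @Rint_dct _ Rpos (fun n x => expR (- (eps R n * x)) * hart f x ^+ 2)
  (fun x => hart f x ^+ 2) (fun x => hart f x ^+ 2) (@measurable_Rpos R) _ mh cE ih.
- by move=> n; exact: intg_meas (iA n).
- move=> n x; rewrite in_Rpos => x0; rewrite ger0_norm; last by rewrite mulr_ge0 ?sqr_ge0// expR_ge0.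
  rewrite ler_piMl ?sqr_ge0// -expR0 ler_expR oppr_le0 mulr_ge0// ltW//.
  exact: eps_gt0.
transitivity (\int[mu]_(x in Rpos) hart f x ^+ 2); first by apply: Rint_eq => x _; rewrite expr2.
rewrite (cvg_unique _ cH cL)// lap_sym//; last exact: lap_sqint.
by rewrite -ipZr// -ipDr//; exact: sqintZ.
Qed.

End HartleyNorm.

(** * The extension to square-integrable functions *)

Section Operator.
Variable R : realType.
Local Notation mu := (@lebesgue_measure R).
Local Notation intg D f := (mu.-integrable D (EFin \o f)).
Implicit Types (f g : R -> R) (x s t a b B C e : R).

Definition c0 : R := Num.sqrt (2 / pi).

Lemma c0_gt0 : 0 < c0. Proof. by rewrite sqrtr_gt0 divr_gt0// pi_gt0. Qed.

Lemma c0_sqr : c0 ^+ 2 = 2 / pi.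
Proof. by rewrite sqr_sqrtr// divr_ge0// pi_ge0. Qed.

Lemma sub_itv_Rpos (x : R) : `]0, x]%classic `<=` Rpos.
Proof. by move=> t; rewrite in_Rpos /= in_itv /= => /andP[]. Qed.

(** The kernel of the derivative formula, equal to the integral of cas(y t) over y in ]0, x].
    Integration gains the decay 1/t that makes it square-integrable in [t]. *)
Definition dk x t := (1 + sin (x * t) - cos (x * t)) / t.

Lemma cas_primitive x t : 0 < x -> 0 < t ->
  \int[mu]_(y in `]0, x]) cas (y * t) = dk x t.
Proof.
move=> x0 t0; have tn0 : t != 0 by rewrite gt_eqF.
have cc : continuous (fun y : R => cas (y * t)) by rewrite /cas; der_continuous.
rewrite Rintegral_itv_obnd_cbnd; last first.
  by apply: intgS (cont_intg 0 x cc) => // y /=; rewrite !in_itv /= => /andP[/ltW -> ->].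
transitivity (dk x t - (1 + sin (0 * t) - cos (0 * t)) / t); last first.
  by rewrite mul0r sin0 cos0 addr0 subrr mul0r subr0.
apply: (@FTC2 _ _ (fun y => dk y t)) => // y.
by rewrite /dk /cas; der; field.
Qed.

(** The sum of two bounds: |dk| <= 2 x from the integral form, sharp enough near 0, and t |dk| <= 3
    from the closed form, for large [t]. *)
Lemma dk_bound x t : 0 < x -> 0 < t -> `|dk x t| <= (2 * x + 3) * (1 + t)^-1.
Proof.
move=> x0 t0; have t1 : 0 < 1 + t by rewrite addr_gt0.
have B1 : `|dk x t| <= 2 * x.
  rewrite -cas_primitive//; apply: (@le_trans _ _ (\int[mu]_(y in `]0, x]) 2)).
    apply: normr_Rint_le => //.
    - apply: (@intg_bnd _ _ _ 2) => //; [exact: mu_itv_fin| |by move=> y _; exact: cas_bound].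
      by apply: cont_meas; rewrite /cas; der_continuous.
    - by apply: intg_cst => //; exact: mu_itv_fin.
    - by move=> y _; exact: cas_bound.
  have -> : \int[mu]_(y in `]0, x]) 2 = 2 * fine (mu `]0, x]) by exact: Rintegral_cst.
  by rewrite lebesgue_measure_itv /= lte_fin x0 -EFinD /= subr0.
have B2 : t * `|dk x t| <= 3.
  rewrite /dk normrM (ger0_norm (x := t^-1)); last by rewrite invr_ge0 ltW.
  rewrite mulrCA divff ?gt_eqF// mulr1.
  have := trig_bound (-1) 1 (x * t); rewrite mulN1r mul1r normrN normr1 => H.
  rewrite -addrA (addrC (sin _)) (le_trans (ler_normD _ _))// normr1.
  by move: H; lra.
by rewrite ler_pdivlMr// mulrC mulrDl mul1r; exact: lerD.
Qed.

Lemma dk_sqint x : 0 < x -> sqint (dk x).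
Proof.
move=> x0; apply: (sqint_le _ _ (sqintZ (2 * x + 3) (sqint_resolvent ltr01))).
  rewrite /dk; apply: measurable_funM; first by apply: cont_meas; der_continuous.
  by apply: measurable_funTS; exact: measurable_inv.
by move=> t t0; exact: dk_bound.
Qed.

Lemma sqint_indic (x : R) : sqint (\1_(`]0, x]) : R -> R).
Proof.
split; first by apply: measurable_funTS; exact: measurable_indic.
have : intg setT (\1_(`]0, x]) : R -> R) by exact: integrable_indic_itv.
move/(intgS (@measurable_Rpos R) measurableT (@subsetT _ _)).
by apply: intg_eq => // t _; rewrite /= -[LHS]mulr1 expr2 indicE; case: (_ \in _); rewrite ?mulr1 ?mulr0.
Qed.

Lemma Rint_ip_indic f x : \int[mu]_(t in `]0, x]) f t = ip (\1_(`]0, x])) f.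
Proof.
rewrite /ip Rintegral_mkcond [RHS]Rintegral_mkcond; apply: eq_Rintegral => t _.
rewrite !patchE indicE; case: ifPn => [tx|_]; last by rewrite mul0r if_same.
by rewrite mul1r ifT//; move: tx; rewrite !inE => /sub_itv_Rpos.
Qed.

Lemma sqint_intg_itv f x : sqint f -> intg `]0, x] f.
Proof.
move=> Hf; have := sqint_mul (sqint_indic x) Hf.
move/(intgS (measurable_itv `]0, x]) (@measurable_Rpos R) (@sub_itv_Rpos x)).
by apply: intg_eq => // t tx; rewrite indicE mem_set// mul1r.
Qed.

(* The extension is characterised by its primitives, which makes it stable under
   limits in L_2. *)
Definition isH f g := sqint g /\
  forall x, 0 < x -> \int[mu]_(t in `]0, x]) g t = c0 * ip (dk x) f.

Lemma isH_unique f g g' : isH f g -> isH f g' -> {ae mu, forall x, Rpos x -> g x = g' x}.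
Proof.
move=> [S1 E1] [S2 E2]; apply: ae_eq_primitive.
- exact: S1.1.
- exact: S2.1.
- by move=> x _; exact: sqint_intg_itv.
- by move=> x _; exact: sqint_intg_itv.
- by move=> x x0; rewrite E1// E2.
Qed.

Lemma hart_primitive f x : intg Rpos f -> 0 < x ->
  intg `]0, x] (hart f) /\ \int[mu]_(y in `]0, x]) hart f y = ip (dk x) f.
Proof.
move=> jf x0; have mx := measurable_itv `]0, x].
have jc : intg `]0, x] (fun=> 1) by apply: intg_cst => //; exact: mu_itv_fin.
have [H1 _ H3] := @Fubini_bounded _ _ _ (fun y t => cas (y * t)) (fun=> 1) f 2 mx (@measurable_Rpos R)
  (@measurable_cas_kernel R) jc jf (fun _ _ _ _ => cas_bound _).
split; first by apply: intg_eq H1 => // y _; rewrite mul1r.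
rewrite (Rint_eq (g := fun y => 1 * hart f y)) ?[LHS]H3; last by move=> y _; rewrite mul1r.
apply: Rint_eq => t; rewrite in_Rpos => t0; rewrite mulrC -cas_primitive//; congr (_ * _).
by apply: Rint_eq => y _; rewrite mulr1.
Qed.

(** On integrable functions the abstract extension is the integral itself. This serves [C2c],
    truncated functions and the Fresnel tail alike. *)
Lemma isH_hart f g : sqint f -> intg Rpos f -> isH f g ->
  {ae mu, forall x, Rpos x -> g x = c0 * hart f x}.
Proof.
move=> Hf jf [Sg Eg]; apply: ae_eq_primitive.
- exact: Sg.1.
- by apply: measurable_funM => //; exact: measurable_hart Hf.1.
- by move=> x _; exact: sqint_intg_itv.
- by move=> x x0; apply: intgZl => //; exact: (hart_primitive jf x0).1.
- move=> x x0; rewrite Eg// RintegralZl//; last exact: (hart_primitive jf x0).1.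
  by rewrite (hart_primitive jf x0).2.
Qed.

Lemma hart_isH f : lipc f -> isH f (c0 *: hart f).
Proof.
move=> Lf; have [Sh _] := hart_norm Lf; split; first exact: sqintZ.
move=> x x0; have [H1 H2] := hart_primitive (lipc_intg Lf) x0.
by rewrite -H2 -RintegralZl.
Qed.

Lemma hartB f g x : lipc f -> lipc g -> hart (f - g) x = hart f x - hart g x.
Proof.
move=> Lf Lg; rewrite /hart -RintegralB//; [|exact: hart_intg (lipc_intg _)..].
by apply: Rint_eq => t _; rewrite -mulrBr.
Qed.

Lemma nrm_sqrt_le f g a : 0 <= a -> ip f f <= a ^+ 2 * ip g g -> nrm f <= a * nrm g.
Proof.
move=> a0 H; rewrite -(ler_pXn2r (n := 2)) ?nnegrE ?nrm_ge0 ?mulr_ge0 ?nrm_ge0//.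
by rewrite exprMn !nrm2.
Qed.

Lemma lap_nrm f : sqint f -> nrm (lap f) <= Num.sqrt pi * nrm f.
Proof.
move=> Hf; apply: nrm_sqrt_le; first exact: sqrtr_ge0.
by rewrite sqr_sqrtr ?pi_ge0// lap_bound.
Qed.

Lemma c0hart_nrm f : lipc f -> nrm (c0 *: hart f) <= 2 * nrm f.
Proof.
move=> Lf; have [Sh E] := hart_norm Lf; have Sf := lipc_sqint Lf.
apply: nrm_sqrt_le => //; rewrite ipZl ?ipZr//; last exact: sqintZ.
rewrite mulrA -expr2 c0_sqr E.
have := lap_bound Sf; have pp := pi_gt0 R => H.
rewrite mulrAC ler_pdivrMr//.
have -> : 2 ^+ 2 * ip f f * pi = 2 * (pi * ip f f + pi * ip f f) by ring.
by rewrite ler_pM2l// lerD2l.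
Qed.

Lemma ip_cvg (u : nat -> R -> R) v w : (forall n, sqint (u n)) -> sqint v -> sqint w ->
  nrm (u n - v) @[n --> \oo] --> (0 : R) -> ip w (u n) @[n --> \oo] --> ip w v.
Proof.
move=> Su Sv Sw uv; apply/subr_cvg0; apply: (@squeeze_cvgr _ _ _ _ (fun n => - (nrm w * nrm (u n - v))) (fun n => nrm w * nrm (u n - v))).
- apply: nearW => n; rewrite -ler_norml -ipBr//.
  by apply: cauchy_schwarz => //; exact: sqintB.
- by rewrite -oppr0 -(mulr0 (nrm w)); apply: cvgN; apply: cvgMr.
- by rewrite -(mulr0 (nrm w)); apply: cvgMr.
Qed.

Lemma nrm_cvg (u : nat -> R -> R) v : (forall n, sqint (u n)) -> sqint v ->
  nrm (u n - v) @[n --> \oo] --> (0 : R) -> nrm (u n) @[n --> \oo] --> nrm v.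
Proof.
move=> Su Sv /cvgrPdist_le uv; apply/cvgrPdist_le => e e0; have H := uv _ e0.
apply: filterS H => n; rewrite sub0r normrN (ger0_norm (nrm_ge0 _)).
by rewrite nrmB//; apply: le_trans; exact: nrm_dist.
Qed.

Lemma nrm_intg_cvg (u : nat -> R -> R) v x : (forall n, sqint (u n)) -> sqint v ->
  nrm (u n - v) @[n --> \oo] --> (0 : R) ->
  \int[mu]_(t in `]0, x]) u n t @[n --> \oo] --> \int[mu]_(t in `]0, x]) v t.
Proof.
move=> Su Sv uv; rewrite Rint_ip_indic.
under eq_fun do rewrite Rint_ip_indic.
exact: ip_cvg (sqint_indic x) uv.
Qed.

(** The rate 2^-(n+3) absorbs the operator bound 2 and two triangle terms, so that the transforms
    meet the increment bound 2^-n of [L2_complete]. *)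
Lemma lipc_approx f : sqint f -> exists u : nat -> R -> R,
  [/\ forall n, lipc (u n), forall n, nrm (f - u n) < 2^-1 ^+ n.+3 &
      nrm (u n - f) @[n --> \oo] --> (0 : R)].
Proof.
move=> Sf; have /choice[u uP] : forall n, exists g, lipc g /\ nrm (f - g) < 2^-1 ^+ n.+3.
  move=> n; have e0 : 0 < (2^-1 : R) ^+ n.+3 by rewrite exprn_gt0// invr_gt0.
  by have [g [Lg _ H]] := lipc_dense Sf e0; exists g.
exists u; split=> [n|n|]; [exact: (uP n).1|exact: (uP n).2|].
apply: (@squeeze_cvgr _ _ _ _ (fun=> 0) (fun n => 2^-1 ^+ 3 * 2^-1 ^+ n)).
- apply: nearW => n; rewrite nrm_ge0 /=; have [L H] := uP n.
  by rewrite nrmB//; [rewrite -exprD; exact: ltW|exact: lipc_sqint].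
- exact: cvg_cst.
- rewrite -(mulr0 (2^-1 ^+ 3)); apply: cvgMr; apply: cvg_expr.
  by rewrite ger0_norm ?invr_ge0// invf_lt1// ltr1n.
Qed.

Lemma ip_self_cvg (v : nat -> R -> R) w : (forall n, sqint (v n)) -> sqint w ->
  nrm (v n - w) @[n --> \oo] --> (0 : R) -> ip (v n) (v n) @[n --> \oo] --> ip w w.
Proof.
move=> Sv Sw vw; rewrite -nrm2 expr2; under eq_fun do rewrite -nrm2 expr2.
by apply: cvgM; exact: nrm_cvg vw.
Qed.

(** Primitives, norms and the Laplace term are continuous in L_2, so the limit of the transforms of
    nice approximants inherits both the characterization and the norm identity. *)
Lemma isH_exists f : sqint f -> exists g, isH f g /\ 
  ip g g = 2 * ip f f + 2 / pi * ip (lap f) (lap f).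
Proof.
move=> Sf; have [u [Lu du uf]] := lipc_approx Sf; pose g n := c0 *: hart (u n).
have Su n := lipc_sqint (Lu n).
have Sg n : sqint (g n) by exact: (hart_isH (Lu n)).1.
have dg n : nrm (g n.+1 - g n) <= 2^-1 ^+ n.
  have -> : g n.+1 - g n = c0 *: hart (u n.+1 - u n).
    by apply/funext => x; rewrite /g !fctE hartB// -mulrBr.
  apply: (le_trans (c0hart_nrm (lipcB (Lu _) (Lu _)))).
  have -> : u n.+1 - u n = (f - u n) - (f - u n.+1).
    by apply/funext => x; rewrite !fctE; ring.
  have A := nrmD (sqintB Sf (Su n)) (sqintN (sqintB Sf (Su n.+1))).
  rewrite nrmN in A; last exact: sqintB.
  have B1 := du n; have B2 := du n.+1.
  have E0 : 0 < (2^-1 : R) ^+ n by apply: exprn_gt0; lra.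
  move: B1 B2; rewrite !exprS => B1 B2.
  lra.
have [h Sh gh] := L2_complete Sg dg.
have hg : nrm (g n - h) @[n --> \oo] --> (0 : R) by exact: gh.
exists h; split; first split => //.
  move=> x x0; have A := @nrm_intg_cvg _ _ x Sg Sh hg.
  have B : \int[mu]_(t in `]0, x]) g n t @[n --> \oo] --> c0 * ip (dk x) f.
    under eq_fun do rewrite (hart_isH (Lu _)).2//.
    by apply: cvgMr; exact: ip_cvg (dk_sqint x0) uf.
  exact: (cvg_unique (@Rhausdorff R) A B).
have Lf := lap_sqint Sf.
have lapuf : nrm (lap (u n) - lap f) @[n --> \oo] --> (0 : R).
  apply: (@squeeze_cvgr _ _ _ _ (fun=> 0) (fun n => Num.sqrt pi * nrm (u n - f))).
  - apply: nearW => n; rewrite nrm_ge0 /=.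
    have -> : nrm (lap (u n) - lap f) = nrm (lap (u n - f)).
      congr Num.sqrt; apply: Rint_eq => p; rewrite in_Rpos => p0; rewrite !fctE.
      have -> // : lap (u n - f) p = lap (u n) p - lap f p.
      by rewrite -scaleN1r lapD ?lapZ ?mulN1r//; exact: sqintZ.
    by apply: lap_nrm; exact: sqintB.
  - exact: cvg_cst.
  - by rewrite -(mulr0 (Num.sqrt pi)); apply: cvgMr; exact: uf.
have A := ip_self_cvg Sg Sh hg.
have B : ip (g n) (g n) @[n --> \oo] --> 2 * ip f f + 2 / pi * ip (lap f) (lap f).
  have -> : (fun n => ip (g n) (g n)) =
      (fun n => 2 * ip (u n) (u n) + 2 / pi * ip (lap (u n)) (lap (u n))).
    apply/funext => n; rewrite /g; have [S1 E1] := hart_norm (Lu n).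
    rewrite (ipZl _ S1 (sqintZ _ S1)) (ipZr _ S1 S1).
    by rewrite mulrA -expr2 c0_sqr E1 mulrDr mulrA divfK// lt0r_neq0// pi_gt0.
  apply: cvgD; apply: cvgMr; first exact: ip_self_cvg Su Sf uf.
  by apply: ip_self_cvg Lf lapuf => n; exact: lap_sqint.
exact: (cvg_unique (@Rhausdorff R) A B).
Qed.

End Operator.

(** * The real transform on L_2: linearity, polarization and symmetry *)

Section OpH.
Variable R : realType.
Local Notation mu := (@lebesgue_measure R).
Local Notation intg D f := (mu.-integrable D (EFin \o f)).
Implicit Types (f g h : R -> R) (x s t a b B C e : R).

Definition aeq f g := {ae mu, forall x, Rpos x -> f x = g x}.

Lemma aeq_refl f : aeq f f. Proof. by apply/aeW. Qed.

Lemma aeq_sym f g : aeq f g -> aeq g f.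
Proof. by apply: aeS => x H Rx; rewrite H. Qed.

Lemma aeq_trans g f h : aeq f g -> aeq g h -> aeq f h.
Proof. by apply: aeS2 => x H1 H2 Rx; rewrite H1// H2. Qed.

Lemma aeq_lin a f f' g g' : aeq f f' -> aeq g g' -> aeq (a *: f + g) (a *: f' + g').
Proof. by apply: aeS2 => x H1 H2 Rx; rewrite !fctE H1// H2. Qed.

Lemma aeq_on f g : (forall x, 0 < x -> f x = g x) -> aeq f g.
Proof. by move=> H; apply/aeW => x; rewrite in_Rpos; exact: H. Qed.

Lemma aeq_ipl f f' g : sqint f -> sqint f' -> sqint g -> aeq f f' -> ip f g = ip f' g.
Proof. by move=> Sf Sf' Sg E; apply: eq_ip => //; exact: aeq_refl. Qed.

Lemma aeq_nrm f f' : sqint f -> sqint f' -> aeq f f' -> nrm f = nrm f'.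
Proof. by move=> Sf Sf' E; rewrite /nrm (eq_ip E E). Qed.

Lemma sqint_lin a f g : sqint f -> sqint g -> sqint (a *: f + g).
Proof. by move=> Sf Sg; apply: sqintD => //; exact: sqintZ. Qed.

Lemma ip_lin a f g h : sqint f -> sqint g -> sqint h -> ip (a *: f + g) h = a * ip f h + ip g h.
Proof. by move=> *; rewrite ipDl ?ipZl//; exact: sqintZ. Qed.

Lemma weak_aeq f g : sqint f -> sqint g -> (forall h, sqint h -> ip f h = ip g h) -> aeq f g.
Proof.
move=> Sf Sg H; have Sd := sqintB Sf Sg.
have /(nrm0_ae Sd) : nrm (f - g) = 0.
  by rewrite /nrm {1}/GRing.add /= ipBl// H// subrr sqrtr0.
by apply: aeS => x E Rx; apply/eqP; rewrite -subr_eq0; apply/eqP; exact: E.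
Qed.

Lemma isH_aeq f f' g : sqint f -> sqint f' -> aeq f f' -> isH f g -> isH f' g.
Proof.
move=> Sf Sf' E [Sg H]; split=> // x x0.
by rewrite H// !(ipC (dk x)) (aeq_ipl _ _ _ E)//; exact: dk_sqint.
Qed.

Lemma isH_lin a f f' g g' : sqint f -> sqint f' -> isH f g -> isH f' g' ->
  isH (a *: f + f') (a *: g + g').
Proof.
move=> Sf Sf' [Sg H] [Sg' H']; split; first exact: sqint_lin.
move=> x x0; have Sx := dk_sqint x0; have Si := sqint_indic x.
rewrite Rint_ip_indic ipC ip_lin// ![ip _ (\1_ _)]ipC -!Rint_ip_indic H// H'//.
by rewrite [in RHS]ipC ip_lin// ![ip _ (dk x)]ipC; ring.
Qed.

(** The hypothesis sits under the existential so that choice yields an operator on all functions,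
    with an arbitrary value off L_2. *)
Lemma isH_total f : exists g, sqint f -> isH f g /\
  ip g g = 2 * ip f f + 2 / pi * ip (lap f) (lap f).
Proof.
have [/isH_exists[g Hg]|nf] := pselect (sqint f); first by exists g.
by exists 0 => /nf.
Qed.

(** Representatives are chosen separately for each [f], so linearity and the other operator
    identities hold up to [aeq]. *)
Definition opH f := sval (cid (isH_total f)).

Lemma opH_isH f : sqint f -> isH f (opH f).
Proof. by move=> Sf; rewrite /opH; case: cid => g /= /(_ Sf)[]. Qed.

Lemma opH_sqint f : sqint f -> sqint (opH f).
Proof. by move=> /opH_isH[]. Qed.

Lemma opH_sqr f : sqint f -> ip (opH f) (opH f) = 2 * ip f f + 2 / pi * ip (lap f) (lap f).
Proof. by move=> Sf; rewrite /opH; case: cid => g /= /(_ Sf)[]. Qed.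

Lemma opH_lin a f g : sqint f -> sqint g -> aeq (opH (a *: f + g)) (a *: opH f + opH g).
Proof.
move=> Sf Sg; apply: (@isH_unique _ (a *: f + g)); first exact: opH_isH (sqint_lin a Sf Sg).
by apply: isH_lin => //; exact: opH_isH.
Qed.

Lemma opH_aeq f g : sqint f -> sqint g -> aeq f g -> aeq (opH f) (opH g).
Proof.
move=> Sf Sg E; apply: (@isH_unique _ g); last exact: opH_isH.
exact: isH_aeq E (opH_isH Sf).
Qed.

Lemma opH_hart f : sqint f -> intg Rpos f -> aeq (opH f) (c0 R *: hart f).
Proof. by move=> Sf jf; exact: isH_hart (opH_isH Sf). Qed.

Lemma opH_nrm f : sqint f -> nrm (opH f) <= 2 * nrm f.
Proof.
move=> Sf; apply: nrm_sqrt_le => //; rewrite opH_sqr//.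
have pp := pi_gt0 R; have := lap_bound Sf; rewrite -ler_pdivrMl// => H.
by rewrite -mulrA; move: H; lra.
Qed.

Lemma opH_nrm_ge f : sqint f -> Num.sqrt 2 * nrm f <= nrm (opH f).
Proof.
move=> Sf; rewrite -(ler_pXn2r (n := 2)) ?nnegrE ?nrm_ge0 ?mulr_ge0 ?sqrtr_ge0 ?nrm_ge0//.
rewrite exprMn !nrm2 sqr_sqrtr// opH_sqr// lerDl mulr_ge0 ?ip_ge0//.
by rewrite divr_ge0// pi_ge0.
Qed.

Lemma lap_lin a f g : sqint f -> sqint g -> aeq (lap (a *: f + g)) (a *: lap f + lap g).
Proof.
move=> Sf Sg; apply: aeq_on => x x0; rewrite lapD ?lapZ//; exact: sqintZ.
Qed.

Lemma ip_lin2 f g : sqint f -> sqint g ->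
  ip (1 *: f + g) (1 *: f + g) = ip f f + 2 * ip f g + ip g g.
Proof.
move=> Sf Sg; have S := sqint_lin 1 Sf Sg.
by rewrite ip_lin// ![ip _ (1 *: f + g)]ipC !ip_lin// (ipC g f); ring.
Qed.

Let polarize (X a b c k l m n : R) :
  (2 * a + k * l) + 2 * X + (2 * c + k * n) = 2 * (a + 2 * b + c) + k * (l + 2 * m + n) ->
  X = 2 * b + k * m.
Proof. by lra. Qed.

Lemma opH_polar f g : sqint f -> sqint g ->
  ip (opH f) (opH g) = 2 * ip f g + 2 / pi * ip (lap f) (lap g).
Proof.
move=> Sf Sg; have S := sqint_lin 1 Sf Sg.
have SH h : sqint h -> sqint (opH h) := @opH_sqint h.
have SL h : sqint h -> sqint (lap h) := @lap_sqint R h.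
have := opH_sqr S; have E1 := opH_lin 1 Sf Sg; have E2 := lap_lin 1 Sf Sg.
rewrite (eq_ip E1 E1) ?(eq_ip E2 E2) ?ip_lin2//; try by [apply: SL|apply: SH|apply: sqint_lin; auto]; auto.
rewrite (opH_sqr Sf) (opH_sqr Sg); exact: polarize.
Qed.

Lemma opHB f g : sqint f -> sqint g -> aeq (opH f) (opH g + opH (f - g)).
Proof.
move=> Sf Sg; have := opH_lin (-1) Sg Sf; rewrite !scaleN1r !(addrC (- _)).
by apply: aeS => x E Rx; have := E Rx; rewrite !fctE => ->; ring.
Qed.

Lemma ip_opHB f g h : sqint f -> sqint g -> sqint h ->
  ip (opH f) h = ip (opH g) h + ip (opH (f - g)) h.
Proof.
move=> Sf Sg Sh; rewrite -ipDl//; [|exact: opH_sqint|by apply: opH_sqint; exact: sqintB].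
apply: aeq_ipl => //; [exact: opH_sqint| |exact: opHB].
by apply: sqintD; apply: opH_sqint => //; exact: sqintB.
Qed.

Lemma ip_Br f g h : sqint f -> sqint g -> sqint h -> ip h f = ip h g + ip h (f - g).
Proof. by move=> Sf Sg Sh; rewrite ipBr//; ring. Qed.

(** The kernel cas(x t) is symmetric and bounded, and both functions are integrable, so Fubini
    applies directly. *)
Lemma opH_sym_lipc f g : lipc f -> lipc g -> ip (opH f) g = ip f (opH g).
Proof.
move=> Lf Lg; have Sf := lipc_sqint Lf; have Sg := lipc_sqint Lg.
have jf := lipc_intg Lf; have jg := lipc_intg Lg.
have SHf := (hart_isH Lf).1; have SHg := (hart_isH Lg).1.
rewrite (aeq_ipl _ _ _ (opH_hart Sf jf))//; last exact: opH_sqint.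
rewrite [RHS]ipC (aeq_ipl _ _ _ (opH_hart Sg jg))//; last exact: opH_sqint.
have [Sf1 _] := hart_norm Lf; have [Sg1 _] := hart_norm Lg.
rewrite !ipZl//; congr (_ * _).
have [_ _ E] := @Fubini_bounded _ _ _ (fun x t => cas (x * t)) g f 2 (@measurable_Rpos R) (@measurable_Rpos R)
  (@measurable_cas_kernel R) jg jf (fun _ _ _ _ => cas_bound _).
rewrite ipC [LHS]E ipC; apply: Rint_eq => x _; congr (_ * _).
apply: Rint_eq => t _; rewrite (mulrC t)//.
Qed.

(** Density is used in one argument at a time; the defect of symmetry is bounded by 4 |f| |g| and
    vanishes on nice functions. *)
Lemma opH_sym f g : sqint f -> sqint g -> ip (opH f) g = ip f (opH g).
Proof.
have bnd f' g' : sqint f' -> sqint g' -> `|ip (opH f') g' - ip f' (opH g')| <= 4 * nrm g' * nrm f'.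
  move=> Sf Sg; rewrite (le_trans (ler_normB _ _))//.
  have A := cauchy_schwarz (opH_sqint Sf) Sg; have B := cauchy_schwarz Sf (opH_sqint Sg).
  have A' := ler_wpM2r (nrm_ge0 g') (opH_nrm Sf).
  have B' := ler_wpM2l (nrm_ge0 f') (opH_nrm Sg).
  by move: A B A' B'; lra.
have half f' g' : sqint f' -> lipc g' -> ip (opH f') g' - ip f' (opH g') = 0.
  move=> Sf Lg; have Sg := lipc_sqint Lg; move: f' Sf; apply: (@dense_eq0 _ _ (4 * nrm g')).
  - by rewrite mulr_ge0// nrm_ge0.
  - move=> u v Su Sv; rewrite (ip_opHB Su Sv)// !(ipC _ (opH g')) (ip_Br Su Sv (opH_sqint Sg)).
    by ring.
  - by move=> u Su; exact: bnd.
  - by move=> u Lu; rewrite opH_sym_lipc ?subrr.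
move=> Sf Sg; apply/eqP; rewrite -subr_eq0; apply/eqP.
move: g Sg; apply: (@dense_eq0 _ _ (4 * nrm f)).
- by rewrite mulr_ge0// nrm_ge0.
- move=> u v Su Sv; rewrite !(ipC f) (ip_opHB Su Sv)// (ip_Br Su Sv (opH_sqint Sf)).
  by ring.
- by move=> u Su; have := bnd _ _ Sf Su; rewrite mulrAC.
- by move=> u Lu; exact: half.
Qed.

Lemma opH_opH f : sqint f -> forall g, sqint g ->
  ip (opH (opH f)) g = 2 * ip f g + 2 / pi * ip (lap (lap f)) g.
Proof.
move=> Sf g Sg; rewrite opH_sym//; last exact: opH_sqint.
by rewrite opH_polar// -lap_sym//; exact: lap_sqint.
Qed.

End OpH.

(** * The Fresnel kernel and the inverse operator *)

Section FresnelKernel.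
Variable R : realType.
Local Notation mu := (@lebesgue_measure R).
Local Notation intg D f := (mu.-integrable D (EFin \o f)).
Implicit Types (f g h : R -> R) (x s t a b B C e q u r : R).

Definition wq q := q ^+ 2 / (1 + q ^+ 4).

(** The function m of the overview. As a superposition of exponentials in [u], its transform can be
    computed one exponential at a time. *)
Definition fresnel_tail u := \int[mu]_(q in Rpos) (expR (- (u * q ^+ 2)) * wq q).

Lemma quartic_gt0 q : 0 < 1 + q ^+ 4.
Proof. by rewrite ltr_pwDl// exprn_even_ge0. Qed.

Lemma quartic_neq0 q : 1 + q ^+ 4 != 0.
Proof. by rewrite gt_eqF// quartic_gt0. Qed.

Lemma wq_ge0 q : 0 <= wq q.
Proof. by rewrite divr_ge0 ?sqr_ge0// ltW// quartic_gt0. Qed.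

Lemma intg_wq : intg Rpos wq /\ \int[mu]_(q in Rpos) wq q = pi / (2 * Num.sqrt 2).
Proof.
have [H1 H2] := @quartic_integral R 1 0 ler01 (lexx 0).
have E q : (1 * q ^+ 2 + 0) / (1 + q ^+ 4) = wq q by rewrite mul1r addr0.
split; first by apply: intg_eq H1 => // q _; rewrite E.
by rewrite -(Rint_eq (fun q _ => E q)) H2; congr (_ / _); ring.
Qed.

Lemma intg_quartic_inv : intg Rpos (fun q => (1 + q ^+ 4)^-1) /\
  \int[mu]_(q in Rpos) (1 + q ^+ 4)^-1 = pi / (2 * Num.sqrt 2).
Proof.
have [H1 H2] := @quartic_integral R 0 1 (lexx 0) ler01.
have E q : (0 * q ^+ 2 + 1) / (1 + q ^+ 4) = (1 + q ^+ 4)^-1 by rewrite mul0r add0r mul1r.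
split; first by apply: intg_eq H1 => // q _; rewrite E.
by rewrite -(Rint_eq (fun q _ => E q)) H2; congr (_ / _); ring.
Qed.

Lemma measurable_expRN_sqr u D : measurable_fun D (fun q => expR (- (u * q ^+ 2))).
Proof. by apply: cont_meas; der_continuous. Qed.

Lemma expRN_le1 u : 0 <= u -> expR (- u) <= 1.
Proof. by move=> u0; rewrite -expR0 ler_expR oppr_le0. Qed.

Lemma fresnel_tail_intg u : 0 <= u -> intg Rpos (fun q => expR (- (u * q ^+ 2)) * wq q).
Proof.
move=> u0; apply: (@intgM _ _ _ _ 1) => //; [exact: measurable_expRN_sqr| |exact: intg_wq.1].
by move=> q _; rewrite ger0_norm ?expR_ge0// expRN_le1// mulr_ge0// sqr_ge0.
Qed.

Lemma fresnel_tail_ge0 u : 0 <= fresnel_tail u.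
Proof. by apply: Rintegral_ge0 => q _; rewrite mulr_ge0 ?expR_ge0// wq_ge0. Qed.

(** Combine exp(-u q^2) <= 1/(1 + u q^2) with q^2 (1 + u) <= (1 + q^2)(1 + u q^2). The constant is
    the sum of the integrals of q^2/(1+q^4) and 1/(1+q^4). *)
Lemma fresnel_tail_le u : 0 < u -> fresnel_tail u <= pi / Num.sqrt 2 * (1 + u)^-1.
Proof.
move=> u0; have u1 : 0 < 1 + u by rewrite addr_gt0.
have [I1 E1] := intg_wq; have [I2 E2] := intg_quartic_inv.
have -> : pi / Num.sqrt 2 * (1 + u)^-1 =
    \int[mu]_(q in Rpos) ((1 + u)^-1 * (wq q + (1 + q ^+ 4)^-1)).
  rewrite RintegralZl//; last exact: intgD.
  rewrite RintegralD// E1 E2; field.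
  by rewrite !gt_eqF// sqrtr_gt0.
apply: le_Rintegral => //.
- exact: fresnel_tail_intg (ltW u0).
- by apply: intgZl => //; exact: intgD.
move=> q _; have q2 := sqr_ge0 q; have q4 := quartic_gt0 q.
have uq : 0 < 1 + u * q ^+ 2 by rewrite ltr_pwDl// mulr_ge0// ltW.
apply: (@le_trans _ _ ((1 + u * q ^+ 2)^-1 * wq q)).
  by rewrite ler_wpM2r ?wq_ge0// expRN_le// mulr_ge0// ltW.
have -> : wq q + (1 + q ^+ 4)^-1 = (q ^+ 2 + 1) / (1 + q ^+ 4) by rewrite /wq mulrDl mul1r.
rewrite /wq [leLHS]mulrA [leRHS]mulrA ler_pM2r ?invr_gt0// (mulrC (1 + u * _)^-1) (mulrC (1 + u)^-1) ler_pdivrMr// mulrAC ler_pdivlMr//.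
by rewrite -subr_ge0; have := mulr_ge0 (ltW u0) (mulr_ge0 q2 q2); nra.
Qed.

Lemma measurable_fresnel_tail : measurable_fun setT fresnel_tail.
Proof.
apply: measurable_Rint => //; last exact: intg_meas intg_wq.1.
apply: measurable_comp_cont; first exact: continuous_expR.
apply: measurableT_comp => //; apply: measurable_funM => //.
exact: measurable_funX.
Qed.

(** The inner integral over [s] is at most b/(x q^2), and the factor q^2 of [wq] cancels this
    singularity. The choice phi = 1 gives integrability of the tail, phi = cas(t s) its
    transform. *)
Lemma fresnel_tail_fubini x b : 0 < x -> 0 <= b -> forall phi : R -> R,
  measurable_fun setT phi -> (forall s, `|phi s| <= b) ->
  intg Rpos (fun s => phi s * fresnel_tail (x * s)) /\
  \int[mu]_(s in Rpos) (phi s * fresnel_tail (x * s)) =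
  \int[mu]_(q in Rpos) (wq q * \int[mu]_(s in Rpos) (expR (- (x * q ^+ 2 * s)) * phi s)).
Proof.
move=> x0 b0 phi mphi phib.
have mR := @measurable_Rpos R.
have [I1 _] := intg_wq; have [I2 _] := intg_quartic_inv.
have xq q : 0 < q -> 0 < x * q ^+ 2 by move=> q0; rewrite mulr_gt0// exprn_gt0.
have [|||||||H1 H2 H3] := @Fubini_kernel _ Rpos Rpos
  (fun q s => expR (- (x * q ^+ 2 * s)) * phi s) wq (fun=> 1)
  (fun q => b * (x * q ^+ 2)^-1) (@measurable_Rpos R) (@measurable_Rpos R).
- apply: measurable_funM; last by apply: measurableT_comp.
  apply: measurable_comp_cont; first exact: continuous_expR.
  apply: measurableT_comp => //; apply: measurable_funM => //.
  by apply: measurable_funM => //; exact: measurable_funX.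
- exact: intg_meas I1.
- by [].
- move=> q; rewrite in_Rpos => q0; have [E _] := integral_expRN (xq q q0).
  apply: intg_le (intgZl b (@measurable_Rpos R) E) => //.
    apply: measurable_funM => //; apply: measurable_funM; first exact: measurable_expRN.
    exact: measurable_funTS.
  move=> s _; rewrite mulr1 normrM (ger0_norm (expR_ge0 _)) mulrC.
  by rewrite ler_wpM2r ?expR_ge0.
- move=> s; rewrite in_Rpos => s0; apply: (@intgM _ _ _ _ b) => //.
    apply: measurable_funM => //.
    by apply: cont_meas; der_continuous.
  move=> q _; rewrite normrM (ger0_norm (expR_ge0 _)) -[leRHS]mul1r ler_pM ?expR_ge0//.
  by apply: expRN_le1; apply: mulr_ge0; [apply: mulr_ge0; [exact: ltW|exact: sqr_ge0]|exact: ltW].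
- move=> q; rewrite in_Rpos => q0; have [E1 E2] := integral_expRN (xq q q0).
  rewrite -E2 -RintegralZl//; apply: le_Rintegral => //.
  + apply: (@integrable_norm _ _ _ mu _ (fun s => expR (- (x * q ^+ 2 * s)) * phi s * 1)).
    apply: intg_le (intgZl b (@measurable_Rpos R) E1) => //.
      apply: measurable_funM => //; apply: measurable_funM; first exact: measurable_expRN.
      exact: measurable_funTS.
    move=> s _; rewrite mulr1 normrM (ger0_norm (expR_ge0 _)) mulrC.
    by rewrite ler_wpM2r ?expR_ge0.
  + exact: intgZl.
  + move=> s _; rewrite mulr1 normrM (ger0_norm (expR_ge0 _)) mulrC.
    by rewrite ler_wpM2r ?expR_ge0.
- apply: intg_eq (intgZl (b / x) (@measurable_Rpos R) I2) => // q.
  rewrite in_Rpos => q0; rewrite (ger0_norm (wq_ge0 q)) /wq; field.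
  by rewrite quartic_neq0 !gt_eqF.
have E s : 0 < s -> \int[mu]_(q in Rpos) (expR (- (x * q ^+ 2 * s)) * phi s * wq q) =
    phi s * fresnel_tail (x * s).
  move=> s0; rewrite /fresnel_tail -RintegralZl; [|exact: mR|]; last first.
    exact: fresnel_tail_intg (mulr_ge0 (ltW x0) (ltW s0)).
  by apply: Rint_eq => q _; rewrite (mulrAC x); ring.
split.
  by apply: (intg_eq mR _ H2) => s; rewrite in_Rpos => s0; rewrite (E s s0) mul1r.
transitivity (\int[mu]_(s in Rpos) (1 * \int[mu]_(q in Rpos) (expR (- (x * q ^+ 2 * s)) * phi s * wq q))).
  by apply: Rint_eq => s; rewrite in_Rpos => s0; rewrite (E s s0) mul1r.
rewrite -H3; apply: Rint_eq => q _; congr (_ * _).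
by apply: Rint_eq => s _; rewrite mulr1.
Qed.

(** The exponential exp(-x q^2 s) transforms into (x q^2 + t) / ((x q^2)^2 + t^2), and integrating
    this against [wq] is [quartic_kernel_integral]. *)
Lemma fresnel_tail_hart x t : 0 < x -> 0 < t -> x != t ->
  hart (fun s => fresnel_tail (x * s)) t = pi / (2 * Num.sqrt 2) / (x + t).
Proof.
move=> x0 t0 xt; have [_ E] := @fresnel_tail_fubini x 2 x0 (ler0n _ _)
  (fun s => cas (t * s)) (@measurable_cas R t setT) (fun s => cas_bound _).
rewrite /hart E -(quartic_kernel_integral x0 t0 xt); apply: Rint_eq => q; rewrite in_Rpos => q0.
congr (_ * _); have xq : 0 < x * q ^+ 2 by rewrite mulr_gt0// exprn_gt0.
have [_ H] := integral_expRN_trig 1 1 t xq.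
rewrite !mul1r in H; rewrite -H; apply: Rint_eq => s _.
by rewrite /cas !mul1r.
Qed.

Definition fresnel_cos u := sin u * fresnelS u + cos u * fresnelC u.

(** The subtraction formula for cos merges the two Fresnel integrals into one, to which a single
    Gaussian representation applies. *)
Lemma fresnel_cosE u : fresnel_cos u =
  c0 R * \int[mu]_(t in `[0, Num.sqrt u]) cos (u - t ^+ 2).
Proof.
have cs : continuous (fun t : R => sin (t ^+ 2)) by der_continuous.
have cc : continuous (fun t : R => cos (t ^+ 2)) by der_continuous.
have i1 := cont_intg 0 (Num.sqrt u) cs; have i2 := cont_intg 0 (Num.sqrt u) cc.
have m := measurable_itv `[0, Num.sqrt u]%R.
rewrite /fresnel_cos /fresnelS /fresnelC -/(c0 R) mulrCA (mulrCA (cos u)) -mulrDr.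
congr (_ * _); rewrite -!RintegralZl// -RintegralD//; try exact: intgZl.
by apply: Rint_eq => t _; rewrite cosB addrC.
Qed.

(** The factor [t], coming from the Gaussian representation of 1, makes the integrand a function of
    t^2 times its differential, so the primitive is elementary. *)
Lemma damped_cos_integral r q : 0 < r ->
  \int[mu]_(t in `[0, r]) (expR (- (t * q) ^+ 2) * (t * cos (r ^+ 2 - t ^+ 2))) =
  2^-1 * ((q ^+ 2 * cos (r ^+ 2) + sin (r ^+ 2)) / (1 + q ^+ 4) - expR (- (r ^+ 2 * q ^+ 2)) * wq q).
Proof.
move=> r0; pose F t := 2^-1 * (expR (- (t * q) ^+ 2) *
  ((- q ^+ 2) / (1 + q ^+ 4) * cos (r ^+ 2 - t ^+ 2) + (- (1 + q ^+ 4)^-1) * sin (r ^+ 2 - t ^+ 2))).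
transitivity (F r - F 0).
  apply: FTC2 => //; last by der_continuous.
  move=> t; rewrite /F; der; field.
  by rewrite quartic_neq0.
rewrite /F /wq subrr cos0 sin0 mul0r !expr0n /= oppr0 expR0 addr0 exprMn.
by field; rewrite quartic_neq0.
Qed.

Let fresnel_const (p b c T K : R) : 0 < p -> 0 < b -> p ^+ 2 = c ->
  b * p^-1 * (p^-1 * (K * (c / (2 * b)) - T)) = 2^-1 * K - b / c * T.
Proof. by move=> p0 b0 <-; field; rewrite !gt_eqF. Qed.

Let half_cancel (p X I : R) : 0 < p -> p / 2 * I = 2^-1 * X -> I = p^-1 * X.
Proof.
move=> p0 H; have -> : X = 2 * (p / 2 * I) by rewrite H; field.
by field; rewrite gt_eqF.
Qed.

(** In [damped_cos_integral] the endpoint 0 yields cos and sin with weights q^2/(1+q^4) and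
    1/(1+q^4); these have the same integral, so they combine into cas. The endpoint r yields the
    tail. *)
Lemma fresnel_cos_tail u : 0 < u ->
  fresnel_cos u = 2^-1 * cas u - Num.sqrt 2 / pi * fresnel_tail u.
Proof.
move=> u0; rewrite fresnel_cosE; set r := Num.sqrt u.
have r0 : 0 < r by rewrite sqrtr_gt0.
have ur : u = r ^+ 2 by rewrite sqr_sqrtr// ltW.
have sp0 : 0 < Num.sqrt (pi : R) by rewrite sqrtr_gt0 pi_gt0.
have sp : Num.sqrt (pi : R) ^+ 2 = pi by rewrite sqr_sqrtr ?pi_ge0.
have s20 : 0 < Num.sqrt (2 : R) by rewrite sqrtr_gt0.
have s2 : Num.sqrt (2 : R) ^+ 2 = 2 by rewrite sqr_sqrtr.
rewrite ur.
have cc : continuous (fun t : R => cos (r ^+ 2 - t ^+ 2)) by der_continuous.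
(* The endpoint 0 is dropped because [gauss_half] holds only for positive [t]. *)
have sub : (`]0, r]%classic : set R) `<=` `[0, r]%classic.
  by move=> t; rewrite /= !in_itv /= => /andP[/ltW -> ->].
have ic := intgS (measurable_itv `]0, r]) (measurable_itv `[0, r]) sub (cont_intg 0 r cc).
rewrite -Rintegral_itv_obnd_cbnd//.
have m := measurable_itv `]0, r]%R.
have tpos t : `]0, r]%classic t -> 0 < t by rewrite /= in_itv /= => /andP[].
have iK q : intg `]0, r] (fun t => expR (- (t * q) ^+ 2) * (t * cos (r ^+ 2 - t ^+ 2))).
  apply: (intgS m (measurable_itv `[0, r]) sub).
  by apply: cont_intg; der_continuous.
have [|||||||_ _ H] := @Fubini_kernel _ `]0, r] Rpos (fun t q => expR (- (t * q) ^+ 2))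
  (fun t => t * cos (r ^+ 2 - t ^+ 2)) (fun=> 1) (fun t => Num.sqrt pi / 2 / t) m (@measurable_Rpos R).
- apply: measurable_comp_cont; first exact: continuous_expR.
  by apply: measurableT_comp => //; apply: measurable_funX; exact: measurable_funM.
- by apply: cont_meas; der_continuous.
- by [].
- by move=> t /tpos/gauss_half[+ _]; apply: intg_eq => // q _; rewrite mulr1.
- by move=> q _; exact: iK.
- move=> t /tpos t0; have [_ <-] := gauss_half t0; rewrite le_eqVlt; apply/orP; left; apply/eqP.
  by apply: Rint_eq => q _; rewrite mulr1 ger0_norm ?expR_ge0.
- have := intgZl (Num.sqrt pi / 2) m (@integrable_norm _ _ _ mu _ _ ic).
  apply: intg_eq => // t /tpos t0; rewrite normrM (gtr0_norm t0) /=.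
  by field; rewrite gt_eqF.
have HL : \int[mu]_(t in `]0, r]) (t * cos (r ^+ 2 - t ^+ 2) *
    \int[mu]_(q in Rpos) (expR (- (t * q) ^+ 2) * 1)) =
    Num.sqrt pi / 2 * \int[mu]_(t in `]0, r]) cos (r ^+ 2 - t ^+ 2).
  rewrite -RintegralZl; [|exact: m|exact: ic].
  apply: Rint_eq => t /tpos t0.
  have [_ E] := gauss_half t0; rewrite (Rint_eq (g := fun q => expR (- (t * q) ^+ 2))); last first.
    by move=> q _; rewrite mulr1.
  by rewrite E; field; rewrite gt_eqF.
have [I1 E1] := intg_wq; have [I2 E2] := intg_quartic_inv.
have mR := @measurable_Rpos R.
have I3 := fresnel_tail_intg (ltW (exprn_gt0 2 r0)).
have HR : \int[mu]_(q in Rpos) (1 * \int[mu]_(t in `]0, r]) (expR (- (t * q) ^+ 2) *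
      (t * cos (r ^+ 2 - t ^+ 2)))) =
    2^-1 * (cas (r ^+ 2) * (pi / (2 * Num.sqrt 2)) - fresnel_tail (r ^+ 2)).
  transitivity (\int[mu]_(q in Rpos) (2^-1 * (cos (r ^+ 2) * wq q + sin (r ^+ 2) * (1 + q ^+ 4)^-1
      - expR (- (r ^+ 2 * q ^+ 2)) * wq q))).
    apply: Rint_eq => q _; rewrite mul1r Rintegral_itv_obnd_cbnd//.
    rewrite damped_cos_integral//; congr (_ * (_ - _)).
    by rewrite /wq; field; rewrite quartic_neq0.
  have J1 := intgZl (cos (r ^+ 2)) mR I1; have J2 := intgZl (sin (r ^+ 2)) mR I2.
  rewrite RintegralZl; [|exact: mR|exact: intgB mR (intgD mR J1 J2) I3].
  rewrite RintegralB; [|exact: mR|exact: intgD mR J1 J2|exact: I3].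
  rewrite RintegralD; [|exact: mR|exact: J1|exact: J2].
  rewrite RintegralZl; [|exact: mR|exact: I1].
  rewrite RintegralZl; [|exact: mR|exact: I2].
  by rewrite E1 E2 -mulrDl.
move: H; rewrite HL HR => H.
have -> : \int[mu]_(t in `]0, r]) cos (r ^+ 2 - t ^+ 2) =
    (Num.sqrt pi)^-1 * (cas (r ^+ 2) * (pi / (2 * Num.sqrt 2)) - fresnel_tail (r ^+ 2)).
  exact: half_cancel H.
rewrite /c0 sqrtrM// sqrtrV ?pi_ge0//.
exact: fresnel_const.
Qed.

End FresnelKernel.

(** * The inverse operator on real L_2 *)

Section Inverse.
Variable R : realType.
Local Notation mu := (@lebesgue_measure R).
Local Notation intg D f := (mu.-integrable D (EFin \o f)).
Implicit Types (f g h : R -> R) (x s t a b B C e q u r : R).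

Let C0 : R := pi / Num.sqrt 2.

Definition tail_op f x := \int[mu]_(t in Rpos) (fresnel_tail (x * t) * f t).

Lemma tail_kernel_bound x t : 0 < x -> 0 < t -> `|fresnel_tail (x * t)| <= C0 * (1 + x * t)^-1.
Proof.
by move=> x0 t0; rewrite (ger0_norm (fresnel_tail_ge0 _)); exact: fresnel_tail_le (mulr_gt0 x0 t0).
Qed.

Lemma measurable_tail x D : measurable_fun D (fun t => fresnel_tail (x * t)).
Proof.
apply: measurable_funTS; apply: measurableT_comp; first exact: measurable_fresnel_tail.
exact: measurable_funM.
Qed.

Lemma measurable_tail_kernel : measurable_fun setT (fun z : R * R => fresnel_tail (z.1 * z.2)).
Proof.
apply: measurableT_comp; first exact: measurable_fresnel_tail.
exact: measurable_funM.
Qed.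

Lemma tail_op_bound f x t : 0 < x -> 0 < t ->
  `|fresnel_tail (x * t) * f t| <= C0 * ((1 + x * t)^-1 * `|f t|).
Proof. by move=> x0 t0; rewrite normrM mulrA ler_wpM2r//; exact: tail_kernel_bound. Qed.

Lemma tail_op_intg f x : sqint f -> 0 < x -> intg Rpos (fun t => fresnel_tail (x * t) * f t).
Proof.
move=> Sf x0; have [H _ _] := schur_test (@schur_kernel_inv_1D R) Sf.
apply: intg_le (intgZl C0 (@measurable_Rpos R) (H x x0)) => //.
  by apply: measurable_funM; [exact: measurable_tail|exact: Sf.1].
by move=> t; rewrite in_Rpos => t0; exact: tail_op_bound.
Qed.

Lemma tail_op_norm_le f x : sqint f -> 0 < x ->
  \int[mu]_(t in Rpos) `|fresnel_tail (x * t) * f t| <=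
  C0 * schur_op (fun x t : R => (1 + x * t)^-1) f x.
Proof.
move=> Sf x0; have [H _ _] := schur_test (@schur_kernel_inv_1D R) Sf.
rewrite /schur_op -RintegralZl; [|exact: measurable_Rpos|exact: H].
apply: le_Rintegral.
- exact: measurable_Rpos.
- exact: (@integrable_norm _ _ _ mu _ _ (tail_op_intg Sf x0)).
- exact: intgZl (@measurable_Rpos R) (H x x0).
- by move=> t; rewrite in_Rpos => t0; exact: tail_op_bound _ x0 t0.
Qed.

Lemma tail_op_le f x : sqint f -> 0 < x ->
  `|tail_op f x| <= C0 * schur_op (fun x t : R => (1 + x * t)^-1) f x.
Proof.
move=> Sf x0; apply: le_trans (tail_op_norm_le Sf x0).
by apply: le_normr_Rintegral; [exact: measurable_Rpos|exact: tail_op_intg].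
Qed.

Lemma tail_op_sqint f : sqint f -> sqint (tail_op f).
Proof.
move=> Sf; have [_ H _] := schur_test (@schur_kernel_inv_1D R) Sf.
apply: sqint_le (sqintZ C0 H).
  by apply: measurable_funTS; apply: measurable_Rint => //; [exact: measurable_tail_kernel|exact: Sf.1].
by move=> x x0; exact: tail_op_le.
Qed.

Lemma C0_ge0 : 0 <= C0. Proof. by rewrite divr_ge0 ?pi_ge0 ?sqrtr_ge0. Qed.

Lemma nrm_le f g : sqint f -> sqint g -> (forall x, 0 < x -> `|f x| <= g x) -> nrm f <= nrm g.
Proof.
move=> Sf Sg fg; rewrite ler_sqrt ?ip_ge0//; apply: le_Rintegral.
- exact: measurable_Rpos.
- exact: sqint_mul.
- exact: sqint_mul.
- move=> x; rewrite in_Rpos => x0; rewrite -!expr2 -(real_normK (num_real (f x))).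
  by rewrite lerXn2r ?nnegrE ?fg//; exact: le_trans (fg _ x0).
Qed.

Lemma tail_op_nrm f : sqint f -> nrm (tail_op f) <= C0 * pi * nrm f.
Proof.
move=> Sf; have [_ H b] := schur_test (@schur_kernel_inv_1D R) Sf.
apply: (@le_trans _ _ (nrm (C0 *: schur_op (fun x t : R => (1 + x * t)^-1) f))).
  apply: nrm_le; [exact: tail_op_sqint|exact: sqintZ|].
  by move=> x x0; exact: tail_op_le.
rewrite nrmZ// (ger0_norm C0_ge0) -mulrA ler_wpM2l ?C0_ge0//.
by apply: nrm_sqrt_le b; exact: pi_ge0.
Qed.

Lemma tail_op_sym f g : sqint f -> sqint g -> ip (tail_op f) g = ip f (tail_op g).
Proof.
move=> Sf Sg; have [_ Hs _] := schur_test (@schur_kernel_inv_1D R) Sf.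
have [|||||||_ _ E] := @Fubini_kernel _ Rpos Rpos (fun x t => fresnel_tail (x * t)) g f
  (fun x => C0 * schur_op (fun x t : R => (1 + x * t)^-1) f x) (@measurable_Rpos R) (@measurable_Rpos R).
- exact: measurable_tail_kernel.
- exact: Sg.1.
- exact: Sf.1.
- by move=> x; rewrite in_Rpos; exact: tail_op_intg.
- move=> t; rewrite in_Rpos => t0.
  by apply: (intg_eq (@measurable_Rpos R) _ (tail_op_intg Sg t0)) => x _; rewrite (mulrC t).
- by move=> x; rewrite in_Rpos; exact: tail_op_norm_le.
- have := intgZl C0 (@measurable_Rpos R) (sqint_mul (sqint_norm Sg) Hs).
  by apply: intg_eq => // x _; rewrite mulrCA.
rewrite ipC.
rewrite /ip /tail_op.
rewrite E.
apply: Rint_eq => t _.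
apply: (congr1 (fun z => f t * z)).
by apply: Rint_eq => x _; rewrite (mulrC x).
Qed.

Lemma tail_op_lin a f g : sqint f -> sqint g ->
  aeq (tail_op (a *: f + g)) (a *: tail_op f + tail_op g).
Proof.
move=> Sf Sg; apply: aeq_on => x x0; have mR := @measurable_Rpos R.
have If := tail_op_intg Sf x0; have Ig := tail_op_intg Sg x0.
transitivity (a * tail_op f x + tail_op g x) => //.
rewrite /tail_op -RintegralZl; [|exact: mR|exact: If].
rewrite -RintegralD; [|exact: mR|exact: intgZl mR If|exact: Ig].
by apply: Rint_eq => t _; rewrite mulrDr mulrCA.
Qed.

Lemma tail_op_aeq f g : sqint f -> sqint g -> aeq f g -> aeq (tail_op f) (tail_op g).
Proof.
move=> Sf Sg E; apply: aeq_on => x x0; apply: Rint_ae_eq.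
- exact: measurable_Rpos.
- exact: intg_meas (tail_op_intg Sf x0).
- exact: intg_meas (tail_op_intg Sg x0).
- by apply: aeS E => t H Rt; rewrite H.
Qed.

Lemma sqint_tail x : 0 < x -> sqint (fun t => fresnel_tail (x * t)).
Proof.
move=> x0; have xi0 : 0 < x^-1 by rewrite invr_gt0.
apply: sqint_le (sqintZ (C0 * x^-1) (sqint_resolvent xi0)); first exact: measurable_tail.
move=> t t0; apply: (le_trans (tail_kernel_bound x0 t0)).
rewrite le_eqVlt; apply/orP; left; apply/eqP.
transitivity (C0 * x^-1 * (x^-1 + t)^-1) => //; field.
by rewrite !gt_eqF// ?addr_gt0// mulr_gt0.
Qed.

Lemma intg_tail x : 0 < x -> intg Rpos (fun t => fresnel_tail (x * t)).
Proof.
move=> x0; have [H _] := @fresnel_tail_fubini _ x 1 x0 ler01 (fun=> 1) (measurable_cst _)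
  (fun _ => ltac:(by rewrite normr1)).
by apply: intg_eq H => // t _; rewrite mul1r.
Qed.

(** Discards the point t = x, which [fresnel_tail_hart] excludes. *)
Lemma ae_neq x : {ae mu, forall t, t != x}.
Proof.
exists [set x]; split; [exact: measurable_set1|exact: lebesgue_measure_set1|].
by move=> t /= /negP; rewrite negbK => /eqP.
Qed.

(** By symmetry the transform moves from [f] to the tail kernel, which is integrable as well as
    square-integrable. There it gives a multiple of 1/(x+t), and pairing that with [f] is the
    Stieltjes operator. *)
Lemma tail_op_opH f x : sqint f -> 0 < x ->
  tail_op (opH f) x = c0 R * (pi / (2 * Num.sqrt 2)) * lap (lap f) x.
Proof.
move=> Sf x0; have Sm := sqint_tail x0; have Sr := sqint_resolvent x0.
set k := c0 R * _.
have -> : tail_op (opH f) x = ip (opH (fun t => fresnel_tail (x * t))) f by rewrite opH_sym.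
rewrite lap_lap//.
have E : aeq (opH (fun t => fresnel_tail (x * t))) (k *: (fun t => (x + t)^-1)).
  apply: (aeq_trans (opH_hart Sm (intg_tail x0))).
  apply: aeS (ae_neq x) => t tx; rewrite in_Rpos => t0.
  transitivity (c0 R * hart (fun s => fresnel_tail (x * s)) t) => //.
  by rewrite fresnel_tail_hart// 1?eq_sym// mulrA.
rewrite (aeq_ipl _ _ _ E)//; [|exact: opH_sqint|exact: sqintZ].
by rewrite ipZl.
Qed.

(** The coefficient of the tail in sqrt(2/pi) times the Fresnel kernel, read off from
    [fresnel_cos_tail]; the 2^-1 in [opG] has the same origin. *)
Definition c1 : R := c0 R * (Num.sqrt 2 / pi).

Definition opG f := (- c1) *: tail_op f + 2^-1 *: opH f.

Lemma opG_sqint f : sqint f -> sqint (opG f).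
Proof.
move=> Sf; apply: sqintD; apply: sqintZ; [exact: tail_op_sqint|exact: opH_sqint].
Qed.

Lemma ip_opG f g : sqint f -> sqint g ->
  ip (opG f) g = - c1 * ip (tail_op f) g + 2^-1 * ip (opH f) g.
Proof.
move=> Sf Sg; have S1 := tail_op_sqint Sf; have S2 := opH_sqint Sf.
by rewrite ipDl ?ipZl//; exact: sqintZ.
Qed.

Lemma opG_sym f g : sqint f -> sqint g -> ip (opG f) g = ip f (opG g).
Proof. by move=> Sf Sg; rewrite [RHS]ipC !ip_opG// tail_op_sym// opH_sym// !(ipC f). Qed.

(** The tail term contributes c^2 / 2 = 1/p times [X], exactly half of the coefficient 2/p that
    [opH_opH] puts in front of it. *)
Let inverse_const (c p r X Y : R) : p != 0 -> 0 < r -> c ^+ 2 = 2 / p ->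
  - (c * (r / p)) * (c * (p / (2 * r)) * X) + 2^-1 * (2 * Y + 2 / p * X) = Y.
Proof.
move=> p0 r0 H; have -> : - (c * (r / p)) * (c * (p / (2 * r)) * X) = - (c ^+ 2 / 2) * X.
  by field; rewrite p0 gt_eqF.
by rewrite H; field.
Qed.

Lemma opG_opH f : sqint f -> aeq (opG (opH f)) f.
Proof.
move=> Sf; have SH := opH_sqint Sf; apply: weak_aeq => //; first exact: opG_sqint.
move=> g Sg; rewrite ip_opG// opH_opH//.
have SL := lap_sqint (lap_sqint Sf).
have E : aeq (tail_op (opH f)) ((c0 R * (pi / (2 * Num.sqrt 2))) *: lap (lap f)).
  by apply: aeq_on => x x0; rewrite tail_op_opH.
rewrite (aeq_ipl _ _ _ E)//; [|exact: tail_op_sqint|exact: sqintZ].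
rewrite ipZl// /c1; move: (ip _ _) (ip _ _) => X Y.
have s20 : 0 < Num.sqrt (2 : R) by rewrite sqrtr_gt0.
by apply: inverse_const (c0_sqr R); [exact: lt0r_neq0 (pi_gt0 R)|].
Qed.

Lemma opH_opG f : sqint f -> aeq (opH (opG f)) f.
Proof.
move=> Sf; have SG := opG_sqint Sf; apply: weak_aeq => //; first exact: opH_sqint.
move=> g Sg; have SH := opH_sqint Sg; rewrite opH_sym// opG_sym// ipC.
by rewrite (aeq_ipl _ _ _ (opG_opH Sg))// 1?ipC//; exact: opG_sqint.
Qed.

Lemma c1_ge0 : 0 <= c1.
Proof. by rewrite mulr_ge0 ?divr_ge0 ?sqrtr_ge0 ?pi_ge0// ltW// c0_gt0. Qed.

Lemma opG_nrm f : sqint f -> nrm (opG f) <= (c1 * (C0 * pi) + 1) * nrm f.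
Proof.
move=> Sf; have S1 := tail_op_sqint Sf; have S2 := opH_sqint Sf.
apply: (le_trans (nrmD (sqintZ _ S1) (sqintZ _ S2))).
rewrite !nrmZ// normrN (ger0_norm c1_ge0) (ger0_norm (_ : 0 <= 2^-1))// mulrDl.
have H1 := ler_wpM2l c1_ge0 (tail_op_nrm Sf); have H2 := opH_nrm Sf.
apply: lerD; first by rewrite -mulrA.
by rewrite mul1r ler_pdivrMl.
Qed.

Lemma opG_lin a f g : sqint f -> sqint g -> aeq (opG (a *: f + g)) (a *: opG f + opG g).
Proof.
move=> Sf Sg; apply: aeS2 (opH_lin a Sf Sg) (tail_op_lin a Sf Sg) => x E1 E2 Rx.
have := E1 Rx; have := E2 Rx; rewrite /opG !fctE => -> ->.
by rewrite /GRing.scale /=; ring.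
Qed.

Lemma opG_aeq f g : sqint f -> sqint g -> aeq f g -> aeq (opG f) (opG g).
Proof.
by move=> Sf Sg E; apply: aeq_lin; [exact: tail_op_aeq|apply: aeS (opH_aeq Sf Sg E) => x H Rx; rewrite !fctE H].
Qed.

(** For integrable [f] both integrals converge absolutely and merge into one; here the abstract
    inverse meets the kernel of the inversion formula. *)
Lemma opG_integral f : sqint f -> intg Rpos f ->
  aeq (opG f) (fun x => c0 R * \int[mu]_(t in Rpos) (fresnel_cos (x * t) * f t)).
Proof.
move=> Sf jf; apply: aeS (opH_hart Sf jf) => x E Rx; have x0 := Rx; rewrite in_Rpos in x0.
have mR := @measurable_Rpos R; have I1 := tail_op_intg Sf x0; have I2 := hart_intg x jf.
transitivity (- c1 * tail_op f x + 2^-1 * opH f x) => //.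
rewrite (E Rx); transitivity (c0 R * (2^-1 * hart f x - Num.sqrt 2 / pi * tail_op f x)).
  by rewrite /c1; transitivity (- (c0 R * (Num.sqrt 2 / pi)) * tail_op f x + 2^-1 * (c0 R * hart f x)) => //; ring.
congr (_ * _); rewrite /hart /tail_op -RintegralZl; [|exact: mR|exact: I2].
rewrite -RintegralZl; [|exact: mR|exact: I1].
rewrite -RintegralB; [|exact: mR|exact: intgZl mR I2|exact: intgZl mR I1].
apply: Rint_eq => t; rewrite in_Rpos => t0; rewrite fresnel_cos_tail ?mulr_gt0//.
by rewrite mulrBl !mulrA.
Qed.

End Inverse.

(** * Complex-valued functions *)

Section ComplexL2.
Variable R : realType.
Local Notation mu := (@lebesgue_measure R).
Local Notation intg D f := (mu.-integrable D (EFin \o f)).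
Local Open Scope complex_scope.
Implicit Types (f g h : R -> R[i]) (x s t a b B C e : R).

Definition rep f : R -> R := fun x => complex.Re (f x).
Definition imp f : R -> R := fun x => complex.Im (f x).

Definition csqint f := sqint (rep f) /\ sqint (imp f).

Definition cnrm f : R := Num.sqrt (nrm (rep f) ^+ 2 + nrm (imp f) ^+ 2).

Lemma Re_normc (z : R[i]) : complex.Re `|z| = Num.sqrt (complex.Re z ^+ 2 + complex.Im z ^+ 2).
Proof. by case: z. Qed.

Let sqn f x := rep f x ^+ 2 + imp f x ^+ 2.

Lemma L2norm_integral f : L2norm f = ((\int[mu]_(x in Rpos) (sqn f x)%:E) `^ 2^-1)%E.
Proof.
rewrite /L2norm unlock; congr (_ `^ _)%E; rewrite [RHS]integral_mkcond.
apply: eq_integral => x _; rewrite !patchE; case: ifP => _.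
  rewrite Re_normc /sqn /= ger0_norm ?sqrtr_ge0// powR_mulrn ?sqrtr_ge0//.
  by rewrite sqr_sqrtr// addr_ge0// sqr_ge0.
by rewrite /= normr0 powR0.
Qed.

Lemma csqint_sqn f : csqint f -> intg Rpos (sqn f).
Proof. by move=> [[_ H1] [_ H2]]; exact: intgD. Qed.

Lemma L2normE f : csqint f -> L2norm f = (cnrm f)%:E.
Proof.
move=> Sf; have [S1 S2] := Sf.
have E : \int[mu]_(x in Rpos) sqn f x = nrm (rep f) ^+ 2 + nrm (imp f) ^+ 2.
  rewrite !nrm2 /ip -RintegralD; [|exact: measurable_Rpos|exact: sqint_mul|exact: sqint_mul].
  by apply: Rint_eq => x _; rewrite /sqn !expr2.
rewrite L2norm_integral -RintE; [|exact: measurable_Rpos|exact: csqint_sqn].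
by rewrite E poweR_EFin powR12_sqrt// addr_ge0// sqr_ge0.
Qed.

Lemma inL2P f : inL2 f <-> csqint f.
Proof.
split=> [[[mr mi] fin]|Sf]; last first.
  by split; [case: Sf => -[? _] [? _]|rewrite L2normE// ltry].
have msq : measurable_fun Rpos (sqn f) by apply: measurable_funD; exact: measurable_funX.
have iq : intg Rpos (sqn f).
  apply/integrableP; split; first exact/measurable_EFinP.
  have -> : (\int[mu]_(x in Rpos) `|(EFin \o sqn f) x| = \int[mu]_(x in Rpos) (sqn f x)%:E)%E.
    by apply: eq_integral => x _ /=; rewrite ger0_norm// addr_ge0// sqr_ge0.
  move: fin; rewrite L2norm_integral.
  have : (0 <= \int[mu]_(x in Rpos) (sqn f x)%:E)%E.
    by apply: integral_ge0 => x _; rewrite lee_fin addr_ge0// sqr_ge0.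
  case: (integral _ _ _) => [r| |]//= _; first by move=> *; exact: ltry.
  (* The infinite case is refuted, since +oo raised to a nonzero power is +oo. *)
  by rewrite invr_eq0 pnatr_eq0.
by split; split => //; apply: (intg_le _ _ _ iq); try exact: measurable_Rpos;
  try exact: measurable_funX; move=> x _; rewrite ger0_norm ?sqr_ge0// /sqn ?lerDl ?lerDr sqr_ge0.
Qed.

Lemma cnrm_ge0 f : 0 <= cnrm f. Proof. exact: sqrtr_ge0. Qed.

Lemma cnrm_sqr f : cnrm f ^+ 2 = nrm (rep f) ^+ 2 + nrm (imp f) ^+ 2.
Proof. exact: sqr_sqrtr (addr_ge0 (sqr_ge0 _) (sqr_ge0 _)). Qed.

Lemma nrm_rep_le f : nrm (rep f) <= cnrm f.
Proof.
rewrite -(ler_pXn2r (n := 2)) ?nnegrE ?nrm_ge0 ?cnrm_ge0// cnrm_sqr.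
by rewrite lerDl sqr_ge0.
Qed.

Lemma nrm_imp_le f : nrm (imp f) <= cnrm f.
Proof.
rewrite -(ler_pXn2r (n := 2)) ?nnegrE ?nrm_ge0 ?cnrm_ge0// cnrm_sqr.
by rewrite lerDr sqr_ge0.
Qed.

Lemma cnrm_leD f : cnrm f <= nrm (rep f) + nrm (imp f).
Proof.
rewrite -(ler_pXn2r (n := 2)) ?nnegrE ?addr_ge0 ?nrm_ge0 ?cnrm_ge0//.
rewrite cnrm_sqr sqrrD lerD2r lerDl.
by rewrite mulrn_wge0// mulr_ge0 ?nrm_ge0.
Qed.

Lemma cnrm_mono f g M : 0 <= M -> nrm (rep f) <= M * nrm (rep g) ->
  nrm (imp f) <= M * nrm (imp g) -> cnrm f <= M * cnrm g.
Proof.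
move=> M0 H1 H2; rewrite -(ler_pXn2r (n := 2)) ?nnegrE ?mulr_ge0 ?cnrm_ge0//.
rewrite exprMn !cnrm_sqr mulrDr -!exprMn.
by apply: lerD; rewrite ler_pXn2r ?nnegrE ?mulr_ge0 ?nrm_ge0.
Qed.

Lemma cnrm_mono_ge f g M : 0 <= M -> M * nrm (rep g) <= nrm (rep f) ->
  M * nrm (imp g) <= nrm (imp f) -> M * cnrm g <= cnrm f.
Proof.
move=> M0 H1 H2; rewrite -(ler_pXn2r (n := 2)) ?nnegrE ?mulr_ge0 ?cnrm_ge0//.
rewrite exprMn !cnrm_sqr mulrDr -!exprMn.
by apply: lerD; rewrite ler_pXn2r ?nnegrE ?mulr_ge0 ?nrm_ge0.
Qed.

Lemma eqL2P f g : eqL2 f g <-> aeq (rep f) (rep g) /\ aeq (imp f) (imp g).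
Proof.
split=> [E|[E1 E2]]; first by split; apply: aeS E => x H Rx; rewrite /rep /imp H.
apply: aeS2 E1 E2 => x H1 H2 Rx; have := H1 Rx; have := H2 Rx; rewrite /rep /imp.
by case: (f x) => a b; case: (g x) => c d /= -> ->.
Qed.

Definition cplx (T : (R -> R) -> R -> R) f x : R[i] := T (rep f) x +i* T (imp f) x.

Lemma rep_lin (z : R[i]) f g : rep (fun x => z * f x + g x) =
  complex.Re z *: rep f + ((- complex.Im z) *: imp f + rep g).
Proof.
apply/funext => x; rewrite /rep /imp !fctE; case: z => p q; case: (f x) => c d; case: (g x) => u v /=.
by rewrite /GRing.scale /=; ring.
Qed.

Lemma imp_lin (z : R[i]) f g : imp (fun x => z * f x + g x) =
  complex.Re z *: imp f + (complex.Im z *: rep f + imp g).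
Proof.
apply/funext => x; rewrite /rep /imp !fctE; case: z => p q; case: (f x) => c d; case: (g x) => u v /=.
by rewrite /GRing.scale /=; ring.
Qed.

Lemma csqint_lin (z : R[i]) f g : csqint f -> csqint g -> csqint (fun x => z * f x + g x).
Proof.
move=> [f1 f2] [g1 g2]; rewrite /csqint rep_lin imp_lin.
by split; apply: sqint_lin => //; exact: sqint_lin.
Qed.

(** A complex scalar mixes the components, so each component of a complex combination is a real
    combination of three functions; hence [lin3]. The bound is kept because the squared norm is the
    sum of those of the components. *)
Lemma bounded_cplx (T : (R -> R) -> R -> R) (M : R) : 0 <= M ->
  (forall u, sqint u -> sqint (T u)) ->
  (forall u v, sqint u -> sqint v -> aeq u v -> aeq (T u) (T v)) ->
  (forall a u v, sqint u -> sqint v -> aeq (T (a *: u + v)) (a *: T u + T v)) ->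
  (forall u, sqint u -> nrm (T u) <= M * nrm u) ->
  bounded_operatorL2 (cplx T).
Proof.
move=> M0 TS TE TL TM.
have lin3 a b u v w : sqint u -> sqint v -> sqint w ->
    aeq (T (a *: u + (b *: v + w))) (a *: T u + (b *: T v + T w)).
  move=> Su Sv Sw; apply: aeq_trans (TL a _ _ Su (sqint_lin b Sv Sw)) _.
  by apply: aeq_lin; [exact: aeq_refl|exact: TL].
split.
- by move=> f /inL2P[f1 f2]; apply/inL2P; split; exact: TS.
- move=> f g /inL2P[f1 f2] /inL2P[g1 g2] /eqL2P[E1 E2]; apply/eqL2P; split; exact: TE.
- move=> z f g /inL2P[f1 f2] /inL2P[g1 g2]; apply/eqL2P; rewrite rep_lin imp_lin; split.
  + by rewrite {1}/rep /cplx /= rep_lin; exact: lin3.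
  + by rewrite {1}/imp /cplx /= imp_lin; exact: lin3.
- exists M => f /inL2P Sf; have [f1 f2] := Sf; rewrite !L2normE//; last by split; exact: TS.
  by rewrite -EFinM lee_fin; apply: cnrm_mono => //; exact: TM.
Qed.

Lemma C2_on_measurable (u : R -> R) : C2_on Rpos u -> measurable_fun Rpos u.
Proof.
move=> Hu; apply: open_continuous_measurable_fun; first exact: open_Rpos.
move=> x /set_mem Rx; have [d _ _] := Hu x Rx.
exact/differentiable_continuous/derivable1_diffP.
Qed.

Lemma compact_support_bsupp (u : R -> R) (K : set R) : C2_on Rpos u -> compact K -> K `<=` Rpos ->
  (forall x, Rpos x -> ~ K x -> u x = 0) -> sqint u /\ intg Rpos u.
Proof.
move=> Hu cK KR u0; have mu_ := C2_on_measurable Hu.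
have cu : {within K, continuous u}.
  apply: continuous_in_subspaceT => x /set_mem /KR Rx; have [d _ _] := Hu x Rx.
  exact/differentiable_continuous/derivable1_diffP.
have [M [_ HM]] := compact_bounded cK.
have [B [_ HB]] := compact_bounded (continuous_compact cu cK).
pose b := `|M| + 1; pose c := `|B| + 1.
have Kb x : K x -> x <= b.
  by move=> Kx; rewrite (le_trans (ler_norm _))//; apply: HM => //; rewrite /b (le_lt_trans (ler_norm _))// ltrDl.
have uc x : Rpos x -> `|u x| <= c * \1_(`]0, b]) x.
  move=> Rx; have [Kx|nK] := pselect (K x); last first.
    by rewrite u0// normr0 mulr_ge0// addr_ge0.
  rewrite indicE mem_set ?mulr1; last by rewrite /= in_itv /= Kb// -in_Rpos Rx.
  apply: HB; last by exists x.
  by rewrite /c (le_lt_trans (ler_norm _))// ltrDl.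
have S1 := sqint_indic b; have I1 : intg Rpos (\1_(`]0, b]) : R -> R).
  apply: intg_eq (sqint_mul S1 S1) => // x _; rewrite indicE.
  by case: (_ \in _); rewrite ?mulr1 ?mulr0.
split; first by apply: sqint_le (sqintZ c S1) => // x x0; apply: uc; rewrite in_Rpos.
by apply: intg_le (intgZl c (@measurable_Rpos R) I1).
Qed.

Lemma C2c_sqint f : C2c f -> csqint f /\ (intg Rpos (rep f) /\ intg Rpos (imp f)).
Proof.
move=> [H1 H2 [K [cK KR f0]]].
have [|S1 I1] := compact_support_bsupp H1 cK KR; first by move=> x Rx nK; rewrite f0.
have [|S2 I2] := compact_support_bsupp H2 cK KR; first by move=> x Rx nK; rewrite f0.
by [].
Qed.

Lemma C2c_dense f e : csqint f -> 0 < e -> exists g, C2c g /\ cnrm (fun x => f x - g x) < e.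
Proof.
move=> [S1 S2] e0; have e2 : 0 < e / 2 by rewrite divr_gt0.
have [u [[a [b [B [C [a0 [mu1 uB u0] _]]]]] C2u du]] := lipc_dense S1 e2.
have [v [[a' [b' [B' [C' [a'0 [mv vB v0] _]]]]] C2v dv]] := lipc_dense S2 e2.
exists (fun x => u x +i* v x); split.
  split; [exact: C2u|exact: C2v|].
  exists `[Num.min a a', Num.max b b']%classic; split; first exact: segment_compact.
    move=> x /=; rewrite in_itv /= => /andP[+ _]; rewrite in_Rpos; apply: lt_le_trans.
    by rewrite lt_min a0.
  move=> x _; rewrite /= in_itv /= => nx; rewrite u0 ?v0//.
    apply/negP => /andP[x1 x2]; apply: nx.
    by rewrite ge_min x1 orbT le_max x2 orbT.
  apply/negP => /andP[x1 x2]; apply: nx.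
  by rewrite ge_min x1 le_max x2.
apply: (le_lt_trans (cnrm_leD _)); rewrite [ltRHS]splitr; apply: ltrD.
- apply: le_lt_trans du; rewrite le_eqVlt; apply/orP; left; apply/eqP; congr nrm.
  by apply/funext => x; rewrite /rep !fctE; case: (f x).
- apply: le_lt_trans dv; rewrite le_eqVlt; apply/orP; left; apply/eqP; congr nrm.
  by apply/funext => x; rewrite /imp !fctE; case: (f x).
Qed.

(** The factor 2 is the price of passing through real and imaginary parts; it is harmless in an
    argument that only needs smallness. *)
Lemma cnrm_triangle f g h : csqint f -> csqint g -> csqint h -> eqL2 h (fun x => f x - g x) ->
  cnrm h <= 2 * (cnrm f + cnrm g).
Proof.
move=> [f1 f2] [g1 g2] [h1 h2] /eqL2P[E1 E2].
have R1 : rep (fun x => f x - g x) = rep f - rep g.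
  by apply/funext => x; rewrite /rep !fctE; case: (f x); case: (g x).
have R2 : imp (fun x => f x - g x) = imp f - imp g.
  by apply/funext => x; rewrite /imp !fctE; case: (f x); case: (g x).
rewrite R1 in E1; rewrite R2 in E2.
apply: (le_trans (cnrm_leD _)); rewrite (aeq_nrm h1 _ E1) ?(aeq_nrm h2 _ E2); try exact: sqintB.
have A := nrmD f1 (sqintN g1); have B := nrmD f2 (sqintN g2).
rewrite !nrmN// in A B.
have := nrm_rep_le f; have := nrm_rep_le g; have := nrm_imp_le f; have := nrm_imp_le g.
by move: A B; lra.
Qed.

Lemma cnrm_eq0 f : csqint f -> cnrm f <= 0 -> eqL2 f (fun=> 0).
Proof.
move=> [f1 f2] f0; apply/eqL2P.
have A : nrm (rep f) = 0.
  by apply/eqP; rewrite eq_le nrm_ge0 andbT; exact: le_trans (nrm_rep_le f) f0.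
have B : nrm (imp f) = 0.
  by apply/eqP; rewrite eq_le nrm_ge0 andbT; exact: le_trans (nrm_imp_le f) f0.
by split; exact: nrm0_ae.
Qed.

End ComplexL2.

(** * The complex transform: uniqueness, differentiation and inversion formulas *)

Section ComplexHartley.
Variable R : realType.
Local Notation mu := (@lebesgue_measure R).
Local Notation intg D f := (mu.-integrable D (EFin \o f)).
Local Open Scope complex_scope.
Implicit Types (f g h : R -> R[i]) (x s t a b B C e : R).

Lemma aeI (P Q : R -> Prop) : {ae mu, forall x, P x} -> {ae mu, forall x, Q x} ->
  {ae mu, forall x, P x /\ Q x}.
Proof. by apply: aeS2 => x. Qed.

Lemma Re_realM a (z : R[i]) : complex.Re (a%:C * z) = a * complex.Re z.
Proof. by case: z => u v /=; ring. Qed.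

Lemma Im_realM a (z : R[i]) : complex.Im (a%:C * z) = a * complex.Im z.
Proof. by case: z => u v /=; ring. Qed.

Lemma divc_real (z : R[i]) t : z / t%:C = (t^-1)%:C * z.
Proof. by rewrite mulrC -fmorphV. Qed.

Definition cH := cplx (@opH R).

Lemma cH_bounded : bounded_operatorL2 cH.
Proof.
by apply: (@bounded_cplx _ _ 2) => //;
  [exact: opH_sqint|exact: opH_aeq|exact: opH_lin|exact: opH_nrm].
Qed.

Lemma cH_csqint f : csqint f -> csqint (cH f).
Proof. by move=> [f1 f2]; split; exact: opH_sqint. Qed.

Lemma cH_half_hartley f : C2c f -> eqL2 (cH f) (half_hartley f).
Proof.
move=> /C2c_sqint[[S1 S2] [I1 I2]]; apply/eqL2P; split.
- apply: (aeq_trans (opH_hart S1 I1)); apply: aeq_on => x _.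
  rewrite /rep /half_hartley Re_realM; transitivity (c0 R * hart (rep f) x) => //.
  by congr (_ * _); apply: Rint_eq => t _; rewrite Re_realM.
- apply: (aeq_trans (opH_hart S2 I2)); apply: aeq_on => x _.
  rewrite /imp /half_hartley Im_realM; transitivity (c0 R * hart (imp f) x) => //.
  by congr (_ * _); apply: Rint_eq => t _; rewrite Im_realM.
Qed.

Lemma cH_extension : bounded_extension cH.
Proof. by split; [exact: cH_bounded|exact: cH_half_hartley]. Qed.

(** Two extensions agree on the dense class [C2c], so their difference at [f] equals their
    difference at a small remainder f - g, where both bounds apply. *)
Lemma extension_unique (H H' : (R -> R[i]) -> R -> R[i]) :
  bounded_extension H -> bounded_extension H' -> forall f, inL2 f -> eqL2 (H' f) (H f).
Proof.
move=> [[hS hE hL [M hM]] hX] [[h'S h'E h'L [M' h'M]] h'X] f Lf.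
have Sf := (inL2P f).1 Lf.
have SH g : inL2 g -> csqint (H g) by move=> /hS /inL2P.
have SH' g : inL2 g -> csqint (H' g) by move=> /h'S /inL2P.
have minus1 g1 g2 : (fun x => -1 * g2 x + g1 x) = (fun x => g1 x - g2 x).
  by apply/funext => x; rewrite mulN1r addrC.
have Sd : csqint (fun x => H' f x - H f x).
  by rewrite -minus1; apply: csqint_lin; [exact: SH|exact: SH'].
suff : cnrm (fun x => H' f x - H f x) <= 0.
  move=> /(cnrm_eq0 Sd); apply: aeS => x E Rx.
  by apply/eqP; rewrite -subr_eq0 E.
(* The 2 is that of [cnrm_triangle]; absolute values appear since [M] and [M'] come without a sign,
   and the 1 makes [K] positive. *)
set K := 2 * (`|M'| + `|M|) + 1; have K0 : 0 < K by rewrite ltr_wpDl// mulr_ge0// addr_ge0.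
apply/ler_addgt0Pl => e e0; rewrite addr0.
have eK : 0 < e / K by rewrite divr_gt0.
have [g [Cg dg]] := C2c_dense Sf eK.
have [Sg _] := C2c_sqint Cg; have Lg := (inL2P g).2 Sg.
pose d := fun x => f x - g x.
have Sd' : csqint d by rewrite /d -minus1; exact: csqint_lin.
have Ld := (inL2P d).2 Sd'.
have fE : (fun x => 1 * d x + g x) = f by apply/funext => x; rewrite mul1r subrK.
have E : eqL2 (fun x => H' f x - H f x) (fun x => H' d x - H d x).
  have E1 := hL 1 _ _ Ld Lg; have E2 := h'L 1 _ _ Ld Lg; rewrite !fE in E1 E2.
  have X1 := hX _ Cg; have X2 := h'X _ Cg.
  have Y1 := aeI E1 E2; have Y2 := aeI X1 X2.
  apply: aeS2 Y1 Y2 => x [P1 P2] [Q1 Q2] Rx; rewrite P1// P2// Q1// Q2// !mul1r.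
  by rewrite opprD addrACA subrr addr0.
have bnd (T : (R -> R[i]) -> R -> R[i]) m : (L2norm (T d) <= m%:E * L2norm d)%E -> csqint (T d) ->
    cnrm (T d) <= `|m| * cnrm d.
  move=> + ST; rewrite !L2normE// -EFinM lee_fin => /le_trans; apply.
  by rewrite ler_wpM2r ?cnrm_ge0// ler_norm.
have B1 := bnd _ _ (hM _ Ld) (SH _ Ld); have B2 := bnd _ _ (h'M _ Ld) (SH' _ Ld).
apply: (le_trans (cnrm_triangle (SH' _ Ld) (SH _ Ld) Sd E)).
have dK : K * cnrm d <= e by rewrite mulrC -ler_pdivlMr// ltW.
have := cnrm_ge0 d; move: B1 B2 dK; rewrite /K.
move: (cnrm d) (cnrm _) (cnrm _) => *; nra.
Qed.

Lemma cH_invertible : invertibleL2 cH.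
Proof.
exists (cplx (@opG R)); split.
  apply: (@bounded_cplx _ _ (c1 R * (pi / Num.sqrt 2 * pi) + 1)).
  - by rewrite addr_ge0// mulr_ge0 ?c1_ge0// mulr_ge0 ?pi_ge0// divr_ge0 ?pi_ge0 ?sqrtr_ge0.
  - exact: opG_sqint.
  - exact: opG_aeq.
  - exact: opG_lin.
  - exact: opG_nrm.
move=> f /inL2P[f1 f2]; split; apply/eqL2P; split.
- exact: opG_opH f1.
- exact: opG_opH f2.
- exact: opH_opG f1.
- exact: opH_opG f2.
Qed.

Lemma cH_norm f : inL2 f ->
  ((Num.sqrt 2)%:E * L2norm f <= L2norm (cH f))%E /\ (L2norm (cH f) <= 2%:E * L2norm f)%E.
Proof.
move=> /inL2P Sf; have [f1 f2] := Sf; have SH := cH_csqint Sf.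
rewrite !L2normE// -!EFinM !lee_fin; split.
- by apply: cnrm_mono_ge; [exact: sqrtr_ge0|exact: opH_nrm_ge|exact: opH_nrm_ge].
- by apply: cnrm_mono; [|exact: opH_nrm|exact: opH_nrm].
Qed.

Lemma derivative_integrand_Re f x t :
  complex.Re (derivative_integrand f x t) = dk x t * rep f t.
Proof. by rewrite /derivative_integrand divc_real !Re_realM mulrA. Qed.

Lemma derivative_integrand_Im f x t :
  complex.Im (derivative_integrand f x t) = dk x t * imp f t.
Proof. by rewrite /derivative_integrand divc_real !Im_realM mulrA. Qed.

Lemma derivative_integrable f x : inL2 f -> 0 < x -> cintegrable Rpos (derivative_integrand f x).
Proof.
move=> /inL2P[f1 f2] x0; have Sx := dk_sqint x0; have mR := @measurable_Rpos R; split.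
- by apply: (intg_eq mR _ (sqint_mul Sx f1)) => t _; rewrite derivative_integrand_Re.
- by apply: (intg_eq mR _ (sqint_mul Sx f2)) => t _; rewrite derivative_integrand_Im.
Qed.

(** The integral with kernel [dk] equals the primitive of [opH u] divided by [c0] at every positive
    point, hence near each such point, so Lebesgue differentiation transfers to it. *)
Lemma opH_derivative (u : R -> R) : sqint u -> {ae mu, forall x, 0 < x ->
  is_derive x 1 (fun y => \int[mu]_(t in Rpos) (dk y t * u t)) ((c0 R)^-1 * opH u x)}.
Proof.
move=> Su; have [Sg E] := opH_isH Su; have c00 := c0_gt0 R.
have H := @ae_FTC R (opH u) Sg.1 (fun x _ => sqint_intg_itv x Sg).
apply: aeS H => x H x0.
have D : is_derive x 1 (fun y => (c0 R)^-1 * \int[mu]_(t in `]0, y]) opH u t) ((c0 R)^-1 * opH u x).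
  have H0 := H x0; have := @der_mul R (fun=> (c0 R)^-1) _ x 0 _ (der_cst _ _) H0.
  by move=> H1; apply: (is_derive_eq H1); rewrite mul0r add0r.
apply: near_eq_is_derive D.
near=> y; have y0 : 0 < y by near: y; exact: lt_nbhsr.
by rewrite E// mulKf// gt_eqF.
Unshelve. all: by end_near. Qed.

Lemma cH_derivative f : inL2 f -> {ae mu, forall x : R, 0 < x ->
  exists2 d : R[i], is_cderive x (fun y : R => cintegral Rpos (derivative_integrand f y)) d
    & cH f x = (Num.sqrt (2 / pi))%:C * d}.
Proof.
move=> /inL2P[f1 f2]; apply: aeS2 (opH_derivative f1) (opH_derivative f2) => x D1 D2 x0.
have c00 : c0 R != 0 by rewrite gt_eqF// c0_gt0.
exists (((c0 R)^-1 * opH (rep f) x) +i* ((c0 R)^-1 * opH (imp f) x)); last first.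
  apply/eqP; rewrite eq_complex Re_realM Im_realM /=.
  by rewrite -/(c0 R) !mulVKf// !eqxx.
split => /=.
- have -> : (fun y => \int[mu]_(t in Rpos) complex.Re (derivative_integrand f y t)) =
      (fun y => \int[mu]_(t in Rpos) (dk y t * rep f t)).
    by apply/funext => y; apply: Rint_eq => t _; rewrite derivative_integrand_Re.
  exact: D1.
- have -> : (fun y => \int[mu]_(t in Rpos) complex.Im (derivative_integrand f y t)) =
      (fun y => \int[mu]_(t in Rpos) (dk y t * imp f t)).
    by apply/funext => y; apply: Rint_eq => t _; rewrite derivative_integrand_Im.
  exact: D2.
Qed.

(** Agrees with [fresnel_cos] at positive arguments; in this form measurability and boundedness are
    immediate. *)
Let fc (u : R) : R := 2^-1 * cas u - Num.sqrt 2 / pi * fresnel_tail u.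

Let fc_measurable : measurable_fun setT fc.
Proof.
apply: measurable_funB; apply: measurable_funM => //.
- by apply: continuous_measurable_fun; exact: cas_continuous.
- exact: measurable_fresnel_tail.
Qed.

Let fc_bounded : exists B, forall u, 0 < u -> `|fc u| <= B.
Proof.
exists (1 + Num.sqrt 2 / pi * (pi / Num.sqrt 2)) => u u0.
apply: (le_trans (ler_normB _ _)); apply: lerD.
  rewrite normrM (ger0_norm (_ : 0 <= 2^-1))// ler_pdivrMl// mulr1.
  exact: cas_bound.
rewrite normrM (ger0_norm (fresnel_tail_ge0 _)) ger0_norm; last first.
  by rewrite divr_ge0 ?sqrtr_ge0 ?pi_ge0.
apply: ler_wpM2l; first by rewrite divr_ge0 ?sqrtr_ge0 ?pi_ge0.
apply: (le_trans (fresnel_tail_le u0)); rewrite -[leRHS]mulr1.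
apply: ler_wpM2l; first by rewrite divr_ge0 ?sqrtr_ge0 ?pi_ge0.
by rewrite invf_le1 ?lerDl ?addr_gt0// ltW.
Qed.

Definition inv_trunc (u : R -> R) N x := \int[mu]_(t in `]0, N[) (fresnel_cos (x * t) * u t).

Lemma sub_itv_oo_Rpos (N : R) : `]0, N[%classic `<=` @Rpos R.
Proof. by move=> t; rewrite in_Rpos /= in_itv /= => /andP[]. Qed.

Lemma inv_trunc_intg (u : R -> R) N x : sqint u -> 0 < x ->
  intg `]0, N[ (fun t => fresnel_cos (x * t) * u t).
Proof.
move=> Su x0; have [B HB] := fc_bounded; have m := measurable_itv `]0, N[.
have pos t : `]0, N[%classic t -> 0 < t by rewrite /= in_itv /= => /andP[].
have iu : intg `]0, N[ u.
  apply: intgS (sqint_intg_itv N Su) => //.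
  by move=> t /=; rewrite !in_itv /= => /andP[-> /ltW ->].
apply: (@intg_eq _ _ (fun t => fc (x * t) * u t) _ m).
  by move=> t /pos t0; rewrite fresnel_cos_tail ?mulr_gt0.
apply: (@intgM _ _ _ _ B m) => //; last by move=> t /pos t0; apply: HB; exact: mulr_gt0.
apply: measurable_funTS; apply: measurableT_comp; first exact: fc_measurable.
exact: measurable_funM.
Qed.

Definition cut (u : R -> R) N : R -> R := fun t => \1_(`]0, N[) t * u t.

Lemma cut_le (u : R -> R) N t : `|cut u N t| <= `|u t|.
Proof.
rewrite /cut indicE; case: (_ \in _); rewrite ?mul1r// mul0r normr0//.
Qed.

Lemma cut_sqint (u : R -> R) N : sqint u -> sqint (cut u N).
Proof.
move=> Su; apply: sqint_le (sqint_norm Su).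
  by apply: measurable_funM; [apply: measurable_funTS; exact: measurable_indic|exact: Su.1].
by move=> t _; exact: cut_le.
Qed.

Lemma Rint_cut (k u : R -> R) N :
  \int[mu]_(t in `]0, N[) (k t * u t) = \int[mu]_(t in Rpos) (k t * cut u N t).
Proof.
rewrite Rintegral_mkcond [RHS]Rintegral_mkcond; apply: eq_Rintegral => t _.
rewrite !patchE /cut indicE; case: ifPn => [tx|_]; last by rewrite mul0r mulr0 if_same.
by rewrite mul1r ifT//; move: tx; rewrite !inE => /sub_itv_oo_Rpos.
Qed.

Lemma cut_intg (u : R -> R) N : sqint u -> intg Rpos (cut u N).
Proof.
move=> Su; have := sqint_mul (sqint_indic N) (cut_sqint N Su).
apply: intg_eq; first exact: measurable_Rpos.
move=> t _; rewrite /cut !indicE.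
have [H|H] := pselect (`]0, N[%classic t); last by rewrite (memNset H) mul0r mulr0.
rewrite (mem_set H) mem_set ?mul1r//.
by move: H; rewrite /= !in_itv /= => /andP[-> /ltW ->].
Qed.

(** Cutting to the bounded interval ]0, N[ makes an L_2 function integrable, so [opG_integral]
    applies to it. Measurability in [x] is read off from the form with [fc]. *)
Lemma inv_trunc_opG (u : R -> R) N : sqint u ->
  sqint (inv_trunc u N) /\ aeq (inv_trunc u N) ((c0 R)^-1 *: opG (cut u N)).
Proof.
move=> Su; have Sc := cut_sqint N Su; have c00 : c0 R != 0 by rewrite gt_eqF// c0_gt0.
have E : aeq (inv_trunc u N) ((c0 R)^-1 *: opG (cut u N)).
  apply: aeS (opG_integral Sc (cut_intg N Su)) => x H Rx.
  transitivity ((c0 R)^-1 * opG (cut u N) x) => //.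
  by rewrite (H Rx) mulKf// /inv_trunc Rint_cut.
split => //; apply: (@eq_sqint _ ((c0 R)^-1 *: opG (cut u N))).
- apply: (@eq_measurable_fun _ _ _ _ _ (fun x => \int[mu]_(t in Rpos) (fc (x * t) * cut u N t))).
    move=> x /set_mem; rewrite in_Rpos => x0; rewrite /inv_trunc Rint_cut.
    by apply: Rint_eq => t; rewrite in_Rpos => t0; rewrite fresnel_cos_tail ?mulr_gt0.
  apply: measurable_funTS; apply: measurable_Rint => //; last exact: Sc.1.
  by apply: measurableT_comp; [exact: fc_measurable|exact: measurable_funM].
- exact: aeq_sym.
- by apply: sqintZ; exact: opG_sqint.
Qed.

(** Take [h] close to [u] and vanishing beyond [b]. For N > b the error is 0 on ]0, N[ and equals |u
    - h| elsewhere on the half-line, so it is dominated by |u - h|. *)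
Lemma cut_cvg (u : R -> R) e : sqint u -> 0 < e ->
  exists b, forall N, b < N -> nrm (cut u N - u) < e.
Proof.
move=> Su e0; have [h [Lh _ dh]] := lipc_dense Su e0.
have Sh := lipc_sqint Lh; have [a [b [B [C [_ [_ _ h0] _]]]]] := Lh.
exists b => N bN; have Sd := sqintB Su Sh.
apply: (le_lt_trans _ dh); rewrite (_ : nrm (u - h) = nrm (fun x => `|(u - h) x|)); last first.
  by congr Num.sqrt; apply: Rint_eq => t _; rewrite -!expr2 real_normK ?num_real.
apply: nrm_le; [by apply: sqintB => //; exact: cut_sqint|exact: sqint_norm|].
move=> t t0; rewrite !fctE /cut indicE.
have [H|nt] := pselect (`]0, N[%classic t); first by rewrite (mem_set H) mul1r subrr normr0.
rewrite (memNset nt) mul0r sub0r normrN h0 ?subr0//; apply/negP => /andP[_ tb]; apply: nt.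
by rewrite /= in_itv /= t0 (le_lt_trans tb).
Qed.

(** Since u = G H u, the error is G applied to the truncation error of H u, divided by [c0]. The
    bound [K] of [opG_nrm] explains the tolerance e c0 / K. *)
Lemma inv_trunc_cvg (u : R -> R) e : sqint u -> 0 < e ->
  exists b, forall N, b < N -> nrm (inv_trunc (opH u) N - (c0 R)^-1 *: u) < e.
Proof.
move=> Su e0; have SH := opH_sqint Su; have c00 := c0_gt0 R.
set K := (c1 R * (pi / Num.sqrt 2 * pi) + 1).
have K0 : 0 < K.
  by rewrite ltr_wpDl// mulr_ge0 ?c1_ge0// mulr_ge0 ?pi_ge0// divr_ge0 ?pi_ge0 ?sqrtr_ge0.
have e1 : 0 < e * c0 R / K by rewrite divr_gt0// mulr_gt0.
have [b Hb] := cut_cvg SH e1; exists b => N bN.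
have Sc := cut_sqint N SH; have SD := sqintB Sc SH; have [SI E] := inv_trunc_opG N SH.
have SG := opG_sqint SD; have Sc0 := sqintZ (c0 R)^-1 Su.
have E2 : aeq (inv_trunc (opH u) N - (c0 R)^-1 *: u) ((c0 R)^-1 *: opG (cut (opH u) N - opH u)).
  have L := opG_lin (-1) SH Sc; rewrite !scaleN1r !(addrC (- _)) in L.
  have Y := aeI E (opG_opH Su); apply: aeS2 Y L => x [P1 P2] P3 Rx.
  transitivity (inv_trunc (opH u) N x - (c0 R)^-1 * u x) => //.
  transitivity ((c0 R)^-1 * opG (cut (opH u) N - opH u) x) => //.
  rewrite (P1 Rx) (P3 Rx); transitivity ((c0 R)^-1 * opG (cut (opH u) N) x - (c0 R)^-1 * u x) => //.
  by rewrite -(P2 Rx) -mulrBr.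
rewrite (aeq_nrm _ _ E2); [|exact: sqintB|exact: sqintZ].
rewrite nrmZ// ger0_norm ?invr_ge0; last exact: ltW.
rewrite mulrC ltr_pdivrMr//; apply: (le_lt_trans (opG_nrm SD)); rewrite -/K.
by rewrite mulrC -ltr_pdivlMr//; exact: Hb.
Qed.

Lemma inversion_integrand_Re f x t :
  complex.Re (inversion_integrand f x t) = fresnel_cos (x * t) * rep f t.
Proof. exact: Re_realM. Qed.

Lemma inversion_integrand_Im f x t :
  complex.Im (inversion_integrand f x t) = fresnel_cos (x * t) * imp f t.
Proof. exact: Im_realM. Qed.

Lemma cH_inversion f : inL2 f ->
  (forall x N : R, 0 < x -> 0 < N -> cintegrable `]0, N[ (inversion_integrand (cH f) x))
  /\ exists2 g : R -> R[i],
       cvgL2 (fun N x : R => cintegral `]0, N[ (inversion_integrand (cH f) x)) g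
       & {ae leb R, forall x : R, 0 < x -> f x = (Num.sqrt (2 / pi))%:C * g x}.
Proof.
move=> /inL2P Sf; have [f1 f2] := Sf; have [H1 H2] := cH_csqint Sf.
have c00 : c0 R != 0 by rewrite gt_eqF// c0_gt0.
split.
  move=> x N x0 _; have m := measurable_itv `]0, N[; split.
  - by apply: (intg_eq m _ (inv_trunc_intg N H1 x0)) => t _; rewrite inversion_integrand_Re.
  - by apply: (intg_eq m _ (inv_trunc_intg N H2 x0)) => t _; rewrite inversion_integrand_Im.
(* The truncated integrals carry no factor sqrt(2/pi), so their limit is [f] divided by [c0]. *)
exists (fun x => ((c0 R)^-1)%:C * f x); last first.
  by apply/aeW => x _; rewrite mulrA -rmorphM /= -/(c0 R) divff// mul1r.
pose F N x := cintegral `]0, N[ (inversion_integrand (cH f) x).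
have F1 N : rep (F N) = inv_trunc (opH (rep f)) N.
  by apply/funext => x; apply: Rint_eq => t _; rewrite inversion_integrand_Re.
have F2 N : imp (F N) = inv_trunc (opH (imp f)) N.
  by apply/funext => x; apply: Rint_eq => t _; rewrite inversion_integrand_Im.
have g1 : rep (fun x => ((c0 R)^-1)%:C * f x) = (c0 R)^-1 *: rep f.
  by apply/funext => x; rewrite /rep Re_realM.
have g2 : imp (fun x => ((c0 R)^-1)%:C * f x) = (c0 R)^-1 *: imp f.
  by apply/funext => x; rewrite /imp Im_realM.
have SF N : csqint (F N).
  by rewrite /csqint F1 F2; split; [exact: (inv_trunc_opG N H1).1|exact: (inv_trunc_opG N H2).1].
have Sg : csqint (fun x => ((c0 R)^-1)%:C * f x).
  by rewrite /csqint g1 g2; split; exact: sqintZ.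
split; [by move=> N _; apply/inL2P; exact: SF|exact/inL2P|].
have D1 N : rep (fun x => F N x - ((c0 R)^-1)%:C * f x) =
    inv_trunc (opH (rep f)) N - (c0 R)^-1 *: rep f.
  by rewrite -F1 -g1; apply/funext => x; rewrite /rep !fctE; case: (F N x); case: (_ * _).
have D2 N : imp (fun x => F N x - ((c0 R)^-1)%:C * f x) =
    inv_trunc (opH (imp f)) N - (c0 R)^-1 *: imp f.
  by rewrite -F2 -g2; apply/funext => x; rewrite /imp !fctE; case: (F N x); case: (_ * _).
have SD N : csqint (fun x => F N x - ((c0 R)^-1)%:C * f x).
  rewrite /csqint D1 D2; split; apply: sqintB; rewrite -?F1 -?F2; try exact: sqintZ.
  + exact: (SF N).1.
  + exact: (SF N).2.
have -> : (fun N => L2norm (fun x => F N x - ((c0 R)^-1)%:C * f x)) =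
    (fun N => (cnrm (fun x => F N x - ((c0 R)^-1)%:C * f x))%:E).
  by apply/funext => N; rewrite L2normE.
apply: cvg_EFin; first by apply: nearW.
apply/cvgr0Pnorm_le => e e0; have e2 : 0 < e / 2 by rewrite divr_gt0.
have [b1 B1] := inv_trunc_cvg f1 e2; have [b2 B2] := inv_trunc_cvg f2 e2.
near=> N; have N1 : b1 < N by near: N; apply: nbhs_pinfty_gt; exact: num_real.
have N2 : b2 < N by near: N; apply: nbhs_pinfty_gt; exact: num_real.
rewrite /= ger0_norm ?cnrm_ge0//.
apply: (le_trans (cnrm_leD _)); rewrite D1 D2 [leRHS]splitr.
apply: lerD; apply: ltW; [exact: B1|exact: B2].
Unshelve. all: by end_near. Qed.

End ComplexHartley.

Local Open Scope complex_scope.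

Theorem theorem1 (R : realType) :
  exists H : (R -> R[i]) -> R -> R[i],
    [/\ bounded_extension H
          /\ (forall H' : (R -> R[i]) -> R -> R[i], bounded_extension H' ->
               forall f : R -> R[i], inL2 f -> eqL2 (H' f) (H f)),
        invertibleL2 H,
        forall f : R -> R[i], inL2 f ->
          (forall x : R, 0 < x -> cintegrable Rpos (derivative_integrand f x))
          /\ {ae leb R, forall x : R, 0 < x ->
               exists2 d : R[i],
                 is_cderive x (fun y : R => cintegral Rpos (derivative_integrand f y)) d
                 & H f x = (Num.sqrt (2 / pi))%:C * d},
        forall f : R -> R[i], inL2 f ->
          (forall x N : R, 0 < x -> 0 < N ->
             cintegrable `]0, N[ (inversion_integrand (H f) x))
          /\ exists2 g : R -> R[i],
               cvgL2 (fun N x : R => cintegral `]0, N[ (inversion_integrand (H f) x)) g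
               & {ae leb R, forall x : R, 0 < x ->
                   f x = (Num.sqrt (2 / pi))%:C * g x}
      & forall f : R -> R[i], inL2 f ->
          ((Num.sqrt 2)%:E * L2norm f <= L2norm (H f))%E
          /\ (L2norm (H f) <= 2%:E * L2norm f)%E].
Proof.
exists (@cH R); split.
- by split; [exact: cH_extension|move=> H' HH' f; exact: extension_unique (@cH_extension R) HH' f].
- exact: cH_invertible.
- by move=> f Lf; split; [move=> x; exact: derivative_integrable|exact: cH_derivative].
- exact: cH_inversion.
- exact: cH_norm.
Qed.
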